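(* Fix $\alpha>1/2$, $\nu>0$ and a sequence of real numbers $v_n\to\infty$. Define $$\beta:=\frac{1}{1+8\alpha}\qquad\text{and}\qquad k_n:=\big\lfloor n^{\beta}\log(n)^{-2\alpha}\big\rfloor .$$ Then, with probability tending to $1$ as $n\to\infty$, the nodes of the random hyperbolic graph $\mathcal{G}_{\alpha,\nu}(n)$, ordered by increasing radius as $X_{(1)}^n,\dots,X_{(n)}^n$, satisfy both of the following: (i) for all $i\in\{1,\dots,n\}$ with $i>k_n$, $$\deg(X_{(1)}^n)>\deg(X_{(2)}^n)>\dots>\deg(X_{(k_n)}^n)>\deg(X_{(i)}^n);$$ (ii) there exists an integer $i\in[n^{\beta},\,n^{\beta}v_n]$ (with $i+1\le n$) such that $$\deg(X_{(i)}^n)<\deg(X_{(i+1)}^n).$$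
   Context: Hyperbolic plane: $\mathbb{H}$ is the Poincaré disc (open unit disc of $\mathbb{C}$ with metric $4\mathbf{g}_{\mathbb{C}}/(1-|w|^2)^2$, where $\mathbf{g}_{\mathbb{C}}$ is the Euclidean metric), with distance $d_{\mathbb{H}}$. A point $w$ has polar coordinates $(r(w),\theta(w))$, where $r(w)$ is its hyperbolic distance to the origin (its radius) and $\theta(w)$ its angle. For points $x=(r,\theta)$, $y=(s,\beta')$: $\cosh d_{\mathbb{H}}(x,y)=\cosh r\cosh s-\sinh r\sinh s\cos(\theta-\beta')$. Random hyperbolic graph $\mathcal{G}_{\alpha,\nu}(n)$: for $\alpha,\nu>0$ and $n\in\mathbb{N}^*$ (with $n>\nu$), set $R_n:=2\log(n/\nu)$. Let $\mu_n$ be the probability measure on $\mathbb{H}$ under which the polar coordinates $r,\theta$ are independent, $\theta$ is uniform on $(-\pi,\pi]$, and $r$ has density $\rho_n(r)=\frac{\alpha\sinh(\alpha r)}{\cosh(\alpha R_n)-1}\mathbf{1}_{\{r<R_n\}}$ on $\mathbb{R}_+$. The nodes $X_1^n,\dots,X_n^n$ are i.i.d. with law $\mu_n$, and two distinct nodes are joined by an (undirected) edge if and only if their hyperbolic distance is at most $R_n$. $\deg(X)$ denotes the number of neighbours of the node $X$ in the graph. $X_{(1)}^n,\dots,X_{(n)}^n$ denotes a reordering of the nodes by increasing radius: $r(X_{(1)}^n)\le\dots\le r(X_{(n)}^n)$ (almost surely there are no ties). *)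

(* Defs.v *)
From HB Require Import structures.
From mathcomp Require Import all_boot all_order all_algebra perm.
From mathcomp Require Import all_classical all_reals all_analysis.
From mathcomp Require Import measurable_realfun.
From mathcomp Require Import ring lra.

Set Implicit Arguments.
Unset Strict Implicit.
Unset Printing Implicit Defensive.

Import Order.TTheory GRing.Theory Num.Theory.
Import numFieldNormedType.Exports.

Local Open Scope classical_set_scope.
Local Open Scope ring_scope.

Section hyperbolic_functions.
Context {R : realType}.
Implicit Types x y r s : R.

Definition cosh x := (expR x + expR (- x)) / 2.
Definition sinh x := (expR x - expR (- x)) / 2.

(* The nonnegative inverse of [cosh] on [1, +oo[. *)
Definition arcosh x := ln (x + Num.sqrt (x ^+ 2 - 1)).

Lemma cosh0 : cosh 0 = 1.
Proof. by rewrite /cosh oppr0 expR0; field. Qed.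

Lemma cosh2B_sinh2 x : cosh x ^+ 2 - sinh x ^+ 2 = 1.
Proof. by rewrite -[RHS](expRxMexpNx_1 x) /cosh /sinh; field. Qed.

Lemma coshB x y : cosh (x - y) = cosh x * cosh y - sinh x * sinh y.
Proof. by rewrite /cosh /sinh opprB !expRD; field. Qed.

Lemma cosh_ge1 x : 1 <= cosh x.
Proof.
have h := expRxMexpNx_1 x; have := expR_gt0 x; have := expR_gt0 (- x).
rewrite /cosh; have := sqr_ge0 (expR x - expR (- x)); nra.
Qed.

Lemma sinh_ge0 x : 0 <= x -> 0 <= sinh x.
Proof.
move=> x0; rewrite /sinh divr_ge0 // subr_ge0 ler_expR; lra.
Qed.

Lemma sinhN x : sinh (- x) = - sinh x.
Proof. by rewrite /sinh opprK; field. Qed.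

Lemma cosh_gt1 x : 0 < x -> 1 < cosh x.
Proof.
move=> x0; have h := expRxMexpNx_1 x.
have p : 1 < expR x by rewrite expR_gt1.
have := expR_gt0 (- x); rewrite /cosh; nra.
Qed.

Lemma arcosh_ge0 x : 1 <= x -> 0 <= arcosh x.
Proof. by move=> x1; apply: ln_ge0; have := sqrtr_ge0 (x ^+ 2 - 1); lra. Qed.

Lemma arcoshK x : 1 <= x -> cosh (arcosh x) = x.
Proof.
move=> x1; have q0 := sqrtr_ge0 (x ^+ 2 - 1).
have qE : Num.sqrt (x ^+ 2 - 1) ^+ 2 = x ^+ 2 - 1 by rewrite sqr_sqrtr //; nra.
rewrite /cosh /arcosh expRN lnK ?posrE; last by lra.
move: q0 qE; set q := Num.sqrt _ => q0 qE.
have y0 : x + q != 0 by rewrite gt_eqF //; lra.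
have -> : (x + q)^-1 = x - q.
  by apply: (mulfI y0); rewrite divff // mulrC -subr_sqr qE; ring.
by field.
Qed.

Lemma coshK x : 0 <= x -> arcosh (cosh x) = x.
Proof.
move=> x0; rewrite /arcosh.
have -> : cosh x ^+ 2 - 1 = sinh x ^+ 2 by rewrite -(cosh2B_sinh2 x); ring.
rewrite sqrtr_sqr ger0_norm ?sinh_ge0 //.
have -> : cosh x + sinh x = expR x by rewrite /cosh /sinh; field.
by rewrite expRK.
Qed.

End hyperbolic_functions.

(* A point of the hyperbolic plane is given by its polar coordinates: (r, t) is
   the point of the Poincare disc at hyperbolic distance r from the origin and
   with angle t. *)
Definition hradius {R : realType} (x : R * R) : R := x.1.
Definition hangle {R : realType} (x : R * R) : R := x.2.

(* Hyperbolic law of cosines; [cosh_hdist_disc] relates it to the disc. *)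
Definition hdist {R : realType} (x y : R * R) : R :=
  arcosh (cosh (hradius x) * cosh (hradius y)
          - sinh (hradius x) * sinh (hradius y) * cos (hangle x - hangle y)).

Section hdist_theory.
Context {R : realType}.
Implicit Types x y : R * R.

Lemma cosh_hdist x y : 0 <= hradius x -> 0 <= hradius y ->
  cosh (hdist x y) = cosh (hradius x) * cosh (hradius y)
    - sinh (hradius x) * sinh (hradius y) * cos (hangle x - hangle y).
Proof.
move=> x0 y0; rewrite /hdist arcoshK //.
have := cosh_ge1 (hradius x - hradius y); rewrite coshB.
have := mulr_ge0 (sinh_ge0 x0) (sinh_ge0 y0).
have := cos_le1 (hangle x - hangle y).
by set c := cos _; set p := sinh _ * _; nra.
Qed.

(* Cartesian coordinates: the Euclidean modulus is tanh (r / 2). *)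
Definition disc_point x : R * R :=
  let t := sinh (hradius x / 2) / cosh (hradius x / 2) in
  (t * cos (hangle x), t * sin (hangle x)).

Lemma cosh_hdist_disc x y : 0 <= hradius x -> 0 <= hradius y ->
  let u := disc_point x in let v := disc_point y in
  cosh (hdist x y) = 1 + 2 * ((u.1 - v.1) ^+ 2 + (u.2 - v.2) ^+ 2)
    / ((1 - (u.1 ^+ 2 + u.2 ^+ 2)) * (1 - (v.1 ^+ 2 + v.2 ^+ 2))).
Proof.
move=> x0 y0 /=; rewrite cosh_hdist // cosB.
have dbl (r : R) : cosh r = cosh (r / 2) ^+ 2 + sinh (r / 2) ^+ 2
    /\ sinh r = 2 * (sinh (r / 2) * cosh (r / 2)).
  have e : r = r / 2 + r / 2 by field.
  by split; rewrite {1}e /cosh /sinh opprD !expRD; field.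
have [cx sx] := dbl (hradius x); have [cy sy] := dbl (hradius y).
rewrite {}cx {}sx {}cy {}sy.
have := cosh2B_sinh2 (hradius x / 2); have := cosh2B_sinh2 (hradius y / 2).
have := cosh_ge1 (hradius x / 2); have := cosh_ge1 (hradius y / 2).
have := cos2Dsin2 (hangle x); have := cos2Dsin2 (hangle y).
set C := cosh (hradius x / 2); set S := sinh (hradius x / 2).
set C' := cosh (hradius y / 2); set S' := sinh (hradius y / 2).
set a := cos (hangle x); set b := sin (hangle x).
set a' := cos (hangle y); set b' := sin (hangle y).
move=> ey ex C'1 C1 eC' eC.
have C0 : C != 0 by rewrite gt_eqF //; lra.
have C'0 : C' != 0 by rewrite gt_eqF //; lra.
have SE : S ^+ 2 = C ^+ 2 - 1 by rewrite -[X in _ - X]eC; ring.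
have S'E : S' ^+ 2 = C' ^+ 2 - 1 by rewrite -[X in _ - X]eC'; ring.
have n1 : 1 - ((S / C * a) ^+ 2 + (S / C * b) ^+ 2) = (C ^+ 2)^-1.
  transitivity (1 - (S / C) ^+ 2 * (a ^+ 2 + b ^+ 2)); first by ring.
  by rewrite ex expr_div_n SE; field.
have n2 : 1 - ((S' / C' * a') ^+ 2 + (S' / C' * b') ^+ 2) = (C' ^+ 2)^-1.
  transitivity (1 - (S' / C') ^+ 2 * (a' ^+ 2 + b' ^+ 2)); first by ring.
  by rewrite ey expr_div_n S'E; field.
rewrite n1 n2.
have n3 : (S / C * a - S' / C' * a') ^+ 2 + (S / C * b - S' / C' * b') ^+ 2
    = (S / C) ^+ 2 * (a ^+ 2 + b ^+ 2) + (S' / C') ^+ 2 * (a' ^+ 2 + b' ^+ 2)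
      - 2 * (S / C) * (S' / C') * (a * a' + b * b') by ring.
rewrite n3 ex ey.
rewrite (expr_div_n S C) (expr_div_n S' C') SE S'E.
by field; rewrite C0 C'0.
Qed.

Lemma hdist_origin (t : R) x : 0 <= hradius x -> hdist (0, t) x = hradius x.
Proof.
move=> x0; rewrite /hdist /= cosh0 mul1r.
by rewrite (_ : sinh 0 = 0) ?mul0r ?subr0 ?coshK // /sinh oppr0 subrr mul0r.
Qed.

End hdist_theory.

Section radial_law.
Context {R : realType}.
Variables a L : R.

Definition radial_pdf : R -> R :=
  (fun r => a * sinh (a * r) / (cosh (a * L) - 1)) \_ `[0, L[.

Definition radial_law :=
  fun A => (\int[lebesgue_measure]_(r in A) (radial_pdf r)%:E)%E.

Lemma radial_pdf_ge0 r : 0 <= radial_pdf r.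
Proof.
apply: restrict_ge0 => {}r /=; rewrite in_itv /= => /andP[r0 _].
rewrite divr_ge0 // ?subr_ge0 ?cosh_ge1 //.
have [a0|/ltW a0] := leP 0 a.
  by rewrite mulr_ge0 // sinh_ge0 // mulr_ge0.
rewrite -mulrNN -sinhN mulr_ge0 ?oppr_ge0 // sinh_ge0 // -mulNr.
by rewrite mulr_ge0 // oppr_ge0.
Qed.

Let pdfT (r : R) := a * sinh (a * r) / (cosh (a * L) - 1).

Let continuous_pdfT : continuous pdfT.
Proof.
move=> x; apply: cvgM; last exact: cvg_cst.
apply: cvgM; first exact: cvg_cst.
apply: cvgM; last exact: cvg_cst.
have h : {for x, continuous (fun r : R => a * r)}.
  by apply: cvgM; [exact: cvg_cst|exact: cvg_id].
apply: cvgB.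
  by apply: (continuous_comp h); exact: continuous_expR.
apply: (@continuous_comp _ _ _ (fun r : R => - (a * r)) expR).
  exact: cvgN.
exact: continuous_expR.
Qed.

Lemma measurable_radial_pdf : measurable_fun [set: R] radial_pdf.
Proof.
apply/measurable_restrict => //; apply: measurable_funTS.
exact: (continuous_measurable_fun continuous_pdfT).
Qed.

Let radial_law0 : radial_law set0 = 0%E.
Proof. by rewrite /radial_law integral_set0. Qed.

Let radial_law_ge0 A : (0 <= radial_law A)%E.
Proof. by apply: integral_ge0 => r _; rewrite lee_fin radial_pdf_ge0. Qed.

Let radial_law_sigma_additive : semi_sigma_additive radial_law.
Proof.
move=> /= F mF tF mUF; rewrite /radial_law; apply: cvg_toP.
  apply: ereal_nondecreasing_is_cvgn => m n mn.
  apply: lee_sum_nneg_natr => // k _ _.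
  by apply: integral_ge0 => /= x Fkx; rewrite lee_fin radial_pdf_ge0.
rewrite ge0_integral_bigcup//=.
- apply: measurable_funTS; apply: measurableT_comp => //.
  exact: measurable_radial_pdf.
- by move=> x _; rewrite lee_fin radial_pdf_ge0.
Qed.

HB.instance Definition _ := isMeasure.Build _ _ _ radial_law
  radial_law0 radial_law_ge0 radial_law_sigma_additive.

Lemma radial_law_setT : 0 < a -> 0 < L -> radial_law [set: R] = 1%E.
Proof.
move=> a0 L0.
have c0 : cosh (a * L) - 1 != 0.
  by rewrite subr_eq0 gt_eqF // cosh_gt1 // mulr_gt0.
pose F (r : R) := cosh (a * r) / (cosh (a * L) - 1).
have dF (x : R) : is_derive x 1 F (pdfT x).
  rewrite /F /pdfT; move: c0; set c := cosh (a * L) - 1 => c0.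
  rewrite /cosh /sinh; apply: is_derive_eq.
  rewrite /GRing.scale /=. by field.
have cF : continuous F.
  by move=> x; apply: differentiable_continuous; apply/derivable1_diffP.
rewrite /radial_law.
transitivity (\int[lebesgue_measure]_(r in `[0%R, L[) (pdfT r)%:E)%E.
  by rewrite [RHS]integral_mkcond restrict_EFin.
rewrite integral_itv_bndo_bndc; last first.
  by apply: measurable_funTS; apply/measurable_EFinP; exact: continuous_measurable_fun.
rewrite (@continuous_FTC2 _ _ F) //.
- by rewrite /F mulr0 cosh0 -EFinB -mulrBl divff.
- exact: continuous_subspaceT.
- split.
  + by move=> z _; exact: ex_derive.
  + by apply: cvg_at_right_filter; exact: cF.
  + by apply: cvg_at_left_filter; exact: cF.
- by move=> z _; rewrite derive1E; exact: derive_val.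
Qed.

End radial_law.

Lemma ltNpi (R : realType) : - pi < pi :> R.
Proof. by have := pi_gt0 R; lra. Qed.

(* The law of a node, in polar coordinates: independent radius and angle, the
   angle being uniform. The library uses the closed interval [-pi, pi], which
   gives the same measure as (-pi, pi]. *)
Definition node_law {R : realType} (a L : R) :=
  (radial_law a L \x uniform_prob (ltNpi R))%E.

Section node_law.
Context {R : realType}.
Variables a L : R.

HB.instance Definition _ := Measure.copy (node_law a L)
  (radial_law a L \x uniform_prob (ltNpi R))%E.

Lemma node_lawE (A B : set R) : measurable A -> measurable B ->
  node_law a L (A `*` B) = (radial_law a L A * uniform_prob (ltNpi R) B)%E.
Proof.
move=> mA mB; rewrite /node_law.
exact: (product_measure1E (radial_law a L) (uniform_prob (ltNpi R)) mA mB).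
Qed.

Lemma node_law_setT : 0 < a -> 0 < L -> node_law a L [set: R * R] = 1%E.
Proof.
move=> a0 L0; rewrite -setXTT node_lawE // radial_law_setT //.
by rewrite probability_setT mule1.
Qed.

End node_law.

Definition mutually_independent d d' (T : measurableType d)
    (T' : measurableType d') (R : realType) (P : probability T R) (I : finType)
    (X : I -> {RV P >-> T'}) : Prop :=
  forall (J : {set I}) (A : I -> set T'), (forall i, measurable (A i)) ->
    P [set w | forall i, i \in J -> A i (X i w)]
    = (\prod_(i in J) P (X i @^-1` A i))%E.

Definition iid_with_law d d' (T : measurableType d)
    (T' : measurableType d') (R : realType) (P : probability T R) (I : finType)
    (law : set T' -> \bar R) (X : I -> {RV P >-> T'}) : Prop :=
  mutually_independent X /\
  forall i A, measurable A -> distribution P (X i) A = law A.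

Section random_hyperbolic_graph.
Context {R : realType}.
Implicit Types (nu : R) (n : nat).

Definition rhg_radius nu n : R := 2 * ln (n%:R / nu).

Definition rhg_adj nu n (x : 'I_n -> R * R) : rel 'I_n :=
  fun i j => (i != j) && (hdist (x i) (x j) <= rhg_radius nu n).

Definition rhg_deg nu n (x : 'I_n -> R * R) (i : 'I_n) : nat :=
  #|rhg_adj nu x i|.

(* Nodes of the random hyperbolic graph; meaningful when nu < n, that is when
   [rhg_radius nu n] is positive. *)
Definition rhg_nodes d (T : measurableType d) (P : probability T R)
    (alpha nu : R) n (X : 'I_n -> {RV P >-> (R * R)%type}) : Prop :=
  iid_with_law (node_law alpha (rhg_radius nu n) : set (R * R) -> \bar R) X.

(* [s i] is the index of the node of rank i.+1: ordinals are 0-based whereas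
   ranks start at 1. *)
Definition radius_ordering n (x : 'I_n -> R * R) (s : 'S_n) : Prop :=
  forall i j : 'I_n, (i <= j)%N -> hradius (x (s i)) <= hradius (x (s j)).

End random_hyperbolic_graph.

(* Main.v *)
(* Conditionally on its position, a node at radius r has a binomial degree of
   mean F(r), of order n exp(-r/2), and r -> F(r) decreases at rate of order
   F(r).

   (i) By Chernoff's bound all degrees are within O(sqrt(F log n)) of F. A first
   moment computation shows that among the nodes of radius at most t, where
   about K = O(k_n) nodes are found, no radius is followed by another one within
   eta = O(sqrt(log n / F(t))), as K^2 eta -> 0; beyond that distance the mean
   degrees differ by more than the fluctuations.

   (ii) In a window [t0, t0 + 1) of radii containing about K = n^beta w nodes,
   with w -> oo slowly, cut the radii into about sqrt(F) / eps^2 cells; the number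
   of cells with exactly two nodes is of order K^2 eps^2 / sqrt(F) and tends to
   infinity. Exchanging the angles of the two nodes of any set of such cells
   preserves the law. By Littlewood-Offord anticoncentration, the degree
   difference of the two nodes of a cell is typically larger than the effect of
   the difference of their radii and of all other nodes of the window, so that
   one of the two states of the cell produces an inversion whatever the state of
   the other cells: with g such cells at most a fraction 2^-g of the states has
   no inversion. *)
Require Import Defs.
From HB Require Import structures.
From mathcomp Require Import all_boot all_order all_algebra perm.
From mathcomp Require Import all_classical all_reals all_analysis.
From mathcomp Require Import measurable_realfun.
From mathcomp Require Import ring lra zify.

Set Implicit Arguments.
Unset Strict Implicit.
Unset Printing Implicit Defensive.

Import Order.TTheory GRing.Theory Num.Theory.
Import numFieldNormedType.Exports.

Local Open Scope classical_set_scope.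
Local Open Scope ring_scope.

(** * Independence *)

(** Where [beta] comes from: let [K = n exp(- alpha (L - t))] be the order of the number of nodes
    below radius [t] and [D = n exp(- t / 2)] that of their degrees. As [1 - beta = 8 alpha beta],
    solving [K = n^beta] makes [D] of order [n^(4 beta)], so [K^2 / sqrt D] is of order 1 exactly at
    this exponent. Lowering [K] by [log(n)^(-2 alpha)] multiplies [D] by [log n], which absorbs the
    logarithm of the union bound over the nodes.

    The obstacle is that degrees of different nodes are dependent. The main estimates fix at most
    two nodes, the hub, and let every other node enter only through a class in a finite type: a
    conditional probability is then a finite sum of products, integrated over the law of the hub.
    Dependence between cells is bypassed because the count of states without inversion is
    deterministic once the positions are given; probability enters it only through the invariance of
    the law. *)

Section pairRV.
Context d d1 d2 (T : measurableType d) (T1 : measurableType d1)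
  (T2 : measurableType d2) (R : realType) (P : probability T R).
Variables (Y : {RV P >-> T1}) (Z : {RV P >-> T2}).

Definition pairRV (w : T) : T1 * T2 := (Y w, Z w).

Lemma measurable_pairRV : measurable_fun setT pairRV.
Proof. exact: measurable_fun_pair. Qed.

HB.instance Definition _ := isMeasurableFun.Build _ _ _ _ pairRV measurable_pairRV.

End pairRV.

Section independence.
Context d d' (T : measurableType d) (V : measurableType d') (R : realType).
Variables (P : probability T R) (mu : probability V R) (n : nat).
Variable X : 'I_n -> {RV P >-> V}.
Local Open Scope ereal_scope.

(** One formula for two facts: the nodes of [J] are independent with law [mu], and they are jointly
    independent of the hub [Y]. It asks for product events only, which is what mutual independence
    provides; general events follow by uniqueness of measures. *)
Definition indep_rest dU (U : measurableType dU) (Y : {RV P >-> U})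
    (J : {set 'I_n}) : Prop :=
  forall (A : set U) (B : 'I_n -> set V), measurable A ->
    (forall k, measurable (B k)) ->
  P ((Y @^-1` A) `&` [set w | forall k, k \in J -> B k (X k w)])
  = P (Y @^-1` A) * \prod_(k in J) mu (B k).

Lemma measurable_preim dU (U : measurableType dU) (Y : {RV P >-> U}) A :
  measurable A -> measurable (Y @^-1` A).
Proof. by move=> mA; rewrite -[X in measurable X]setTI; exact: measurable_funPT. Qed.

Lemma measurable_forall_in (J : {set 'I_n}) (E : 'I_n -> set T) :
  (forall k, measurable (E k)) ->
  measurable [set w | forall k, k \in J -> E k w].
Proof.
move=> mE; have -> : [set w | forall k, k \in J -> E k w] =
    \bigcap_(k in [set k | k \in J]) E k by [].
by apply: fin_bigcap_measurable => //; exact: finite_finset.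
Qed.

(** For fixed conditions [B] on [J], both sides are finite measures in [C]; they agree on
    rectangles, a pi-system that generates the product sigma-algebra. *)
Lemma indep_restS dU (U : measurableType dU) (Y : {RV P >-> U})
    (J : {set 'I_n}) k :
  k \notin J -> indep_rest Y (k |: J) ->
  indep_rest (pairRV Y (X k)) J.
Proof.
move=> kJ iY C B mC mB.
pose E := [set w | forall k, k \in J -> B k (X k w)].
have mE : measurable E.
  by apply: measurable_forall_in => l; exact: measurable_preim.
have c0 : (0 <= fine (\prod_(l in J) mu (B l)))%R.
  by apply: fine_ge0; apply: prode_ge0 => l _.
have cE : (fine (\prod_(l in J) mu (B l)))%:E = \prod_(l in J) mu (B l).
  rewrite fineK //; elim/big_ind: _ => // [x y|l _]; first exact: fin_numM.
  by rewrite fin_num_measure.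
pose Y' : {RV P >-> (U * V)%type} := pairRV Y (X k).
(* [m1] is the joint law of [Y] and [X k] restricted to the event on [J]; [m2] is the unrestricted
   joint law scaled by the mass of that event. *)
pose m1 : {measure set (U * V) -> \bar R} :=
  measure_function_pushforward__canonical__measure_function_Measure (mrestr P mE) (measurable_pairRV Y (X k)).
pose m2 : {measure set (U * V) -> \bar R} :=
  mscale (NngNum c0) (distribution P Y').
suff : m1 C = m2 C.
  rewrite /m1 /m2 /= /mscale /= cE /pushforward /mrestr /distribution /= => ->.
  by rewrite muleC.
apply: (measure_unique [set A `*` D | A in measurable & D in measurable]
  (fun=> setT)) => //.
- by rewrite measurable_prod_measurableType.
- move=> _ _ [A1 mA1 [D1 mD1 <-]] [A2 mA2 [D2 mD2 <-]].
  exists (A1 `&` A2); first exact: measurableI.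
  by exists (D1 `&` D2); [exact: measurableI|rewrite setXI].
- by move=> _; exists setT => //; exists setT => //; rewrite setXTT.
- by apply/seteqP; split=> // x _; exists 0%N.
- move=> _ [A mA [D mD <-]].
  pose BD l := if l == k then D else B l.
  have mBD l : measurable (BD l) by rewrite /BD; case: ifP.
  pose Bk l := if l == k then D else setT.
  have mBk l : measurable (Bk l) by rewrite /Bk; case: ifP.
  have e1 : m1 (A `*` D) = P (Y @^-1` A) * (mu D * \prod_(l in J) mu (B l)).
    have := iY A BD mA mBD; rewrite big_setU1 //= {2}/BD eqxx.
    rewrite (eq_bigr (fun l => mu (B l))); last first.
      move=> l lJ; rewrite /BD; case: eqP => // lk.
      by move: kJ; rewrite -lk lJ.
    move=> <-; rewrite /m1 /= /pushforward /mrestr /=; congr (P _).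
    apply/seteqP; split=> w /=.
      move=> [[Aw Dw] Ew]; split=> // l; rewrite in_setU1 /BD.
      by case: eqP => [->//|_ /= lJ]; exact: Ew.
    move=> [Aw h]; split; first (split=> //).
      by have := h k; rewrite setU11 /BD eqxx; exact.
    move=> l lJ; have := h l; rewrite in_setU1 lJ orbT /BD.
    by case: eqP => [lk|_]; [move: kJ; rewrite -lk lJ|exact].
  have e2 : m2 (A `*` D) = P (Y @^-1` A) * (mu D * \prod_(l in J) mu (B l)).
    have := iY A Bk mA mBk; rewrite big_setU1 //= {2}/Bk eqxx.
    rewrite big1 ?mule1; last first.
      move=> l lJ; rewrite /Bk; case: eqP => [lk|_].
        by move: kJ; rewrite -lk lJ.
      exact: probability_setT.
    move=> e; rewrite muleA -e muleC /m2 /= /mscale /= cE; congr (_ * P _).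
    apply/seteqP; split=> w /=.
      by move=> [Aw Dw]; split=> // l; rewrite /Bk; case: eqP => [->|].
    move=> [Aw h]; split=> //.
    by have := h k; rewrite setU11 /Bk eqxx; exact.
  by rewrite e1 e2.
- move=> _; rewrite /m1 /= /pushforward /mrestr /= preimage_setT setTI.
  by rewrite (le_lt_trans (probability_le1 _ mE)) // ltry.
Qed.

Lemma indep_rest_law dU (U : measurableType dU) (Y : {RV P >-> U}) k C :
  indep_rest Y [set k]%SET -> measurable C ->
  distribution P (pairRV Y (X k)) C = (distribution P Y \x mu) C.
Proof.
move=> iY mC; apply/esym; apply: product_measure_unique => // A B mA mB.
have := iY A (fun=> B) mA (fun=> mB); rewrite big_set1 => <-.
congr (P _); apply/seteqP; split=> w /=.
  by move=> [Aw Bw]; split=> // l /[!inE] /eqP ->.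
by move=> [Aw h]; split=> //; apply: h; rewrite inE.
Qed.

Lemma indep_restW dU (U : measurableType dU) (Y : {RV P >-> U})
    (J K : {set 'I_n}) : J \subset K -> indep_rest Y K -> indep_rest Y J.
Proof.
move=> /fintype.subsetP JK iY A B mA mB.
pose B' k := if k \in J then B k else setT.
have mB' k : measurable (B' k) by rewrite /B'; case: ifP.
have := iY A B' mA mB'.
have -> : [set w | forall k, k \in K -> B' k (X k w)] =
    [set w | forall k, k \in J -> B k (X k w)].
  apply/seteqP; split=> w /= h k kJ; have := h k; rewrite /B'.
    by rewrite JK // kJ; exact.
  by case: ifP => // kJ'; exact.
move=> ->; congr (_ * _); rewrite [RHS]big_mkcond /= big_mkcond /=.
apply: eq_bigr => k _; rewrite /B'; case: ifPn => [kK|].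
  by case: ifP => // _; exact: probability_setT.
by case: ifPn => // /JK ->.
Qed.

Lemma measurable_prode dU (U : measurableType dU) (J : {set 'I_n})
    (f : 'I_n -> U -> \bar R) : (forall k, measurable_fun setT (f k)) ->
  measurable_fun setT (fun y => \prod_(k in J) f k y).
Proof.
move=> mf; rewrite (_ : (fun y => _) =
  (fun y => \prod_(k <- enum J) f k y)); last first.
  by apply/funext => y; rewrite big_enum.
elim: (enum J) => [|k s ih].
  by under eq_fun do rewrite big_nil; exact: measurable_cst.
under eq_fun do rewrite big_cons.
by apply: emeasurable_funM.
Qed.

(* Fubini along the nodes of [J], which are independent of [Y]. *)
Lemma indep_restE dU (U : measurableType dU) (Y : {RV P >-> U})
    (J : {set 'I_n}) (A : set U) (C : 'I_n -> set (U * V)) :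
  indep_rest Y J -> measurable A -> (forall k, measurable (C k)) ->
  P ((Y @^-1` A) `&` [set w | forall k, k \in J -> C k (Y w, X k w)])
  = \int[distribution P Y]_(y in A) \prod_(k in J) mu (xsection (C k) y).
Proof.
move: {2}#|J| (leqnn #|J|) => m; elim: m dU U Y J A C.
  move=> dU U Y J A C; rewrite leqn0 cards_eq0 => /eqP -> iY mA mC.
  under eq_integral do rewrite big_set0.
  rewrite integral_cst // mul1e; congr (P _).
  apply/seteqP; split=> w /=; first by case.
  by move=> Aw; split=> // k; rewrite inE.
move=> m ih dU U Y J A C Jm iY mA mC.
have [->|[k kJ]] := set_0Vmem J.
  under eq_integral do rewrite big_set0.
  rewrite integral_cst // mul1e; congr (P _).
  apply/seteqP; split=> w /=; first by case.
  by move=> Aw; split=> // l; rewrite inE.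
have kJk : k \notin (J :\ k)%SET by rewrite !inE eqxx.
have Jk : (k |: (J :\ k))%SET = J by rewrite finset.setD1K.
(* Induction on the size of [J]: node [k] is absorbed into the hub, its own condition becomes part
   of the hub event [A'], and the conditions [C'] on the other nodes ignore its coordinate. Tonelli
   then integrates it out. *)
pose Y' : {RV P >-> (U * V)%type} := pairRV Y (X k).
have iY' : indep_rest Y' (J :\ k)%SET by apply: indep_restS => //; rewrite Jk.
have iYk : indep_rest Y [set k]%SET.
  by apply: indep_restW iY; rewrite finset.sub1set.
pose A' := C k `&` (A `*` setT).
have mA' : measurable A' by apply: measurableI => //; exact: measurableX.
pose C' l := [set z : (U * V) * V | C l (z.1.1, z.2)].
have mC' l : measurable (C' l).
  rewrite -[X in measurable X]setTI.
  have mf : measurable_fun setT (fun z : (U * V) * V => (z.1.1, z.2)).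
    apply: measurable_fun_pair => //.
    exact: (measurableT_comp measurable_fst measurable_fst).
  exact: mf.
have -> : (Y @^-1` A) `&` [set w | forall l, l \in J -> C l (Y w, X l w)] =
   (Y' @^-1` A') `&`
   [set w | forall l, l \in (J :\ k)%SET -> C' l (Y' w, X l w)].
  apply/seteqP; split=> w /=.
    move=> [Aw h]; split; first by split=> //; exact: h.
    by move=> l; rewrite !inE => /andP[_ lJ]; exact: h.
  move=> [[Ck [Aw _]] h]; split=> // l lJ.
  have [->//|lk] := eqVneq l k.
  by apply: h; rewrite !inE lk.
rewrite ih //; last first.
  by move: Jm; rewrite (cardsD1 k) kJ add1n ltnS.
pose g y := \prod_(l in (J :\ k)%SET) mu (xsection (C l) y).
have g0 y : 0 <= g y by apply: prode_ge0 => l _.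
have mg : measurable_fun setT g.
  by apply: measurable_prode => l; exact: measurable_fun_xsection.
transitivity (\int[distribution P Y']_(z in A') g z.1).
  apply: eq_integral => z _; apply: eq_bigr => l _.
  have -> // : xsection (C' l) z = xsection (C l) z.1.
  by apply/seteqP; split=> x; rewrite /xsection /= !inE.
rewrite integral_mkcond (eq_measure_integral (distribution P Y \x mu)); last first.
  by move=> D mD _; exact: indep_rest_law.
rewrite fubini_tonelli1; last 2 first.
- apply/(measurable_restrictT _ mA').
  apply: measurable_funTS; exact: (measurableT_comp mg measurable_fst).
- by move=> z; apply: erestrict_ge0.
rewrite [RHS]integral_mkcond; apply: eq_integral => y _.
rewrite /fubini_F patchE; case: ifPn => [yA|yA].
  transitivity (\int[mu]_x (g y * (\1_(xsection (C k) y) x)%:E)).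
    apply: eq_integral => x _; rewrite patchE indicE.
    have -> : ((y, x) \in A') = (x \in xsection (C k) y).
      apply/idP/idP; rewrite /xsection !inE /=.
        by case=> h _; rewrite inE.
      by rewrite inE => h; split=> //; split=> //; move: yA; rewrite inE.
    by case: ifP => _; rewrite ?mule1 ?mule0.
  rewrite ge0_integralZl//; last first.
    apply/measurable_EFinP; exact: measurable_indic (measurable_xsection _ _).
  rewrite integral_indic //; last exact: measurable_xsection.
  by rewrite setIT -[in RHS]Jk big_setU1 //= muleC.
rewrite integral0_eq // => x _; rewrite patchE.
rewrite (_ : ((y, x) \in A') = false) //.
apply/negP; rewrite inE => -[_ [/= Ay _]].
by move: yA; rewrite notin_setE; exact.
Qed.

End independence.

(** * Real-valued probabilities, Markov's inequality and union bounds *)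

Section real_probability.
Context d (T : measurableType d) (R : realType) (P : probability T R).
Implicit Types S : set T.

Definition pr S : R := fine (P S).

Lemma prE S : measurable S -> P S = (pr S)%:E.
Proof. by move=> mS; rewrite fineK // fin_num_measure. Qed.

Lemma pr_ge0 S : 0 <= pr S.
Proof. exact: fine_ge0. Qed.

Lemma pr_mono S S' : measurable S -> measurable S' -> S `<=` S' -> pr S <= pr S'.
Proof.
by move=> mS mS' SS'; rewrite -lee_fin -!prE // le_measure ?inE.
Qed.

Lemma pr_le1 S : measurable S -> pr S <= 1.
Proof. by move=> mS; rewrite -lee_fin -prE // probability_le1. Qed.

Lemma pr_setT : pr setT = 1.
Proof. by rewrite /pr probability_setT. Qed.

Lemma pr_set0 : pr set0 = 0.
Proof. by rewrite /pr measure0. Qed.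

Lemma prU2 S A B : measurable S -> measurable A -> measurable B ->
  S `<=` A `|` B -> pr S <= pr A + pr B.
Proof.
move=> mS mA mB h; apply: (le_trans (pr_mono mS (measurableU _ _ mA mB) h)).
rewrite -lee_fin EFinD -!prE //; last exact: measurableU.
exact: measureU2.
Qed.

Lemma pr_setC S : measurable S -> pr (~` S) = 1 - pr S.
Proof.
move=> mS; apply/EFin_inj; rewrite -prE; last exact: measurableC.
by rewrite probability_setC // prE.
Qed.

Variables (I : finType) (E : I -> set T).
Hypothesis mE : forall i, measurable (E i).

Lemma measurable_sum_indic :
  measurable_fun setT (fun w => (\sum_i \1_(E i) w : R)).
Proof. by apply: measurable_sum => i; exact: measurable_indic. Qed.

Lemma sum_prE : ((\sum_i pr (E i))%:E = \int[P]_w (\sum_i \1_(E i) w)%:E)%E.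
Proof.
transitivity (\int[P]_w (\sum_i (\1_(E i) w)%:E))%E; last first.
  by apply: eq_integral => w _; rewrite -sumEFin.
rewrite ge0_integral_sum //; last first.
  by move=> i; apply/measurable_EFinP; exact: measurable_indic.
rewrite -sumEFin; apply: eq_bigr => i _.
by rewrite -prE // integral_indic // setIT.
Qed.

(** Markov's inequality for the number of events [E i] that occur, obtained by integrating the
    pointwise bound of [a] times the indicator of [S]. *)
Lemma pr_markov S (a : R) : measurable S -> 0 <= a ->
  (forall w, S w -> a <= \sum_i \1_(E i) w) -> a * pr S <= \sum_i pr (E i).
Proof.
move=> mS a0 h; rewrite -lee_fin sum_prE EFinM -prE //.
have -> : (a%:E * P S = \int[P]_w (a * \1_S w)%:E)%E.
  under eq_integral do rewrite EFinM.
  rewrite ge0_integralZl //; last first.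
    by apply/measurable_EFinP; exact: measurable_indic.
  by rewrite integral_indic // setIT.
apply: ge0_le_integral => //.
- by move=> w _; rewrite lee_fin mulr_ge0.
- by apply/measurable_EFinP; apply: measurable_funM => //; exact: measurable_indic.
- by apply/measurable_EFinP; exact: measurable_sum_indic.
move=> w _; rewrite lee_fin indicE; case: (boolP (w \in S)) => [|_].
  by rewrite inE => /h; rewrite mulr1.
by rewrite mulr0; apply: sumr_ge0.
Qed.

Lemma sum_pr_le (N : R) :
  (forall w, \sum_i \1_(E i) w <= N) -> \sum_i pr (E i) <= N.
Proof.
move=> h; rewrite -lee_fin sum_prE.
have -> : (N%:E = \int[P]_w (cst N%:E w))%E.
  rewrite integral_cst // -[LHS]mule1; congr (_ * _)%E.
  exact/esym/probability_setT.
apply: ge0_le_integral => //.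
- by move=> w _; rewrite lee_fin; apply: sumr_ge0.
- by apply/measurable_EFinP; exact: measurable_sum_indic.
- by move=> w _; rewrite lee_fin.
Qed.

Lemma pr_partition S : measurable S ->
  (forall w, \1_S w = \sum_i \1_(E i) w :> R) -> pr S = \sum_i pr (E i).
Proof.
move=> mS h; apply/EFin_inj; rewrite sum_prE.
under eq_integral do rewrite -h.
by rewrite -prE // integral_indic // setIT.
Qed.

Lemma pr_sum_le S : measurable S ->
  (forall w, S w -> exists i, E i w) -> pr S <= \sum_i pr (E i).
Proof.
move=> mS h; rewrite -[pr S]mul1r; apply: pr_markov => // w /h[i Ew].
rewrite (bigD1 i) //= indicE mem_set // lerDl; exact: sumr_ge0.
Qed.

End real_probability.

Section finite_information.
Context d (T : measurableType d) (I : finType) (F : finType).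

Lemma measurable_fin_preim (f : T -> F) (Q : set F) :
  (forall y, measurable [set w | f w = y]) -> measurable [set w | Q (f w)].
Proof.
move=> mf; have -> : [set w | Q (f w)] = \bigcup_(y in Q) [set w | f w = y].
  apply/seteqP; split=> w /=; first by move=> h; exists (f w).
  by case=> y Qy ->.
by apply: fin_bigcup_measurable => //; exact: finite_finset.
Qed.

End finite_information.

(** Degrees, orderings of radii and inversions are functions of finitely many comparisons, so their
    events have this form, however intricate the predicate [Q] is. *)
Lemma measurable_fin_info d (T : measurableType d) (I F : finType)
    (b : I -> T -> F) (Q : set {ffun I -> F}) :
  (forall i y, measurable [set w | b i w = y]) ->
  measurable [set w | Q [ffun i => b i w]].
Proof.
move=> mb; apply: (@measurable_fin_preim _ _ _ (fun w => [ffun i => b i w])) => e.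
have -> : [set w | [ffun i => b i w] = e] =
    \bigcap_(i in [set: I]) [set w | b i w = e i].
  apply/seteqP; split=> w /= h; first by move=> i _; rewrite -h ffunE.
  by apply/ffunP => i; rewrite ffunE; exact: h.
by apply: fin_bigcap_measurable => //; exact: finite_finset.
Qed.

Lemma measurable_bool_info d (T : measurableType d) (I : finType)
    (b : I -> T -> bool) (Q : set {ffun I -> bool}) :
  (forall i, measurable [set w | b i w]) ->
  measurable [set w | Q [ffun i => b i w]].
Proof.
move=> mb; apply: measurable_fin_info => i [].
  by rewrite (_ : mkset _ = [set w | b i w]).
rewrite (_ : mkset _ = ~` [set w | b i w]); first exact: measurableC.
by apply/seteqP; split=> w /=; [move=> ->|move/negP/negbTE].
Qed.

(** * Conditioning on a hub: the other nodes seen through finitely many classes *)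

Section hub.
Context d d' (T : measurableType d) (V : measurableType d') (R : realType).
Variables (P : probability T R) (mu : probability V R) (n : nat).
Variable X : 'I_n -> {RV P >-> V}.

(** Probability of [Q] when the nodes of [J] receive independent classes of law [w]. Assignments are
    functions on all of ['I_n] with the default value [f0] outside [J], the form in which
    [big_distr_big_dep] expands products of sums. *)
Definition class_prob (J : {set 'I_n}) (F : finType) (f0 : F) (w : F -> R)
    (Q : pred {ffun 'I_n -> F}) : R :=
  \sum_(e in pfamily f0 (mem J) (fun=> predT) | Q e) \prod_(k in J) w (e k).

Variables (dU : measure_display) (U : measurableType dU) (Y : {RV P >-> U}).
Variables (J : {set 'I_n}) (F : finType) (f0 : F) (kap : U -> V -> F).
Variable Q : U -> pred {ffun 'I_n -> F}.
Hypothesis iY : indep_rest mu X Y J.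
Hypothesis mkap : forall f, measurable [set z : U * V | kap z.1 z.2 = f].
Hypothesis mQ : forall e, measurable [set y | Q y e].

Definition classes (w : T) : {ffun 'I_n -> F} :=
  [ffun k => if k \in J then kap (Y w) (X k w) else f0].

Definition class_weight (y : U) (f : F) : R := pr mu [set x | kap y x = f].

Lemma measurable_kap y f : measurable [set x | kap y x = f].
Proof.
have := measurable_xsection y (mkap f); congr measurable.
by apply/seteqP; split=> x; rewrite /xsection /= inE.
Qed.

Lemma measurable_class_event A : measurable A ->
  measurable [set w | A (Y w) /\ Q (Y w) (classes w)].
Proof.
move=> mA.
rewrite (_ : mkset _ = \bigcup_(e in [set: {ffun 'I_n -> F}])
   ((Y @^-1` (A `&` [set y | Q y e])) `&` [set w | classes w = e])); last first.
  apply/seteqP; split=> w /=; first by move=> [Aw Qw]; exists (classes w).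
  by move=> [e _ [[Aw Qw] /= ->]].
apply: fin_bigcup_measurable; first exact: finite_finset.
move=> e _; apply: measurableI.
  by apply: measurable_preim; apply: measurableI.
apply: (@measurable_fin_info _ _ _ _
  (fun k w => if k \in J then kap (Y w) (X k w) else f0) [set e]) => k f.
case: (k \in J); last first.
  by case: (eqVneq f0 f) => [->|/eqP h];
   [rewrite (_ : mkset _ = setT)//|rewrite (_ : mkset _ = set0)//];
   apply/seteqP; split.
exact: (@measurable_preim _ _ _ P _ _ (pairRV Y (X k)) _ (mkap f)).
Qed.

(** Split the event by the full assignment [e] of classes: for each [e], [Q y e] is a condition on
    the hub alone and the rest is a product event, to which [indep_restE] applies. The finite sum is
    then moved inside the integral. *)
Lemma hubE A : measurable A ->
  (P [set w | A (Y w) /\ Q (Y w) (classes w)] =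
   \int[distribution P Y]_(y in A)
     (class_prob J f0 (class_weight y) (Q y))%:E)%E.
Proof.
move=> mA.
pose E (e : {ffun 'I_n -> F}) :=
  if e \in pfamily f0 (mem J) (fun=> predT) then
    (Y @^-1` (A `&` [set y | Q y e])) `&`
    [set w | forall k, k \in J -> kap (Y w) (X k w) = e k]
  else set0.
have mE e : measurable (E e).
  rewrite /E; case: ifP => // _; apply: measurableI.
    by apply: measurable_preim; apply: measurableI.
  apply: (@measurable_forall_in _ _ _ J (fun k => [set w | kap (Y w) (X k w) = e k])).
  by move=> k; exact: (@measurable_preim _ _ _ P _ _ (pairRV Y (X k)) _ (mkap (e k))).
have mS := measurable_class_event mA.
rewrite prE // (pr_partition P mE mS); last first.
  move=> w; rewrite (bigD1 (classes w)) //= [X in _ + X]big1 ?addr0.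
    rewrite !indicE; congr (_%:R); congr nat_of_bool; apply/idP/idP; rewrite !inE /E.
      have -> : classes w \in pfamily f0 (mem J) (fun=> predT).
        apply/pfamilyP; split=> //.
        apply/fintype.subsetP => k; rewrite !inE ffunE.
        by case: ifP => // _; rewrite eqxx.
      by move=> [Aw Qw]; split=> //= k kJ; rewrite ffunE kJ.
    by case: ifP => [_ [[Aw Qw] _]|_ []].
  move=> e ew; rewrite indicE (_ : (w \in E e) = false) //; apply/negP.
  rewrite inE /E; case: ifP => [/pfamilyP[/fintype.subsetP eJ _] [_ h]|_ []].
  move/eqP: ew; apply; apply/ffunP => k; rewrite ffunE.
  case: ifP => kJ; first by rewrite h.
  by apply/eqP; apply: contraFT kJ => ek; apply: eJ.
rewrite -sumEFin.
pose g (e : {ffun 'I_n -> F}) (y : U) : \bar R :=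
  if (e \in pfamily f0 (mem J) (fun=> predT)) && Q y e then
   (\prod_(k in J) mu (xsection [set z : U * V | kap z.1 z.2 = e k] y))%E else 0%E.
have gE e y : g e y = (if (e \in pfamily f0 (mem J) (fun=> predT)) && Q y e then
   \prod_(k in J) class_weight y (e k) else 0)%:E.
  rewrite /g; case: ifP => // _; rewrite -prodEFin; apply: eq_bigr => k kJ.
  rewrite /class_weight -prE; last exact: measurable_kap.
  by congr (mu _); apply/seteqP; split=> x; rewrite /xsection /= inE.
transitivity (\sum_(e : {ffun 'I_n -> F}) \int[distribution P Y]_(y in A) g e y)%E.
  apply: eq_bigr => e _; rewrite -prE // /E /g.
  case: ifP => ef /=; last by rewrite measure0 integral0.
  rewrite (@indep_restE _ _ _ _ _ _ _ _ _ _ _ _ _ _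
     (fun k => [set z | kap z.1 z.2 = e k]) iY) //; last exact: measurableI.
  rewrite integral_mkcondr; apply: eq_integral => y _.
  by rewrite patchE /= mem_setE /=.
rewrite -ge0_integral_sum //; last first.
- move=> e y _; rewrite gE lee_fin; case: ifP => // _.
  by apply: prodr_ge0 => k _; exact: pr_ge0.
- move=> e; apply: measurable_funTS; rewrite /g; case: (e \in _) => //=.
  apply: measurable_fun_ifT => //.
    apply: (@measurable_fun_bool _ _ _ _ true) => //=.
    rewrite setTI (_ : _ @^-1` _ = [set y | Q y e]) //.
  by apply: measurable_prode => k; exact: measurable_fun_xsection.
apply: eq_integral => y _; rewrite /class_prob [in RHS]big_mkcond /= -sumEFin.
by apply: eq_bigr => e _; rewrite gE.
Qed.

(** The form in which conditional estimates are used: a bound uniform over hub positions. Keeping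
    the probability of the hub event as a factor is what later yields [theta ^+ 2] for two nodes of
    one cell. *)
Lemma hub_le A (eps : R) : measurable A -> 0 <= eps ->
  (forall y, A y -> class_prob J f0 (class_weight y) (Q y) <= eps) ->
  pr P [set w | A (Y w) /\ Q (Y w) (classes w)] <= eps * pr P (Y @^-1` A).
Proof.
move=> mA eps0 h; rewrite -lee_fin EFinM -!prE; last 2 first.
- exact: measurable_preim.
- exact: measurable_class_event.
rewrite hubE //.
have -> : (eps%:E * P (Y @^-1` A) =
    \int[distribution P Y]_(y in A) cst eps%:E y)%E by rewrite integral_cst.
apply: ge0_le_integral => //.
- move=> y _; rewrite lee_fin; apply: sumr_ge0 => e _.
  by apply: prodr_ge0 => k _; exact: pr_ge0.
- apply: measurable_funTS; apply/measurable_EFinP.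
  rewrite /class_prob; under eq_fun do rewrite big_mkcond.
  apply: measurable_sum => e; case: (e \in _) => //=.
  apply: measurable_fun_ifT => //.
    apply: (@measurable_fun_bool _ _ _ _ true) => //=.
    rewrite setTI (_ : _ @^-1` _ = [set y | Q y e]) //.
  under eq_fun do rewrite -big_enum /=.
  apply: measurable_prod => k _.
  apply/measurable_EFinP.
  rewrite (_ : _ \o _ = fun y => mu (xsection [set z : U * V | kap z.1 z.2 = e k] y)).
    exact: measurable_fun_xsection.
  apply/funext => y /=; rewrite /class_weight -prE; last exact: measurable_kap.
  by congr (mu _); apply/seteqP; split=> x; rewrite /xsection /= inE.
Qed.

End hub.

(** * Sums of independent finite classes *)

(** From [exp(- s) >= 1 - s] one gets [exp s <= 1 / (1 - s)], and [(1 + s + 2 s^2)(1 - s) = 1 + s^2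
    (1 - 2 s) >= 1]. Negative [s] are included, so that both tails of Chernoff's bound use it. *)
Lemma expR_le_quadratic (R : realType) (s : R) : s <= 1 / 2 -> expR s <= 1 + s + 2 * s ^+ 2.
Proof.
move=> s2; have h := expR_ge1Dx (- s); have hs : 0 < 1 - s by lra.
rewrite -[s]opprK expRN opprK.
apply: (@le_trans _ _ (1 - s)^-1); first by rewrite lef_pV2 ?posrE ?expR_gt0.
rewrite -div1r ler_pdivrMr //; nra.
Qed.

Section class_expectation.
Context (R : realType) (n : nat) (J : {set 'I_n}) (F : finType) (f0 : F).
Variable w : F -> R.
Hypothesis w0 : forall f, 0 <= w f.

Definition class_E (phi : {ffun 'I_n -> F} -> R) : R :=
  \sum_(e in pfamily f0 (mem J) (fun=> predT))
    (\prod_(k in J) w (e k)) * phi e.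

Lemma class_E_le phi psi : (forall e, phi e <= psi e) -> class_E phi <= class_E psi.
Proof.
by move=> h; apply: ler_sum => e _; apply: ler_wpM2l => //; exact: prodr_ge0.
Qed.

Lemma class_E_ge0 phi : (forall e, 0 <= phi e) -> 0 <= class_E phi.
Proof. by move=> h; apply: sumr_ge0 => e _; rewrite mulr_ge0 // prodr_ge0. Qed.

Lemma class_EZ c phi : class_E (fun e => c * phi e) = c * class_E phi.
Proof. by rewrite /class_E mulr_sumr; apply: eq_bigr => e _; rewrite mulrCA. Qed.

Lemma class_ED phi psi :
  class_E (fun e => phi e + psi e) = class_E phi + class_E psi.
Proof. by rewrite /class_E -big_split; apply: eq_bigr => e _; rewrite mulrDr. Qed.

Lemma class_E_sum (I : finType) (A : pred I) (phi : I -> {ffun 'I_n -> F} -> R) :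
  class_E (fun e => \sum_(i | A i) phi i e) = \sum_(i | A i) class_E (phi i).
Proof.
by rewrite /class_E exchange_big; apply: eq_bigr => e _; rewrite mulr_sumr.
Qed.

Lemma class_probE Q : class_prob J f0 w Q = class_E (fun e => (Q e)%:R).
Proof.
rewrite /class_prob big_mkcondr /=; apply: eq_bigr => e _.
by case: (Q e); rewrite ?mulr1 ?mulr0.
Qed.

Lemma class_probU (Q Q1 Q2 : pred {ffun 'I_n -> F}) : (forall e, Q e -> Q1 e || Q2 e) ->
  class_prob J f0 w Q <= class_prob J f0 w Q1 + class_prob J f0 w Q2.
Proof.
move=> h; rewrite !class_probE -class_ED; apply: class_E_le => e.
have := h e; case: (Q e) => [/(_ isT)|_]; last by rewrite addr_ge0.
by case/orP => ->; rewrite ?lerDl ?lerDr.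
Qed.

Lemma class_prob_markov (Q : pred {ffun 'I_n -> F}) phi (a : R) : 0 < a -> (forall e, 0 <= phi e) ->
  (forall e, Q e -> a <= phi e) -> class_prob J f0 w Q <= class_E phi / a.
Proof.
move=> a0 phi0 h; rewrite ler_pdivlMr // mulrC class_probE -class_EZ.
apply: class_E_le => e; case: (boolP (Q e)) => [/h|_]; first by rewrite mulr1.
by rewrite mulr0.
Qed.

Lemma class_E_prod (phi : 'I_n -> F -> R) :
  class_E (fun e => \prod_(k in J) phi k (e k)) =
  \prod_(k in J) \sum_f w f * phi k f.
Proof.
rewrite (big_distr_big_dep f0); apply: eq_bigr => e _.
by rewrite -big_split.
Qed.

Hypothesis w1 : \sum_f w f = 1.

Lemma class_E1 : class_E (fun=> 1) = 1.
Proof.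
transitivity (class_E (fun e => \prod_(k in J) (fun _ _ => 1) k (e k))).
  by congr class_E; apply/funext => e; rewrite big1.
rewrite (class_E_prod (fun _ _ => 1)) big1 // => k _.
by rewrite -[RHS]w1; apply: eq_bigr => f _; rewrite mulr1.
Qed.

Variable D : pred F.

Definition class_count (e : {ffun 'I_n -> F}) : nat := #|[set k in J | D (e k)]|.

Let p := \sum_(f | D f) w f.

Lemma class_countE e : (class_count e)%:R = \sum_(k in J) (D (e k))%:R :> R.
Proof.
rewrite /class_count -sum1_card natr_sum big_mkcond [RHS]big_mkcond /=.
by apply: eq_bigr => k _; rewrite inE; case: (k \in J); case: (D _).
Qed.

Lemma class_E_count : class_E (fun e => (class_count e)%:R) = #|J|%:R * p.
Proof.
transitivity (\sum_(l in J) class_E (fun e => (D (e l))%:R)).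
  by rewrite -class_E_sum; congr class_E; apply/funext => e; rewrite class_countE.
have -> : #|J|%:R * p = \sum_(l in J) p by rewrite sumr_const mulr_natl.
apply: eq_bigr => l lJ.
pose phi (k : 'I_n) (f : F) : R := if k == l then (D f)%:R else 1.
transitivity (class_E (fun e => \prod_(k in J) phi k (e k))).
  congr class_E; apply/funext => e; rewrite (bigD1 l) //= {1}/phi eqxx.
  by rewrite big1 ?mulr1 // => k /andP[_ /negbTE kl]; rewrite /phi kl.
rewrite class_E_prod (bigD1 l) //= [X in _ * X]big1 ?mulr1.
  rewrite /p [RHS]big_mkcond; apply: eq_bigr => f _.
  by rewrite /phi eqxx; case: (D f); rewrite ?mulr1 ?mulr0.
move=> k /andP[_ /negbTE kl]; rewrite -[RHS]w1; apply: eq_bigr => f _.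
by rewrite /phi kl mulr1.
Qed.

(** By independence the uncentred Laplace transform is the power [#|J|] of
    [1 + p (e^s - 1) <= exp(p (e^s - 1))]; the quadratic bound on [e^s] cancels the linear term with
    the centring. *)
Lemma class_E_laplace (s : R) : s <= 1 / 2 ->
  class_E (fun e => expR (s * ((class_count e)%:R - #|J|%:R * p)))
  <= expR (2 * (#|J|%:R * p) * s ^+ 2).
Proof.
move=> s2; pose c := expR (- (s * (#|J|%:R * p))).
have -> : (fun e => expR (s * ((class_count e)%:R - #|J|%:R * p))) =
    (fun e : {ffun 'I_n -> F} => c * \prod_(k in J) expR (s * (D (e k))%:R)).
  apply/funext => e.
  by rewrite -expR_sum -expRD -mulr_sumr -class_countE; congr expR; ring.
rewrite class_EZ (class_E_prod (fun k f => expR (s * (D f)%:R))) prodr_const.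
have -> : \sum_f w f * expR (s * (D f)%:R) = 1 + p * (expR s - 1).
  transitivity (\sum_f w f + p * (expR s - 1)); last by rewrite w1.
  rewrite /p mulr_suml [X in _ + X]big_mkcond -big_split /=.
  apply: eq_bigr => f _; case: (D f); first by rewrite mulr1; ring.
  by rewrite mulr0 expR0 mulr1 addr0.
have p0 : 0 <= p by apply: sumr_ge0.
have p1 : p <= 1.
  by have <- := w1; rewrite /p [leLHS]big_mkcond; apply: ler_sum => f _; case: (D f).
have h1 : 1 + p * (expR s - 1) <= expR (p * (expR s - 1)) by exact: expR_ge1Dx.
have h0 : 0 <= 1 + p * (expR s - 1) by have := expR_gt0 s; nra.
apply: (@le_trans _ _ (c * expR (p * (expR s - 1)) ^+ #|J|)).
  by rewrite ler_wpM2l ?expR_ge0 // lerXn2r // nnegrE // expR_ge0.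
rewrite -expRM_natl -expRD ler_expR.
have := expR_le_quadratic s2; have : 0 <= #|J|%:R * p by rewrite mulr_ge0.
move=> h2 h3; have := ler_wpM2l h2 h3; nra.
Qed.

Lemma class_chernoff (M a : R) : 0 < M -> #|J|%:R * p <= M ->
  0 <= a <= 2 * M ->
  class_prob J f0 w
    [pred e | a <= `|(class_count e)%:R - #|J|%:R * p|]
  <= 2 * expR (- (a ^+ 2 / (8 * M))).
Proof.
(* [a / (4 M)] minimises [2 M s^2 - s a], and [a <= 2 M] says exactly that [s <= 1 / 2]. *)
move=> M0 pM /andP[a0 aM]; pose s := a / (4 * M).
have s0 : 0 <= s by rewrite divr_ge0 // mulr_ge0 // ltW.
have s2 : s <= 1 / 2 by rewrite ler_pdivrMr; nra.
have sN : - s <= 1 / 2 by lra.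
have M4 : 4 * M != 0 by lra.
have e0 : - (a ^+ 2 / (8 * M)) = 2 * M * s ^+ 2 - s * a.
  by rewrite /s; field; lra.
have tail t : t <= 1 / 2 -> t ^+ 2 = s ^+ 2 ->
    class_prob J f0 w
      [pred e | s * a <= t * ((class_count e)%:R - #|J|%:R * p)]
    <= expR (- (a ^+ 2 / (8 * M))).
  move=> t2 ts.
  apply: le_trans (class_prob_markov (a := expR (s * a))
   (phi := fun e => expR (t * ((class_count e)%:R - #|J|%:R * p))) _ _ _) _.
  - exact: expR_gt0.
  - by move=> e; exact: expR_ge0.
  - by move=> e /=; rewrite ler_expR.
  rewrite ler_pdivrMr ?expR_gt0 // -expRD e0 subrK.
  apply: le_trans (class_E_laplace t2) _; rewrite ler_expR ts.
  by rewrite ler_wpM2r ?sqr_ge0 //; lra.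
apply: le_trans (class_probU (Q1 := [pred e | s * a <= s * ((class_count e)%:R - #|J|%:R * p)])
  (Q2 := [pred e | s * a <= - s * ((class_count e)%:R - #|J|%:R * p)]) _) _.
  move=> e /=; rewrite ler_normr => /orP[h|h]; apply/orP; [left|right].
    by rewrite ler_wpM2l.
  by rewrite mulNr -mulrN ler_wpM2l.
have := tail s s2 erefl; have := tail (- s) sN (sqrrN s); lra.
Qed.

End class_expectation.

(** * Central binomial coefficients and Littlewood-Offord anticoncentration *)

Lemma bin_central_max k j : ('C(k.*2, j) <= 'C(k.*2, k))%N.
Proof.
wlog jk : j / (j <= k)%N => [h|].
  case: (leqP j k) => [/h //|kj].
  case: (leqP j k.*2) => [j2|j2]; last by rewrite bin_small.
  rewrite -(bin_sub j2); apply: h; lia.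
rewrite -(subKn jk); elim: (k - j)%N (leq_subr j k) => [|i ih] ik; first by rewrite subn0.
apply: leq_trans (ih (ltnW ik)).
have -> : (k - i = (k - i.+1).+1)%N by lia.
rewrite -(leq_pmul2l (ltn0Sn (k - i.+1))) mul_bin_left leq_mul2r; apply/orP; right; lia.
Qed.

(** Induction with the ratio [2 (2 k + 1) / (k + 1)] of successive central coefficients; the step
    reduces to [(k + 2)(2 k + 1)^2 <= 4 (k + 1)^3]. *)
Lemma bin_central_le k : (k.+1 * 'C(k.*2, k) ^ 2 <= 16 ^ k)%N.
Proof.
elim: k => [|k ih]; first by [].
have e1 : (k.+1 * 'C(k.+1.*2, k.+1) = 2 * (k.*2.+1 * 'C(k.*2, k)))%N.
  have h1 := mul_bin_diag k.*2.+2 k; have h2 := mul_bin_down k.*2.+1 k.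
  rewrite /= in h1 h2; rewrite doubleS; nia.
have e2 : (k.+1 ^ 2 * (k.+2 * 'C(k.+1.*2, k.+1) ^ 2)
   = 4 * k.+2 * k.*2.+1 ^ 2 * 'C(k.*2, k) ^ 2)%N.
  by rewrite mulnCA -expnMn e1 !expnMn -!mulnA; nia.
have : (k.+1 ^ 3 * (k.+2 * 'C(k.+1.*2, k.+1) ^ 2) <= k.+1 ^ 3 * 16 ^ k.+1)%N.
  rewrite (expnS _ 2) -mulnA e2.
  have : (k.+2 * k.*2.+1 ^ 2 <= 4 * k.+1 ^ 3)%N by rewrite -muln2; nia.
  move: ih; rewrite (expnS 16); set b := ('C(_, _) ^ 2)%N; set u := (16 ^ k)%N.
  set v := (_ * _ ^ 2)%N; set z := (k.+1 ^ 3)%N => h1 h2.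
  have : (k.+1 * (4 * v * b) <= 4 * (4 * z) * u)%N.
    have : (v * (k.+1 * b) <= 4 * z * u)%N by exact: leq_mul.
    nia.
  by rewrite /v; nia.
by rewrite leq_pmul2l // expn_gt0.
Qed.

Section littlewood_offord.
Context (R : realType).
Implicit Types p q : {poly R}.

Definition coef_nneg p := forall i, 0 <= p`_i.

Lemma coef_nnegM p q : coef_nneg p -> coef_nneg q -> coef_nneg (p * q).
Proof. by move=> p0 q0 i; rewrite coefM sumr_ge0 // => j _; rewrite mulr_ge0. Qed.

Lemma coef_nnegX p m : coef_nneg p -> coef_nneg (p ^+ m).
Proof.
move=> p0; elim: m => [|m ih]; last by rewrite exprS; exact: coef_nnegM.
by move=> i; rewrite expr0 coef1.
Qed.

(** A coefficient of the product sums coefficients of [p] against nonnegative weights whose total is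
    at most [q.[1]]. *)
Lemma coefM_le p q (M : R) s : coef_nneg q ->
  (forall i, p`_i <= M) -> 0 <= M -> (p * q)`_s <= M * q.[1].
Proof.
move=> q0 pM M0; rewrite coefMr.
apply: (@le_trans _ _ (M * \sum_(j < s.+1) q`_j)).
  by rewrite mulr_sumr; apply: ler_sum => j _; rewrite ler_wpM2r.
rewrite ler_wpM2l // (horner_coef_wide _ (leq_maxl (size q) s.+1)).
under [leRHS]eq_bigr do rewrite expr1n mulr1.
rewrite -(big_mkord xpredT (fun j => q`_j)) -(big_mkord xpredT (fun j => q`_j)).
rewrite [leRHS](big_cat_nat (n := s.+1)) ?leq_maxr //= lerDl.
by apply: sumr_ge0.
Qed.

Lemma coef_1DX k s : ((1 + 'X) ^+ k : {poly R})`_s = 'C(k, s)%:R.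
Proof.
elim: k s => [|k ih] s; first by rewrite expr0 coef1; case: s.
rewrite exprSr mulrDr mulr1 coefD coefMX !ih; case: s => [|s] /=.
  by rewrite addr0 !bin0.
by rewrite binS natrD.
Qed.

Lemma bin_central_sqrt k :
  'C(k.*2, k)%:R <= 4 ^+ k / Num.sqrt k.+1%:R :> R.
Proof.
have k0 : 0 < k.+1%:R :> R by rewrite ltr0n.
rewrite ler_pdivlMr ?sqrtr_gt0 //.
rewrite -(@ler_pXn2r _ 2) // ?nnegrE ?mulr_ge0 ?sqrtr_ge0 ?exprn_ge0 //.
rewrite exprMn sqr_sqrtr ?ler0n // mulrC -exprM mulnC exprM.
have := bin_central_le k; rewrite -(ler_nat R) natrM !natrX.
by rewrite (_ : 16%:R = 4 ^+ 2 :> R) //; ring.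
Qed.

(** This is [E[1 / sqrt (Z + 1)] <= 1 / sqrt ((m + 1) x)] for [Z] binomial of parameters [m] and
    [x]: the inverse square root is bounded by an affine function of [1 / (Z + 1)], whose mean is
    easy to bound. *)
Lemma binomial_inv_sqrt m (x y : R) : 0 < x -> 0 <= y -> x + y = 1 ->
  \sum_(k < m.+1) 'C(m, k)%:R * x ^+ k * y ^+ (m - k) / Num.sqrt k.+1%:R
  <= (Num.sqrt (m.+1%:R * x))^-1.
Proof.
move=> x0 y0 xy; set l := Num.sqrt (m.+1%:R * x).
have mx0 : 0 < m.+1%:R * x by rewrite mulr_gt0 ?ltr0n.
have l0 : 0 < l by rewrite sqrtr_gt0.
have l2 : l ^+ 2 = m.+1%:R * x by rewrite sqr_sqrtr // ltW.
have b1 : \sum_(k < m.+1) 'C(m, k)%:R * x ^+ k * y ^+ (m - k) = 1.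
  transitivity ((y + x) ^+ m); last by rewrite addrC xy expr1n.
  rewrite exprDn; apply: eq_bigr => k _.
  by rewrite -[RHS]mulr_natl -mulrA [_ * y ^+ _]mulrC.
(* Since [(m + 1) C(m, k) = (k + 1) C(m + 1, k + 1)], the sum times [(m + 1) x] is the expansion of
   [(x + y)^(m + 1)] without its first term. *)
have b2 : \sum_(k < m.+1) 'C(m, k)%:R * x ^+ k * y ^+ (m - k) / k.+1%:R <= 1 / l ^+ 2.
  rewrite l2 ler_pdivlMr // mulr_suml.
  apply: (@le_trans _ _ ((y + x) ^+ m.+1)); last by rewrite addrC xy expr1n.
  rewrite exprDn [leRHS]big_ord_recl /= -[leLHS]add0r lerD //.
    by rewrite mulrn_wge0 // mulr_ge0 // exprn_ge0 // ltW.
  apply: ler_sum => k _; rewrite /bump /= add1n subSS le_eqVlt; apply/orP; left; apply/eqP.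
  have := mul_bin_diag m.+1 k; rewrite /= => /(congr1 (fun z => z%:R : R)).
  rewrite !natrM => e; rewrite -[RHS]mulr_natl exprS.
  have k1 : k.+1%:R != 0 :> R by rewrite pnatr_eq0.
  apply: (mulfI k1); rewrite [RHS]mulrA -e; field.
  by rewrite addrC natr1.
(* AM-GM: [1 / z <= (l / z^2 + 1 / l) / 2], with [l] such that both halves contribute
   [1 / (2 l)]. *)
apply: (@le_trans _ _ (\sum_(k < m.+1) 'C(m, k)%:R * x ^+ k * y ^+ (m - k) *
    ((l / k.+1%:R + l^-1) / 2))).
  apply: ler_sum => k _; rewrite ler_wpM2l //.
    by rewrite !mulr_ge0 // exprn_ge0 // ltW.
  have k0 : 0 < k.+1%:R :> R by rewrite ltr0n.
  set z := Num.sqrt _; have z0 : 0 < z by rewrite sqrtr_gt0.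
  have <- : z ^+ 2 = k.+1%:R by rewrite sqr_sqrtr // ltW.
  rewrite -subr_ge0 (_ : _ - _ = (l / z - 1) ^+ 2 / (2 * l)).
    by rewrite divr_ge0 ?sqr_ge0 // mulr_ge0 // ltW.
  by field; rewrite !gt_eqF.
have -> : \sum_(k < m.+1) 'C(m, k)%:R * x ^+ k * y ^+ (m - k) *
    ((l / k.+1%:R + l^-1) / 2) =
    l / 2 * (\sum_(k < m.+1) 'C(m, k)%:R * x ^+ k * y ^+ (m - k) / k.+1%:R)
    + l^-1 / 2 * (\sum_(k < m.+1) 'C(m, k)%:R * x ^+ k * y ^+ (m - k)).
  rewrite !mulr_sumr -big_split; apply: eq_bigr => k _ /=; ring.
rewrite b1; apply: (@le_trans _ _ (l / 2 * (1 / l ^+ 2) + l^-1 / 2 * 1)).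
  by rewrite lerD2r ler_wpM2l // divr_ge0 // ltW.
rewrite le_eqVlt; apply/orP; left; apply/eqP; field; by rewrite gt_eqF.
Qed.

(** Split the step polynomial as [h + q (1 + X)^2] with [h] nonnegative. Among [m] steps a binomial
    number [k], of parameter [4 q], is of the second kind and contributes [(1 + X)^(2 k)], whose
    coefficients are at most [4^k / sqrt (k + 1)]; convolving with the remaining steps only
    multiplies this by their mass. *)
Lemma trinomial_coef_le (p0 p1 p2 q : R) m s : 0 < q -> q <= p1 -> q <= p2 ->
  2 * q <= p0 -> p0 + p1 + p2 = 1 ->
  ((p2%:P + p0 *: 'X + p1 *: 'X^2) ^+ m)`_s <= (Num.sqrt (m.+1%:R * (4 * q)))^-1.
Proof.
move=> q0 qp1 qp2 qp0 psum.
pose h : {poly R} := (p2 - q)%:P + (p0 - 2 * q) *: 'X + (p1 - q) *: 'X^2.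
have h0 : coef_nneg h.
  move=> i; rewrite /h !coefD coefC !coefZ coefX coefXn.
  case: i => [|[|[|i]]] //=; rewrite ?mulr0 ?mulr1 ?addr0 ?add0r; lra.
have h1 : h.[1] = 1 - 4 * q.
  rewrite /h !(hornerD, hornerZ, hornerX, hornerXn, hornerC) expr1n; lra.
have -> : p2%:P + p0 *: 'X + p1 *: 'X^2 = h + q *: (1 + 'X) ^+ 2.
  apply/polyP => i; rewrite /h !coefD !coefZ !coefC coefX coefXn coef_1DX.
  case: i => [|[|[|i]]] /=; rewrite ?bin0 ?bin1 ?binn ?(@bin_small 2 i.+3) //;
    rewrite ?mulr0n ?mulr1n ?mulr0 ?mulr1 ?addr0 ?add0r; ring.
rewrite exprDn coef_sum.
apply: (@le_trans _ _ (\sum_(k < m.+1) 'C(m, k)%:R * (4 * q) ^+ k * (1 - 4 * q) ^+ (m - k) / Num.sqrt k.+1%:R)); last first.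
  by apply: binomial_inv_sqrt; lra.
apply: ler_sum => k _; rewrite coefMn -[leLHS]mulr_natl -!mulrA ler_wpM2l //.
rewrite exprZn -exprM -scalerAr coefZ mulrC exprMn.
have : ((1 + 'X) ^+ (2 * k) * h ^+ (m - k))`_s <=
    4 ^+ k / Num.sqrt k.+1%:R * (h ^+ (m - k)).[1].
  apply: coefM_le; first exact: coef_nnegX.
    move=> i; rewrite coef_1DX; apply: le_trans (bin_central_sqrt k).
    by rewrite ler_nat mul2n bin_central_max.
  by rewrite divr_ge0 ?exprn_ge0 ?sqrtr_ge0.
rewrite horner_exp h1 [_ * h ^+ _]mulrC => hc.
apply: (@le_trans _ _ (q ^+ k * (4 ^+ k / Num.sqrt k.+1%:R * (1 - 4 * q) ^+ (m - k)))).
  by rewrite [leLHS]mulrC ler_wpM2l // exprn_ge0 // ltW.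
by rewrite le_eqVlt; apply/orP; left; apply/eqP; ring.
Qed.

End littlewood_offord.

Section class_anticoncentration.
Context (R : realType) (n : nat) (J : {set 'I_n}) (F : finType) (f0 : F).
Variables (w : F -> R) (D1 D2 : pred F).
Hypothesis w0 : forall f, 0 <= w f.
Hypothesis w1 : \sum_f w f = 1.
Hypothesis D12 : forall f, D1 f -> D2 f -> False.

Let p1 := \sum_(f | D1 f) w f.
Let p2 := \sum_(f | D2 f) w f.

(** The step [+1] on [D1], [-1] on [D2], shifted by one to be a natural exponent: the sum over [J]
    is [#|J|] plus the difference of the two counts. *)
Let zeta (f : F) : nat := if D1 f then 2%N else if D2 f then 0%N else 1%N.

Let zetaE (e : {ffun 'I_n -> F}) : (\sum_(k in J) zeta (e k) + class_count J D2 e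
  = #|J| + class_count J D1 e)%N.
Proof.
rewrite /class_count -!sum1_card.
rewrite [X in (_ + X)%N](_ : _ = \sum_(k in J) (D2 (e k) : nat))%N; last first.
  rewrite big_mkcond [RHS]big_mkcond /=; apply: eq_bigr => k _.
  by rewrite inE; case: (k \in J); case: (D2 _).
rewrite [X in (_ = _ + X)%N](_ : _ = \sum_(k in J) (D1 (e k) : nat))%N; last first.
  rewrite big_mkcond [RHS]big_mkcond /=; apply: eq_bigr => k _.
  by rewrite inE; case: (k \in J); case: (D1 _).
rewrite -!big_split; apply: eq_bigr => k _ /=; rewrite /zeta.
by have := @D12 (e k); case: (D1 _); case: (D2 _) => //= h; case: (h isT isT).
Qed.

Lemma class_prob_zeta (s : nat) :
  class_prob J f0 w [pred e : {ffun 'I_n -> F} | (\sum_(k in J) zeta (e k) == s)%N]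
  = (((p2%:P + (1 - p1 - p2) *: 'X + p1 *: 'X^2) ^+ #|J|) `_ s).
Proof.
have -> : p2%:P + (1 - p1 - p2) *: 'X + p1 *: 'X^2 =
    \sum_f w f *: 'X^(zeta f) :> {poly R}.
  have e1 : 1 - p1 - p2 = \sum_(f | ~~ D1 f && ~~ D2 f) w f.
    have : \sum_f w f = p1 + (p2 + \sum_(f | ~~ D1 f && ~~ D2 f) w f).
      rewrite (bigID D1) /=; congr (_ + _).
      rewrite (bigID D2) /=; congr (_ + _); apply: eq_bigl => f.
      by have := @D12 f; case: (D1 f); case: (D2 f) => // h; case: (h isT isT).
    rewrite w1; lra.
  rewrite e1 /p1 /p2 raddf_sum /= !scaler_suml.
  rewrite big_mkcond [X in _ + X + _]big_mkcond [X in _ + X]big_mkcond -!big_split /=.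
  apply: eq_bigr => f _; rewrite /zeta; have := @D12 f.
  case: (D1 f); case: (D2 f) => /= h; rewrite ?expr0 ?expr1 ?add0r ?addr0 ?alg_polyC //.
  by case: (h isT isT).
rewrite -prodr_const (big_distr_big_dep f0) coef_sum /class_prob big_mkcondr.
apply: eq_bigr => e _.
have -> : \prod_(k in J) (w (e k) *: 'X^(zeta (e k))) =
    (\prod_(k in J) w (e k)) *: 'X^(\sum_(k in J) zeta (e k))%N :> {poly R}.
  elim/big_rec3: _ => [|k a b c _ ->]; first by rewrite expr0 scale1r.
  by rewrite exprD -scalerAl -scalerAr scalerA.
by rewrite coefZ coefXn /= eq_sym; case: (_ == _); rewrite ?mulr1 ?mulr0.
Qed.

(** The difference of the counts takes one of [2 t + 1] values, and the probability of each is one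
    coefficient of a power of the step polynomial. *)
Lemma class_anticoncentration (q : R) (t : nat) : 0 < q -> q <= p1 -> q <= p2 ->
  p1 + p2 + 2 * q <= 1 ->
  class_prob J f0 w [pred e |
    (class_count J D1 e <= class_count J D2 e + t)%N &&
    (class_count J D2 e <= class_count J D1 e + t)%N]
  <= (2 * t + 1)%:R / Num.sqrt (#|J|.+1%:R * (4 * q)).
Proof.
move=> q0 qp1 qp2 qp.
apply: (@le_trans _ _ (\sum_(s < (2 * t + 1)%N) class_prob J f0 w
   [pred e : {ffun 'I_n -> F} | (\sum_(k in J) zeta (e k) + t == #|J| + s)%N])).
  rewrite class_probE; under [leRHS]eq_bigr do rewrite class_probE.
  rewrite -class_E_sum; apply: class_E_le => // e.
  case: (boolP (_ e)) => [/= /andP[h1 h2]|_]; last by apply: sumr_ge0.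
  have hz := zetaE e.
  have hs : (\sum_(k in J) zeta (e k) + t - #|J| < 2 * t + 1)%N by lia.
  have E : (\sum_(k in J) zeta (e k) + t == #|J| +
      (\sum_(k in J) zeta (e k) + t - #|J|))%N by apply/eqP; lia.
  rewrite (bigD1 (Ordinal hs)) //= E.
  by rewrite lerDl; apply: sumr_ge0.
rewrite -[(2 * t + 1)%N in leRHS]card_ord mulr_natl -sumr_const.
apply: ler_sum => s _.
have [st|st] := leqP t (#|J| + s)%N; last first.
  rewrite class_probE (_ : (fun e => _) = (fun=> 0)).
    rewrite /class_E big1 ?invr_ge0 ?sqrtr_ge0 // => e _; exact: mulr0.
  apply/funext => e /=; case: eqP => // h; exfalso.
  move: st; rewrite -h; apply/negP; rewrite -leqNgt; exact: leq_addl.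
apply: (@le_trans _ _ (class_prob J f0 w
    [pred e : {ffun 'I_n -> F} | (\sum_(k in J) zeta (e k) == #|J| + s - t)%N])).
  rewrite !class_probE; apply: class_E_le => // e /=.
  case: eqP => [h|_]; last by case: eqP.
  by rewrite -h addnK eqxx.
rewrite class_prob_zeta; apply: trinomial_coef_le => //; lra.
Qed.

End class_anticoncentration.

(** * Number of cells occupied exactly twice: second moment method *)

Section exactly_two.
Context (R : realType) (n : nat) (J : {set 'I_n}) (F : finType) (f0 : F).
Variables (w : F -> R) (G : {set F}) (theta : R).
Hypothesis w0 : forall f, 0 <= w f.
Hypothesis w1 : \sum_f w f = 1.
Hypothesis theta1 : theta < 1.
Hypothesis wG : forall c, c \in G -> w c <= theta.

Definition cell_two (c : F) (e : {ffun 'I_n -> F}) : bool :=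
  (class_count J (pred1 c) e == 2)%N.

Definition two_cells (e : {ffun 'I_n -> F}) : nat := #|[set c in G | cell_two c e]%SET|.

Let pairs := [set S : {set 'I_n} | (S \subset J) && (#|S| == 2%N)]%SET.

(** For [S] included in [J], the indicator that the nodes of class [c] are exactly those of [S],
    written as a product over nodes so that its mean factorises. *)
Let I (S : {set 'I_n}) c (e : {ffun 'I_n -> F}) : R :=
  \prod_(k in J) ((e k == c) == (k \in S))%:R.

Let cell_twoE c e : (cell_two c e)%:R = \sum_(S in pairs) I S c e :> R.
Proof.
pose S0 := [set k in J | e k == c]%SET.
have IE (S : {set 'I_n}) : S \subset J -> I S c e = (S == S0)%:R.
  move=> /fintype.subsetP SJ; have [->|SS] := eqVneq S S0.
    rewrite /I big1 // => k kJ; by rewrite inE kJ eqxx.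
  have [k kJ h] : exists2 k, k \in J & (e k == c) != (k \in S).
    apply/exists_inP; apply: contraNT SS => /exists_inPn h.
    apply/eqP/setP => k; rewrite inE.
    case: (boolP (k \in J)) => [kJ|kJ] /=; last by apply: contraNF kJ; exact: SJ.
    by have := h k kJ; rewrite negbK => /eqP ->.
  by rewrite /I (bigD1 k) //= (negbTE h) mul0r.
have S0J : S0 \subset J by apply/fintype.subsetP => k; rewrite inE => /andP[].
rewrite /cell_two (_ : class_count _ _ _ = #|S0|) //.
case: eqP => S02.
  have S0P : S0 \in pairs by rewrite inE S0J S02.
  rewrite (bigD1 S0 S0P) (IE S0 S0J) eqxx /= big1 ?addr0 // => S.
  move=> /andP[SP /negbTE SS]; have : S \in pairs := SP; rewrite inE => /andP[SJ _].
  by rewrite IE // SS.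
rewrite big1 // => S; rewrite inE => /andP[SJ /eqP S2]; rewrite IE //.
by case: eqP => // SS; case: S02; rewrite -SS.
Qed.

Let p c := class_E J f0 w (fun e => (cell_two c e)%:R).

Let a (S : {set 'I_n}) c (k : 'I_n) := if k \in S then w c else 1 - w c.

Let wD1 c : \sum_(f | f != c) w f = 1 - w c.
Proof. by move: w1; rewrite (bigD1 c) //= => <-; ring. Qed.

Let w_le1 c : w c <= 1.
Proof. by rewrite -subr_ge0 -wD1 sumr_ge0. Qed.

Let a_ge0 S c k : 0 <= a S c k.
Proof. by rewrite /a; case: ifP; rewrite // subr_ge0. Qed.

Let EI S c : class_E J f0 w (I S c) = \prod_(k in J) a S c k.
Proof.
rewrite (class_E_prod J f0 w (fun k f => ((f == c) == (k \in S))%:R)).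
apply: eq_bigr => k _; rewrite /a; case: ifP => _.
  rewrite (bigD1 c) //= eqxx mulr1 big1 ?addr0 // => f /negbTE ->.
  by rewrite mulr0.
rewrite -wD1 [RHS]big_mkcond; apply: eq_bigr => f _.
by case: (f == c); rewrite ?mulr0 ?mulr1.
Qed.

Let pE c : p c = \sum_(S in pairs) \prod_(k in J) a S c k.
Proof.
rewrite /p; under eq_bigr do rewrite -EI; rewrite -class_E_sum //.
by congr class_E; apply/funext => e; rewrite cell_twoE.
Qed.

Lemma cell_two_prob c : p c = 'C(#|J|, 2)%:R * w c ^+ 2 * (1 - w c) ^+ (#|J| - 2)%N.
Proof.
rewrite pE; under eq_bigr => S.
  rewrite inE => /andP[SJ /eqP S2].
  have -> : \prod_(k in J) a S c k = w c ^+ 2 * (1 - w c) ^+ (#|J| - 2)%N.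
    rewrite (bigID (mem S)) /=; congr (_ * _).
      rewrite (eq_bigl (mem S)); last first.
        move=> k /=; apply/andP/idP => [[]//|kS]; split=> //.
        by move/fintype.subsetP: SJ; exact.
      by rewrite -S2 -prodr_const; apply: eq_bigr => k; rewrite /a /= => ->.
    rewrite -S2 -cardsDS // -prodr_const.
    by apply: eq_big => k; [rewrite !inE andbC|rewrite /a => /andP[_ /negbTE ->]].
  over.
by rewrite /= sumr_const cards_draws -[LHS]mulr_natl mulrA.
Qed.

Let kap := ((1 - theta)^-1) ^+ 4.

(** For given pairs [S] and [S'], compare node by node with the product of the marginals: a node
    outside both has [1 - w c - w c' <= (1 - w c)(1 - w c')], a node in only one costs a factor at
    most [1 / (1 - theta)], and a common node gives 0. At most four nodes lie in the two pairs,
    hence the exponent in [kap]. *)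
Let joint c c' : c \in G -> c' \in G -> c != c' ->
  class_E J f0 w (fun e => (cell_two c e)%:R * (cell_two c' e)%:R)
  <= kap * (p c * p c').
Proof.
move=> cG c'G cc'; rewrite !pE.
have t0 : 0 < 1 - theta by rewrite subr_gt0.
have -> : (fun e => (cell_two c e)%:R * (cell_two c' e)%:R) =
    (fun e => \sum_(S in pairs) \sum_(S' in pairs) I S c e * I S' c' e).
  by apply/funext => e; rewrite !cell_twoE big_distrlr.
rewrite class_E_sum // big_distrlr mulr_sumr; apply: ler_sum => S SP.
rewrite class_E_sum // mulr_sumr; apply: ler_sum => S' SP'.
pose phi (k : 'I_n) (f : F) : R :=
  ((f == c) == (k \in S))%:R * ((f == c') == (k \in S'))%:R.
have -> : (fun e => I S c e * I S' c' e) = (fun e : {ffun 'I_n -> F} => \prod_(k in J) phi k (e k)).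
  by apply/funext => e; rewrite -big_split.
rewrite class_E_prod //.
pose r k := if k \in S :|: S' then (1 - theta)^-1 else 1.
have r1 : 1 <= (1 - theta)^-1.
  have wc := wG cG; have := w0 c => wc0.
  by rewrite invf_ge1 // gerBl; exact: le_trans wc.
have le_k k : \sum_f w f * phi k f <= a S c k * a S' c' k * r k.
  rewrite /phi /a /r finset.in_setU.
  have wc' := wG c'G; have wc := wG cG.
  have c'c : (c' == c) = false by rewrite eq_sym (negbTE cc').
  case: (k \in S); case: (k \in S') => /=.
  - rewrite big1; last first.
      move=> f _; rewrite !eqb_id; have [->|fc] := eqVneq f c.
        by rewrite (negbTE cc') !mulr0.
      by rewrite mul0r mulr0.
    by rewrite !mulr_ge0 // invr_ge0 ltW.
  - rewrite (bigD1 c) //= !eqxx (negbTE cc') !eqxx !mulr1 big1 ?addr0; last first.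
      by move=> f /negbTE ->; rewrite /= mul0r mulr0.
    by rewrite -mulrA ler_peMr // ler_pdivlMr // mul1r; lra.
  - rewrite (bigD1 c') //= !eqxx c'c !eqxx !mulr1 big1 ?addr0; last first.
      by move=> f /negbTE ->; rewrite /= !mulr0.
    by rewrite [_ * w c']mulrC -mulrA ler_peMr // ler_pdivlMr // mul1r; lra.
  rewrite mulr1.
  have -> : \sum_f w f * (((f == c) == false)%:R * ((f == c') == false)%:R) =
      1 - w c - w c'.
    rewrite -wD1 [in RHS](bigD1 c') /=; last by rewrite c'c.
    rewrite [X in X - _]addrC addrK [RHS]big_mkcond.
    apply: eq_bigr => f _.
    by rewrite !eqbF_neg; case: (f != c); case: (f != c'); rewrite /= ?mul1r ?mul0r ?mulr1 ?mulr0.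
  by have := mulr_ge0 (w0 c) (w0 c'); nra.
apply: (@le_trans _ _ (\prod_(k in J) (a S c k * a S' c' k * r k))).
  apply: ler_prod => k _; rewrite le_k andbT; apply: sumr_ge0 => f _.
  by rewrite mulr_ge0 // mulr_ge0.
rewrite !big_split /= [leRHS]mulrC ler_wpM2l //.
  by rewrite mulr_ge0 //; apply: prodr_ge0 => k _; exact: a_ge0.
rewrite /r -big_mkcondr /= prodr_const.
rewrite /kap ler_weXn2l //.
move: SP SP'; rewrite !inE => /andP[_ /eqP S2] /andP[_ /eqP S2'].
apply: (@leq_trans #|S :|: S'|).
  by apply: subset_leq_card; apply/fintype.subsetP => k /andP[].
by rewrite cardsU S2 S2' leq_subr.
Qed.

Definition two_cells_mean : R := \sum_(c in G) p c.

(** Chebyshev's inequality at half the mean [l]; the bound on joint probabilities gives a variance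
    at most [l + (kap - 1) l^2]. *)
Lemma two_cells_lower : 0 < two_cells_mean ->
  class_prob J f0 w [pred e | (two_cells e)%:R <= two_cells_mean / 2]
  <= 4 / two_cells_mean + 4 * (((1 - theta)^-1) ^+ 4 - 1).
Proof.
set l := two_cells_mean => l0.
have BE e : (two_cells e)%:R = \sum_(c in G) (cell_two c e)%:R :> R.
  rewrite /two_cells -sum1_card natr_sum big_mkcond [RHS]big_mkcond /=.
  by apply: eq_bigr => c _; rewrite inE; case: (c \in G); case: (cell_two _ _).
have EB : class_E J f0 w (fun e => (two_cells e)%:R) = l.
  rewrite /l /two_cells_mean -class_E_sum //.
  by congr class_E; apply/funext => e; rewrite BE.
have p0 c : 0 <= p c by apply: class_E_ge0.
have EB2 : class_E J f0 w (fun e => (two_cells e)%:R ^+ 2) <= l + kap * l ^+ 2.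
  have -> : (fun e => (two_cells e)%:R ^+ 2 : R) = (fun e : {ffun 'I_n -> F} =>
     \sum_(c in G) \sum_(c' in G) (cell_two c e)%:R * (cell_two c' e)%:R).
    by apply/funext => e; rewrite BE expr2 big_distrlr.
  rewrite class_E_sum // expr2 {2 3}/l /two_cells_mean big_distrlr mulr_sumr {1}/l -big_split.
  apply: ler_sum => c cG; rewrite class_E_sum // (bigD1 c) //= [X in _ + _ * X](bigD1 c) //=.
  have k0 : 0 <= kap by rewrite exprn_ge0 // invr_ge0 subr_ge0 ltW.
  rewrite mulrDr; apply: lerD.
    have -> : (fun e => (cell_two c e)%:R * (cell_two c e)%:R) = (fun e => (cell_two c e)%:R : R).
      by apply/funext => e; case: (cell_two c e); rewrite ?mulr1 ?mulr0.
    exact: lexx.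
  apply: ler_wpDl; first by rewrite mulr_ge0 // mulr_ge0.
  rewrite mulr_sumr; apply: ler_sum => c' /andP[c'G cc']; apply: joint => //.
  by rewrite eq_sym.
apply: le_trans (class_prob_markov J f0 w0 (a := l ^+ 2 / 4)
  (phi := fun e => ((two_cells e)%:R - l) ^+ 2) _ _ _) _.
- by rewrite divr_gt0 // exprn_gt0.
- by move=> e; exact: sqr_ge0.
- move=> e /= h; have := ler0n R (two_cells e); nra.
rewrite ler_pdivrMr; last by rewrite divr_gt0 // exprn_gt0.
have -> : (fun e => ((two_cells e)%:R - l) ^+ 2) =
  (fun e => (two_cells e)%:R ^+ 2 + ((- 2 * l) * (two_cells e)%:R + l ^+ 2 * 1)).
  by apply/funext => e; ring.
rewrite class_ED class_ED !class_EZ EB class_E1 //.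
apply: (@le_trans _ _ (l + (kap - 1) * l ^+ 2)); first by move: EB2; lra.
rewrite -/kap le_eqVlt; apply/orP; left; apply/eqP; field; lra.
Qed.

(** Bernoulli's inequality keeps the probability that the remaining nodes avoid the cell above
    [1 - #|J| theta >= 1 / 2]. *)
Lemma two_cells_mean_ge (b : R) : (#|J|%:R * theta <= 1 / 2) -> 0 <= b ->
  (forall c, c \in G -> b <= w c) ->
  #|G|%:R * ('C(#|J|, 2)%:R * b ^+ 2 / 2) <= two_cells_mean.
Proof.
move=> Jt b0 hb; rewrite mulr_natl -sumr_const; apply: ler_sum => c cG.
rewrite cell_two_prob; apply: ler_pM.
- by rewrite mulr_ge0 // exprn_ge0.
- by rewrite invr_ge0.
- by rewrite ler_wpM2l // lerXn2r // ?nnegrE ?hb // (le_trans b0) // hb.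
have bern (x : R) m : 0 <= x <= 1 -> 1 - m%:R * x <= (1 - x) ^+ m.
  move=> /andP[x0 x1]; elim: m => [|m ih]; first by rewrite mul0r subr0 expr0.
  rewrite exprS -natr1; apply: (@le_trans _ _ ((1 - x) * (1 - m%:R * x))).
    have : 0 <= m%:R * x ^+ 2 by rewrite mulr_ge0 // sqr_ge0.
    nra.
  by rewrite ler_wpM2l // subr_ge0.
have wc := wG cG; have wc0 := w0 c.
apply: le_trans (bern _ _ _); last by rewrite wc0 w_le1.
have h1 : (#|J| - 2)%N%:R * w c <= #|J|%:R * theta.
  by rewrite ler_pM // ler_nat leq_subr.
have : (2^-1 : R) = 1 / 2 by rewrite div1r.
lra.
Qed.

End exactly_two.

(** * Masses of hyperbolic balls *)

Section trigonometric_estimates.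
Context {R : realType}.
Implicit Types x y g : R.

Lemma sin_le_id x : 0 <= x -> sin x <= x.
Proof.
move=> x0; have [c _] := @MVT_segment _ sin cos 0 x x0
  (fun z _ => is_derive_sin z) (continuous_subspaceT (@continuous_sin R)).
rewrite sin0 !subr0 => ->; rewrite ler_piMl // cos_le1.
Qed.

Lemma sin_ge_cosM x : 0 <= x <= pi -> x * cos x <= sin x.
Proof.
move=> /andP[x0 xpi].
pose f (z : R) := sin z - z * cos z.
have df (z : R) : is_derive z 1 f (z * sin z).
  rewrite /f; apply: is_derive_eq; rewrite /GRing.scale /=; ring.
have cf : continuous f.
  by move=> z; apply: differentiable_continuous; apply/derivable1_diffP.
have [c] := @MVT_segment _ f (fun z => z * sin z) 0 x x0
  (fun z _ => df z) (continuous_subspaceT cf).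
rewrite in_itv /= => /andP[c0 cx].
rewrite /f sin0 mul0r !subr0 => e; rewrite -subr_ge0 e.
by rewrite !mulr_ge0 // sin_ge0_pi // c0 (le_trans cx).
Qed.

(** [sin x = 2 sin (x/2) cos (x/2) >= x cos (x/2)^2 = x (1 + cos x) / 2 >= x / 2]. *)
Lemma sin_ge_half x : 0 <= x <= pi / 2 -> x / 2 <= sin x.
Proof.
move=> /andP[x0 xpi]; have p2 := pi_ge2 R.
have e : sin x = 2 * sin (x / 2) * cos (x / 2).
  have {1}-> : x = (x / 2) *+ 2 by rewrite -mulr_natl; field.
  by rewrite sin_mulr2n -mulr_natl; ring.
have c2 : 2 * cos (x / 2) ^+ 2 = 1 + cos x.
  have {2}-> : x = (x / 2) *+ 2 by rewrite -mulr_natl; field.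
  by rewrite cos_mulr2n -mulr_natl; ring.
have cx : 0 <= cos x by apply: cos_ge0_pihalf; lra.
have c0 : 0 <= cos (x / 2) by apply: cos_ge0_pihalf; lra.
have s : x / 2 * cos (x / 2) <= sin (x / 2) by apply: sin_ge_cosM; lra.
have := ler_wpM2r c0 s; rewrite e; nra.
Qed.

Lemma one_minus_cosE x : 1 - cos x = 2 * sin (x / 2) ^+ 2.
Proof.
have {1}-> : x = (x / 2) *+ 2 by rewrite -mulr_natl; field.
by rewrite cos_mulr2n -mulr_natl; have := cos2Dsin2 (x / 2); lra.
Qed.

Lemma sqr_le_one_minus_cos x : 0 <= x <= pi -> x ^+ 2 <= 8 * (1 - cos x).
Proof.
move=> /andP[x0 xpi]; rewrite one_minus_cosE.
have : x / 2 / 2 <= sin (x / 2) by apply: sin_ge_half; lra.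
nra.
Qed.

Lemma cosB_le x y : 0 <= x -> x <= y -> cos x - cos y <= (y - x) * y.
Proof.
move=> x0 xy; have y0 := le_trans x0 xy.
pose f (z : R) := - cos z.
have df (z : R) : is_derive z 1 f (sin z).
  by rewrite /f; apply: is_derive_eq; rewrite opprK.
have cf : continuous f.
  by move=> z; apply: differentiable_continuous; apply/derivable1_diffP.
have [c] := @MVT_segment _ f sin x y xy (fun z _ => df z) (continuous_subspaceT cf).
rewrite in_itv /= => /andP[c0 cy]; rewrite /f opprK addrC => ->.
have sc := sin_le_id (le_trans x0 c0).
have : 0 <= y - x by rewrite subr_ge0.
nra.
Qed.

(* The probability that two independent uniform angles differ by [t] with
   [1 - cos t <= g]. *)
Definition arc_prob g : R := if g <= 2 then acos (1 - g) / pi else 1.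

Lemma acos_1B g : 0 <= g <= 2 ->
  [/\ 0 <= acos (1 - g), acos (1 - g) <= pi & cos (acos (1 - g)) = 1 - g].
Proof.
move=> g02; have h : -1 <= 1 - g <= 1 by lra.
by rewrite acos_ge0 // acos_lepi // acosK // in_itv /=; split.
Qed.

Lemma arc_prob_le1 g : 0 <= g -> arc_prob g <= 1.
Proof.
move=> g0; rewrite /arc_prob; case: (leP g 2) => // g2.
have [] := @acos_1B g; first by rewrite g0.
by move=> _ h _; rewrite ler_pdivrMr ?pi_gt0 // mul1r.
Qed.

Lemma arc_prob_le g : 0 <= g -> arc_prob g <= 2 * Num.sqrt g.
Proof.
move=> g0; have s0 := sqrtr_ge0 g; have s2 : Num.sqrt g ^+ 2 = g by rewrite sqr_sqrtr.
rewrite /arc_prob; case: (leP g 2) => g2; last first.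
  by have : 1 <= Num.sqrt g ^+ 2; [rewrite s2; lra|nra].
have [] := @acos_1B g; first by rewrite g0.
set t := acos _ => t0 tpi ct; have p2 := pi_ge2 R.
rewrite ler_pdivrMr ?pi_gt0 //.
have : t ^+ 2 <= 8 * g.
  by have := @sqr_le_one_minus_cos t; rewrite t0 tpi ct => /(_ isT); lra.
move: s0 s2; set s : R := Num.sqrt g => s0 s2 tg.
have : t ^+ 2 <= (4 * s) ^+ 2 by nra.
rewrite ler_sqr ?nnegrE //; last by lra.
nra.
Qed.

Lemma arc_prob_homo g1 g2 : 0 <= g1 -> g1 <= g2 -> arc_prob g1 <= arc_prob g2.
Proof.
move=> g10 g12; rewrite {2}/arc_prob; case: (leP g2 2) => g22; last exact: arc_prob_le1.
rewrite /arc_prob (le_trans g12 g22).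
have [] := @acos_1B g1; first by rewrite g10 (le_trans g12).
have [] := @acos_1B g2; first by rewrite (le_trans g10).
move=> a b c d e f; rewrite ler_pM2r ?invr_gt0 ?pi_gt0 //.
rewrite leNgt; apply/negP => h.
have : cos (acos (1 - g1)) < cos (acos (1 - g2)).
  by rewrite ltr_cos // in_itv /= ?a ?b ?d ?e.
by rewrite c f ltrD2l ltrN2 ltNge g12.
Qed.

(** The derivative of the arc grows like [1 / sqrt g] at small gaps. Here
    [cos t1 - cos t2 <= (t2 - t1) t2], [t2 <= sqrt (8 g2) <= 3 sqrt g2] and [pi <= 4], hence 12. *)
Lemma arc_probB g1 g2 : 0 <= g1 -> g1 <= g2 -> g2 <= 2 -> 0 < g2 ->
  (g2 - g1) / (12 * Num.sqrt g2) <= arc_prob g2 - arc_prob g1.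
Proof.
move=> g10 g12 g22 g20; rewrite /arc_prob g22 (le_trans g12 g22).
have [] := @acos_1B g1; first by rewrite g10 (le_trans g12).
have [] := @acos_1B g2; first by rewrite (ltW g20).
set t2 := acos (1 - g2); set t1 := acos (1 - g1) => a b c d e f.
have t12 : t1 <= t2.
  rewrite leNgt; apply/negP => h; have : cos t1 < cos t2.
    by rewrite ltr_cos // in_itv /= ?a ?b ?d ?e.
  by rewrite c f ltrD2l ltrN2 ltNge g12.
have h := cosB_le d t12; rewrite c f in h.
have hs := @sqr_le_one_minus_cos t2; rewrite a b c in hs.
have {}hs := hs isT.
set s : R := Num.sqrt g2; have s0 : 0 < s by rewrite sqrtr_gt0.
have s2 : s ^+ 2 = g2 by rewrite sqr_sqrtr // ltW.
have ts : t2 <= 3 * s.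
  rewrite -(@ler_pXn2r _ 2) ?nnegrE //; last by lra.
  by rewrite exprMn s2; lra.
have p4 : pi <= 4 :> R by have := pihalf_lt2 R; lra.
have p0 := pi_gt0 R.
rewrite -mulrBl ler_pdivrMr; last by rewrite mulr_gt0.
rewrite mulrAC ler_pdivlMr //.
have dt : 0 <= t2 - t1 by rewrite subr_ge0.
apply: (@le_trans _ _ ((t2 - t1) * (3 * s) * pi)).
  rewrite ler_wpM2r ?(ltW p0) //; apply: (@le_trans _ _ ((t2 - t1) * t2)).
    by lra.
  by rewrite ler_wpM2l.
have : 0 <= (t2 - t1) * s by rewrite mulr_ge0 // ltW.
nra.
Qed.

(** A quasi-triangle inequality: up to a factor, [1 - cos] is a squared chord. It serves to show
    that arcs around well separated angles are disjoint. *)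
Lemma one_minus_cosD_le x y :
  1 - cos (x + y) <= 2 * ((1 - cos x) + (1 - cos y)).
Proof.
rewrite !one_minus_cosE (mulrDl x y) sinD.
have := cos2Dsin2 (x / 2); have := cos2Dsin2 (y / 2).
set s := sin (x / 2); set c := cos (x / 2); set s' := sin (y / 2); set c' := cos (y / 2).
move=> h h'; have := sqr_ge0 (s * c' - c * s').
have := mulr_ge0 (sqr_ge0 s) (sqr_ge0 s'); nra.
Qed.

End trigonometric_estimates.

Section arcs.
Context {R : realType}.
Local Notation U := (uniform_prob (ltNpi R)).
Local Notation lambda := (@lebesgue_measure R).

Lemma uniform_probE (A B : set R) (l : R) : measurable A ->
  A `&` `[- pi, pi]%classic = B -> lambda B = l%:E -> U A = (l / (2 * pi))%:E.
Proof.
move=> mA AB lB; rewrite /uniform_prob integral_uniform_pdf AB.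
transitivity (\int[lambda]_(x in B) cst ((2 * pi)^-1)%:E x)%E.
  apply: eq_integral => x; rewrite -AB inE => -[_ /=].
  by rewrite in_itv /= /uniform_pdf => ->; congr (_^-1%:E); ring.
have mB : measurable B by rewrite -AB; exact: measurableI.
rewrite [RHS]EFinM muleC -lB; exact: integral_cst.
Qed.

Lemma cos_ge_cosP (t x : R) : 0 <= t <= pi -> - (2 * pi) <= x <= 2 * pi ->
  (cos t <= cos x) = (`|x| <= t) || (2 * pi - t <= `|x|).
Proof.
move=> /andP[t0 tpi] hx; have p0 := pi_gt0 R; rewrite -[cos x]cos_norm.
have x0 := normr_ge0 x; have x2 : `|x| <= 2 * pi by rewrite ler_norml; lra.
have mono (a b : R) : 0 <= a <= pi -> 0 <= b <= pi -> (cos a <= cos b) = (b <= a).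
  by move=> ha hb; rewrite !leNgt ltr_cos // in_itv.
case: (leP `|x| pi) => xpi.
  rewrite mono; [|lra|lra].
  by case: (leP `|x| t) => //= xt; apply/esym/negbTE; rewrite -ltNge; lra.
have -> : cos `|x| = cos (2 * pi - `|x|).
  rewrite -[RHS]cosN opprB -[in LHS](subrK (2 * pi) `|x|).
  by rewrite mulr_natl; exact: cosD2pi.
rewrite mono; [|lra|lra].
have -> : (`|x| <= t) = false by apply/negbTE; rewrite -ltNge; lra.
by rewrite /= lerBlDr lerBlDl addrC.
Qed.

Lemma measurable_cos_ge (a c : R) : measurable [set f : R | c <= cos (a - f)].
Proof.
have mf : measurable_fun setT (fun f : R => cos (a - f)).
  apply: continuous_measurable_fun => z; apply: continuous_comp.
    by apply: cvgB; [exact: cvg_cst|exact: cvg_id].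
  exact: continuous_cos.
rewrite (_ : mkset _ = (fun f : R => cos (a - f)) @^-1` `[c, +oo[%classic).
  by rewrite -[X in measurable X]setTI; exact: mf.
by apply/seteqP; split=> f /=; rewrite in_itv /= andbT.
Qed.

(** Inside [[- pi, pi]] the arc is one interval or, when it crosses the cut at [pi] or [- pi], two;
    the total length is [2 t] in all cases. *)
Lemma uniform_arc (a t : R) : - pi <= a <= pi -> 0 <= t <= pi ->
  U [set f : R | cos t <= cos (a - f)] = (t / pi)%:E.
Proof.
move=> ha /andP[t0 tpi]; have p0 := pi_gt0 R.
have mS := measurable_cos_ge a (cos t).
have inS (f : R) : - pi <= f <= pi -> (cos t <= cos (a - f)) <->
    (- t <= a - f /\ a - f <= t) \/ (2 * pi - t <= a - f) \/ (2 * pi - t <= f - a).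
  move=> hf; rewrite cos_ge_cosP; [|lra|lra]; rewrite ler_norml ler_normr opprB.
  split; first by case/or3P => [/andP[]||]; tauto.
  by move=> [[-> ->]//|[->|->]]; rewrite ?orbT.
suff [B [hB lB]] : exists B, [set f : R | cos t <= cos (a - f)] `&` `[- pi, pi]%classic = B /\
    lambda B = (2 * t)%:E.
  by rewrite (uniform_probE mS hB lB); rewrite -mulf_div divff ?mul1r // pnatr_eq0.
(* For [t = pi] the two pieces of a cut arc would touch, and [two] asks for disjoint intervals. *)
have [->|tpi'] := eqVneq t pi.
  exists `[- pi, pi]%classic; split.
    by apply/seteqP; split=> f /= [] // h; split=> //; rewrite cospi cos_geN1.
  by rewrite lebesgue_measure_itv /= lte_fin ltNpi; congr EFin; ring.
have {}tpi' : t < pi by rewrite lt_neqAle tpi'.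
have itvE (x y : R) : x <= y -> lambda `[x, y]%classic = (y - x)%:E.
  rewrite le_eqVlt => /orP[/eqP ->|xy]; last first.
    by rewrite lebesgue_measure_itv /= lte_fin xy.
  by rewrite set_itv1 lebesgue_measure_set1 subrr.
have two (x y x' y' : R) : x <= y -> y < x' -> x' <= y' ->
    lambda (`[x, y] `|` `[x', y'])%classic = (y - x + (y' - x'))%:E.
  move=> xy yx' xy'; rewrite EFinD -!itvE //; apply: measureU => //.
  by apply/seteqP; split=> f //= []; rewrite /= !in_itv /=; lra.
have [up|up] := leP pi (a + t).
  exists (`[- pi, a + t - 2 * pi] `|` `[a - t, pi])%classic; split; last first.
    by rewrite two; [congr EFin; ring|lra|lra|lra].
  apply/seteqP; split=> f /=; rewrite !in_itv /=.
    move=> [+ hf] => /(inS _ hf) [|[|]] h; [right; lra|left; lra|exfalso; lra].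
  move=> h; have hf : - pi <= f <= pi by case: h; lra.
  split=> //; apply/(inS _ hf); case: h => h; [|left; split; lra].
  by right; left; lra.
have [lo|lo] := leP (a - t) (- pi).
  exists (`[- pi, a + t] `|` `[a - t + 2 * pi, pi])%classic; split; last first.
    by rewrite two; [congr EFin; ring|lra|lra|lra].
  apply/seteqP; split=> f /=; rewrite !in_itv /=.
    move=> [+ hf] => /(inS _ hf) [|[|]] h; [left; lra|exfalso; lra|right; lra].
  move=> h; have hf : - pi <= f <= pi by case: h; lra.
  split=> //; apply/(inS _ hf); case: h => h; [left; split; lra|].
  by right; right; lra.
exists `[a - t, a + t]%classic; split; last first.
  by rewrite itvE; [congr EFin; ring|lra].
apply/seteqP; split=> f /=; rewrite !in_itv /=.
  by move=> [+ hf] => /(inS _ hf) [|[|]] h; lra.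
move=> h; have hf : - pi <= f <= pi by lra.
by split=> //; apply/(inS _ hf); left; lra.
Qed.

Lemma uniform_arc_prob (a g : R) : - pi <= a <= pi -> 0 <= g ->
  U [set f : R | 1 - cos (a - f) <= g] = (arc_prob g)%:E.
Proof.
move=> ha g0; rewrite /arc_prob; case: (leP g 2) => g2.
  have [t0 tpi ct] : [/\ 0 <= acos (1 - g), acos (1 - g) <= pi &
    cos (acos (1 - g)) = 1 - g] by apply: acos_1B; rewrite g0.
  rewrite -(uniform_arc ha) ?t0 // ct; congr (U _).
  by apply/seteqP; split=> f /=; lra.
rewrite -[RHS](@probability_setT _ _ _ U); congr (U _).
by apply/seteqP; split=> f //= _; have := cos_geN1 (a - f); lra.
Qed.

End arcs.

Section hyperbolic_estimates.
Context {R : realType}.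
Implicit Types x y r s u L : R.

Lemma cosh_le_expR x : 0 <= x -> cosh x <= expR x.
Proof.
move=> x0; have : expR (- x) <= expR x by rewrite ler_expR; lra.
by rewrite /cosh; lra.
Qed.

Lemma cosh_ge_expR x : expR x / 2 <= cosh x.
Proof. by have := expR_ge0 (- x); rewrite /cosh; lra. Qed.

Lemma sinh_le_expR x : sinh x <= expR x / 2.
Proof. by have := expR_ge0 (- x); rewrite /sinh; lra. Qed.

Lemma sinh_ge_expR x : 1 <= x -> expR x / 4 <= sinh x.
Proof.
move=> x1; have h := expRxMexpNx_1 x; have := expR_ge1Dx x.
by have := expR_gt0 (- x); rewrite /sinh; nra.
Qed.

Lemma sinh_gt0 x : 0 < x -> 0 < sinh x.
Proof.
move=> x0; have : expR (- x) < expR x by rewrite ltr_expR; lra.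
by rewrite /sinh; lra.
Qed.

Lemma cosh_gt0 x : 0 < cosh x.
Proof. exact: lt_le_trans ltr01 (cosh_ge1 x). Qed.

Lemma sinh_ge_id x : 0 <= x -> x <= sinh x.
Proof.
move=> x0.
pose f (z : R) := sinh z - z.
have df (z : R) : is_derive z 1 f (cosh z - 1).
  rewrite /f /sinh /cosh; apply: is_derive_eq.
  by rewrite /GRing.scale /=; field.
have cf : continuous f.
  by move=> z; apply: differentiable_continuous; apply/derivable1_diffP.
have [c _] := @MVT_segment _ f (fun z => cosh z - 1) 0 x x0
  (fun z _ => df z) (continuous_subspaceT cf).
have -> : f 0 = 0 by rewrite /f /sinh oppr0 subrr mul0r add0r.
rewrite !subr0 /f => e; rewrite -subr_ge0 e mulr_ge0 // subr_ge0; exact: cosh_ge1.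
Qed.

Lemma cosh_homo x y : 0 <= x -> x <= y -> cosh x <= cosh y.
Proof.
move=> x0 xy; have : 0 <= sinh ((x + y) / 2) by apply: sinh_ge0; lra.
have : 0 <= sinh ((y - x) / 2) by apply: sinh_ge0; lra.
set a := (x + y) / 2; set b := (y - x) / 2 => hb ha.
have -> : x = a - b by rewrite /a /b; field.
have -> : y = a + b by rewrite /a /b; field.
have := mulr_ge0 ha hb; rewrite /cosh /sinh !expRD !opprD !opprK !expRD; lra.
Qed.

Lemma le_cosh x y : 0 <= x -> 0 <= y -> (cosh x <= cosh y) = (x <= y).
Proof.
move=> x0 y0; apply/idP/idP => [h|]; last exact: cosh_homo.
rewrite leNgt; apply/negP => yx.
have e : cosh x = cosh y by apply/eqP; rewrite eq_le h cosh_homo // ltW.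
by move: yx; rewrite -(coshK x0) -(coshK y0) e ltxx.
Qed.

Lemma cosh_norm x : cosh `|x| = cosh x.
Proof.
case: (ger0P x) => // _; by rewrite /cosh opprK addrC.
Qed.

(* The hyperbolic law of cosines: a node at radius [u] lies within distance [L]
   of one at radius [r] iff the angle [t] between them has
   [1 - cos t <= angular_gap L r u]. *)
Definition angular_gap L r u : R := (cosh L - cosh (r - u)) / (sinh r * sinh u).

Lemma hdist_leE L (y x : R * R) : 0 <= L -> 0 < hradius y -> 0 < hradius x ->
  (hdist y x <= L) =
  (1 - cos (hangle y - hangle x) <= angular_gap L (hradius y) (hradius x)).
Proof.
move=> L0 y0 x0; have sy := sinh_gt0 y0; have sx := sinh_gt0 x0.
have h := cosh_hdist (ltW y0) (ltW x0).
have hd0 : 0 <= hdist y x.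
  apply: arcosh_ge0; have := cosh_ge1 (hradius y - hradius x); rewrite coshB.
  have := cos_le1 (hangle y - hangle x); have := mulr_gt0 sy sx.
  by set c := cos _; set p := sinh _ * _; nra.
have p0 := mulr_gt0 sy sx; have e := coshB (hradius y) (hradius x).
rewrite -le_cosh // h /angular_gap; move: p0 e.
set p := sinh _ * _; set q := cosh _ * _; set c := cos _; set D := cosh (_ - _).
set E := cosh L => p0 e; apply/idP/idP.
  by move=> h1; rewrite ler_pdivlMr // e; lra.
by rewrite ler_pdivlMr // e; lra.
Qed.

Lemma angular_gap_ge0 L r u : 0 < r <= L -> 0 < u <= L -> 0 <= angular_gap L r u.
Proof.
move=> /andP[r0 rL] /andP[u0 uL].
rewrite /angular_gap divr_ge0 //; last by rewrite mulr_ge0 // ltW // sinh_gt0.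
rewrite subr_ge0 -(cosh_norm (r - u)); apply: cosh_homo => //.
by rewrite ler_norml; lra.
Qed.

Lemma angular_gap_le L r u : 0 <= L -> 1 <= r -> 1 <= u ->
  angular_gap L r u <= 16 * expR (L - r - u).
Proof.
move=> L0 r1 u1; have hr := sinh_ge_expR r1; have hu := sinh_ge_expR u1.
have er := expR_gt0 r; have eu := expR_gt0 u.
have r0 : 0 < sinh r by apply: sinh_gt0; lra.
have u0 : 0 < sinh u by apply: sinh_gt0; lra.
rewrite /angular_gap ler_pdivrMr; last exact: mulr_gt0.
apply: (@le_trans _ _ (expR L)).
  by have := cosh_le_expR L0; have := cosh_gt0 (r - u); lra.
have -> : expR L = 16 * expR (L - r - u) * (expR r / 4 * (expR u / 4)).
  have {1}-> : L = (L - r - u) + (r + u) by ring.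
  by rewrite !expRD; field.
rewrite ler_wpM2l ?mulr_ge0 ?expR_ge0 //.
by rewrite ler_pM // divr_ge0 // expR_ge0.
Qed.

(** Quantitative monotonicity of the gap in the radius; it also makes balls of equal angle nested.
    The difference of gaps is explicit; replacing [cosh u] by [cosh L] leaves
    [sinh s - sinh r - sinh (s - r)], which factors into half-argument terms, and [sinh u <= cosh L]
    removes the dependence on [u]. *)
Lemma angular_gapB L r s u : 0 < r -> r <= s -> 0 < u -> u <= L ->
  (s - r) / 2 * expR (- (r + s) / 2) <= angular_gap L r u - angular_gap L s u.
Proof.
move=> r0 rs u0 uL; have s0 : 0 < s by exact: lt_le_trans rs.
have sr := sinh_gt0 r0; have ss := sinh_gt0 s0; have su := sinh_gt0 u0.
pose h := sinh ((s - r) / 2).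
have h0 : 0 <= h by apply: sinh_ge0; lra.
have hge : (s - r) / 2 <= h by apply: sinh_ge_id; lra.
have e1 : angular_gap L r u - angular_gap L s u =
   (cosh L * (sinh s - sinh r) - cosh u * sinh (s - r)) / (sinh u * sinh r * sinh s).
  have sB : sinh (s - r) = sinh s * cosh r - cosh s * sinh r.
    by rewrite /sinh /cosh opprB !expRD; field.
  by rewrite /angular_gap !coshB sB; field; rewrite !gt_eqF.
have e2 : sinh s - sinh r - sinh (s - r) = 4 * h * sinh (s / 2) * sinh (r / 2).
  rewrite /h; set a := s / 2; set b := r / 2.
  have -> : (s - r) / 2 = a - b by rewrite /a /b; field.
  have -> : s - r = (a - b) + (a - b) by rewrite /a /b; field.
  have -> : s = a + a by rewrite /a; field.
  have -> : r = b + b by rewrite /b; field.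
  rewrite /sinh !opprD !opprK !expRD.
  have := expRxMexpNx_1 a; have := expRxMexpNx_1 b.
  set A := expR a; set A' := expR (- a); set B := expR b; set B' := expR (- b).
  move=> hB hA.
  transitivity ((A * A - A' * A') / 2 * (B * B') - (B * B - B' * B') / 2 * (A * A')
      - (A * B' * (A * B') - A' * B * (A' * B)) / 2); last by field.
  by rewrite hA hB; field.
have dbl x : sinh x = 2 * sinh (x / 2) * cosh (x / 2).
  have {1}-> : x = x / 2 + x / 2 by field.
  by rewrite /sinh /cosh opprD !expRD; field.
have sr2 : 0 < sinh (r / 2) by apply: sinh_gt0; lra.
have ss2 : 0 < sinh (s / 2) by apply: sinh_gt0; lra.
have cr2 := cosh_gt0 (r / 2); have cs2 := cosh_gt0 (s / 2).
apply: (@le_trans _ _ (h / (cosh (r / 2) * cosh (s / 2)))).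
  rewrite ler_pdivlMr; last exact: mulr_gt0.
  have -> : - (r + s) / 2 = - (r / 2) + - (s / 2) by field.
  rewrite expRD !expRN.
  have c1 : cosh (r / 2) <= expR (r / 2) by apply: cosh_le_expR; lra.
  have c2 : cosh (s / 2) <= expR (s / 2) by apply: cosh_le_expR; lra.
  have E1 := expR_gt0 (r / 2); have E2 := expR_gt0 (s / 2).
  have : cosh (r / 2) * cosh (s / 2) <= expR (r / 2) * expR (s / 2).
    by apply: ler_pM => //; exact: ltW.
  set X := cosh _ * _; set Y := expR _ * _ => XY.
  have Y0 : 0 < Y by rewrite mulr_gt0.
  have -> : (expR (r / 2))^-1 * (expR (s / 2))^-1 = Y^-1 by rewrite invfM.
  rewrite -[leLHS]mulrA; apply: (@le_trans _ _ ((s - r) / 2)) => //.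
  rewrite ler_piMr //; first lra.
  by rewrite mulrC ler_pdivrMr // mul1r.
rewrite e1.
apply: (@le_trans _ _ (cosh L * (4 * h * sinh (s / 2) * sinh (r / 2)) / (sinh u * sinh r * sinh s))).
  rewrite (dbl r) (dbl s).
  have cL : sinh u <= cosh L.
    apply: (@le_trans _ _ (cosh u)); last by apply: cosh_homo => //; exact: ltW.
    by have := expR_gt0 (- u); rewrite /sinh /cosh; lra.
  have -> : cosh L * (4 * h * sinh (s / 2) * sinh (r / 2)) /
     (sinh u * (2 * sinh (r / 2) * cosh (r / 2)) * (2 * sinh (s / 2) * cosh (s / 2)))
     = (cosh L / sinh u) * (h / (cosh (r / 2) * cosh (s / 2))).
    by field; rewrite !gt_eqF.
  rewrite ler_peMl //; first by rewrite divr_ge0 // mulr_ge0 // ltW.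
  by rewrite ler_pdivlMr // mul1r.
have p0 : 0 < (sinh u * sinh r * sinh s)^-1 by rewrite invr_gt0; exact: mulr_gt0 (mulr_gt0 su sr) ss.
rewrite ler_pM2r // -e2.
have := cosh_homo (ltW u0) uL; have : 0 <= sinh (s - r) by apply: sinh_ge0; lra.
nra.
Qed.

End hyperbolic_estimates.

Section measurability_of_hdist.
Context {R : realType}.

Lemma measurable_expR : measurable_fun setT (@expR R).
Proof. by apply: continuous_measurable_fun; exact: continuous_expR. Qed.

Lemma measurable_coshsinh d (T : measurableType d) (f : T -> R) :
  measurable_fun setT f ->
  measurable_fun setT (fun x => cosh (f x)) /\
  measurable_fun setT (fun x => sinh (f x)).
Proof.
move=> mf; have m1 := measurableT_comp measurable_expR mf.
have m2 : measurable_fun setT (fun x => expR (- f x)).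
  exact: measurableT_comp measurable_expR (measurable_funN mf).
split; apply: measurable_funM => //; last exact: measurable_funB.
exact: measurable_funD.
Qed.

Lemma measurable_hdist :
  measurable_fun setT (fun z : (R * R) * (R * R) => hdist z.1 z.2).
Proof.
have m1 : measurable_fun setT (fun z : (R * R) * (R * R) => hradius z.1).
  exact: measurableT_comp measurable_fst measurable_fst.
have m2 : measurable_fun setT (fun z : (R * R) * (R * R) => hradius z.2).
  exact: measurableT_comp measurable_fst measurable_snd.
have m3 : measurable_fun setT (fun z : (R * R) * (R * R) => hangle z.1).
  exact: measurableT_comp measurable_snd measurable_fst.
have m4 : measurable_fun setT (fun z : (R * R) * (R * R) => hangle z.2).
  exact: measurableT_comp measurable_snd measurable_snd.
have [c1 s1] := measurable_coshsinh m1; have [c2 s2] := measurable_coshsinh m2.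
have mc : measurable_fun setT (@cos R).
  by apply: continuous_measurable_fun; exact: continuous_cos.
have mX : measurable_fun setT (fun z : (R * R) * (R * R) =>
    cosh (hradius z.1) * cosh (hradius z.2)
    - sinh (hradius z.1) * sinh (hradius z.2) * cos (hangle z.1 - hangle z.2)).
  apply: measurable_funB; first exact: measurable_funM.
  apply: measurable_funM; first exact: measurable_funM.
  exact: measurableT_comp mc (measurable_funB m3 m4).
rewrite /hdist /arcosh; apply: (measurableT_comp (@measurable_ln R)).
apply: measurable_funD => //.
have ms : measurable_fun setT (@Num.sqrt R).
  by apply: continuous_measurable_fun; exact: sqrt_continuous.
apply: (measurableT_comp ms); apply: measurable_funB => //.
exact: measurable_funX.
Qed.

Lemma measurable_hdist_le (L : R) d (T : measurableType d) (f g : T -> R * R) :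
  measurable_fun setT f -> measurable_fun setT g ->
  measurable [set x | hdist (f x) (g x) <= L].
Proof.
move=> mf mg.
have mfg : measurable_fun setT (fun x => hdist (f x) (g x)).
  exact: (measurableT_comp measurable_hdist (measurable_fun_pair mf mg)).
rewrite (_ : mkset _ = (fun x => hdist (f x) (g x)) @^-1` `]-oo, L]%classic).
  by rewrite -[X in measurable X]setTI; exact: mfg.
by apply/seteqP; split=> x /=; rewrite in_itv.
Qed.

End measurability_of_hdist.

Section node_masses.
Context {R : realType}.
Variables (alpha L : R).
Hypotheses (a0 : 0 < alpha) (L0 : 0 < L).
Local Notation rad := (radial_law alpha L).
Local Notation U := (uniform_prob (ltNpi R)).
Local Notation mu := (node_law alpha L).
Local Notation Z := (cosh (alpha * L) - 1).

Lemma radial_norm_gt0 : 0 < Z.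
Proof. by rewrite subr_gt0 cosh_gt1 // mulr_gt0. Qed.

Let pdfT (r : R) := alpha * sinh (alpha * r) / Z.

Lemma radial_itv (s t : R) : 0 <= s -> s <= t -> t <= L ->
  rad `[s, t[%classic = ((cosh (alpha * t) - cosh (alpha * s)) / Z)%:E /\
  rad `[s, t]%classic = ((cosh (alpha * t) - cosh (alpha * s)) / Z)%:E.
Proof.
move=> s0 st tL.
have c0 : Z != 0 by rewrite gt_eqF // radial_norm_gt0.
pose F (r : R) := cosh (alpha * r) / Z.
have dF (x : R) : is_derive x 1 F (pdfT x).
  rewrite /F /pdfT; move: c0; set c := Z => c0.
  rewrite /cosh /sinh; apply: is_derive_eq.
  by rewrite /GRing.scale /=; field.
have cF : continuous F.
  by move=> x; apply: differentiable_continuous; apply/derivable1_diffP.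
have cp : continuous pdfT.
  have dp (x : R) : is_derive x 1 pdfT (alpha * alpha * cosh (alpha * x) / Z).
    rewrite /pdfT; move: c0; set c := Z => c0.
    rewrite /cosh /sinh; apply: is_derive_eq.
    by rewrite /GRing.scale /=; field.
  by move=> x; apply: differentiable_continuous; apply/derivable1_diffP.
have mpdf : measurable_fun setT (EFin \o radial_pdf alpha L).
  by apply/measurable_EFinP; exact: measurable_radial_pdf.
have oc : rad `[s, t[%classic = rad `[s, t]%classic.
  rewrite /radial_law; rewrite integral_itv_bndo_bndc //.
  exact: measurable_funTS.
suff h : rad `[s, t[%classic = ((cosh (alpha * t) - cosh (alpha * s)) / Z)%:E.
  by split=> //; rewrite -oc.
have [->|st'] := eqVneq s t.
  rewrite subrr mul0r /radial_law (_ : [set` `[t, t[%R] = set0) ?integral_set0 //.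
  by apply/seteqP; split=> x //=; rewrite in_itv /=; lra.
rewrite /radial_law.
transitivity (\int[lebesgue_measure]_(r in `[s, t[) (pdfT r)%:E)%E.
  apply: eq_integral => r; rewrite inE /= in_itv /= => /andP[sr rt].
  congr EFin; rewrite /radial_pdf patchE mem_set //= in_itv /=.
  by rewrite (le_trans s0 sr) (lt_le_trans rt tL).
rewrite integral_itv_bndo_bndc; last first.
  by apply: measurable_funTS; apply/measurable_EFinP; exact: continuous_measurable_fun.
rewrite (@continuous_FTC2 _ _ F) //.
- by rewrite /F -EFinB -mulrBl.
- by rewrite lt_neqAle st' st.
- exact: continuous_subspaceT.
- split.
  + by move=> z _; exact: ex_derive.
  + by apply: cvg_at_right_filter; exact: cF.
  + by apply: cvg_at_left_filter; exact: cF.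
- by move=> z _; rewrite derive1E; exact: derive_val.
Qed.

(** The radius 0, where the denominator of the gap vanishes, is discarded because the density is
    zero there. *)
Lemma radial_out : rad (~` `]0, L[%classic) = 0%E.
Proof.
rewrite /radial_law integral0_eq // => r /= h; congr EFin.
rewrite /radial_pdf patchE; case: ifPn => //; rewrite inE /= in_itv /= => /andP[r0 rL].
have -> : r = 0.
  apply/eqP; rewrite eq_le r0 andbT leNgt; apply/negP => r0'; apply: h.
  by rewrite in_itv /= r0' rL.
by rewrite mulr0 /sinh oppr0 subrr mul0r mulr0 mul0r.
Qed.

Lemma radial_set1 (x : R) : rad [set x] = 0%E.
Proof. exact: integral_set1. Qed.

Lemma measurable_U_xsection (A : set (R * R)) : measurable A ->
  measurable_fun setT (fun u => U (xsection A u)).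
Proof. by move=> mA; exact: (@measurable_fun_xsection _ _ _ _ R U A mA). Qed.

Lemma node_lawE_in (A : set (R * R)) : measurable A ->
  mu A = (\int[rad]_(u in `]0%R, L[) U (xsection A u))%E.
Proof.
move=> mA; rewrite /node_law /product_measure1.
rewrite -{1}(setvU `]0, L[%classic) setUC.
rewrite ge0_integral_setU //=.
- rewrite [X in (_ + X)%E]null_set_integral ?adde0 //.
  + exact: measurableC.
  + by apply: measurable_funTS; exact: measurable_U_xsection.
  + exact: radial_out.
- exact: measurableC.
- by rewrite setUCr; exact: measurable_U_xsection.
- by apply/disj_setPS => x [].
Qed.

(** Masses are compared through the angular measures of the sections at each radius; the strip [I]
    records where a gain of [c] is available. *)
Lemma node_law_strip_ge (A B : set (R * R)) (I : set R) (c : R) :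
  measurable A -> measurable B -> measurable I -> 0 <= c ->
  (forall u, 0 < u < L -> (U (xsection B u) + (c * \1_I u)%:E <= U (xsection A u))%E) ->
  (mu B + c%:E * rad I <= mu A)%E.
Proof.
move=> mA mB mI c0 h; rewrite !node_lawE_in //.
have -> : (c%:E * rad I = \int[rad]_(u in `]0%R, L[) (c * \1_I u)%:E)%E.
  under eq_integral do rewrite EFinM.
  rewrite ge0_integralZl //; last first.
    by apply/measurable_EFinP; apply: measurable_funTS; exact: measurable_indic.
  rewrite integral_indic //; congr (_ * _)%E.
  rewrite -{1}(setIT I) -(setvU `]0, L[%classic) setIUr.
  rewrite measureU; [|exact: measurableI (measurableC _)|exact: measurableI|].
    rewrite [X in (X + _)%E](_ : _ = 0%E) ?add0e //.
    apply/eqP; rewrite eq_le measure_ge0 andbT -radial_out le_measure ?inE //.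
    - exact: measurableI (measurableC _).
    - exact: measurableC.
  by apply/seteqP; split=> x //= [] [_ +] [].
rewrite -ge0_integralD //; last 3 first.
- by apply: measurable_funTS; exact: measurable_U_xsection.
- by move=> u _; rewrite lee_fin mulr_ge0.
- apply/measurable_EFinP; apply: measurable_funTS; exact: measurable_funM.
apply: ge0_le_integral => //.
- by move=> u _; rewrite adde_ge0 // lee_fin mulr_ge0.
- apply: emeasurable_funD; first by apply: measurable_funTS; exact: measurable_U_xsection.
  apply/measurable_EFinP; apply: measurable_funTS; exact: measurable_funM.
- by apply: measurable_funTS; exact: measurable_U_xsection.
Qed.

Lemma node_law_mono_in (A B : set (R * R)) : measurable A -> measurable B ->
  (forall u, 0 < u < L -> (U (xsection B u) <= U (xsection A u))%E) ->
  (mu B <= mu A)%E.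
Proof.
move=> mA mB h; have := @node_law_strip_ge A B set0 0 mA mB measurable0 (lexx _).
rewrite mul0e adde0; apply=> u hu; rewrite mul0r adde0; exact: h.
Qed.

Lemma node_law_strip_le (A : set (R * R)) (I : set R) (c : R) :
  measurable A -> measurable I -> 0 <= c ->
  (forall u, 0 < u < L -> I u -> (U (xsection A u) <= c%:E)%E) ->
  (mu (A `&` (I `*` setT)) <= c%:E * rad I)%E.
Proof.
move=> mA mI c0 h.
have mAI : measurable (A `&` (I `*` setT)).
  by apply: measurableI => //; exact: measurableX.
rewrite node_lawE_in //.
apply: (@le_trans _ _ (\int[rad]_(u in `]0%R, L[) (c%:E * (\1_I u)%:E))%E).
  apply: ge0_le_integral => //.
  - by apply: measurable_funTS; exact: measurable_U_xsection.
  - apply: measurable_funTS; apply: emeasurable_funM => //.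
    by apply/measurable_EFinP; exact: measurable_indic.
  - move=> u; rewrite /= in_itv /= => hu; rewrite indicE.
    have [Iu|Iu] := boolP (u \in I).
      rewrite mule1; apply: le_trans (h _ hu _); last by move: Iu; rewrite inE.
      rewrite le_measure ?inE //; try exact: measurable_xsection.
      by move=> x; rewrite /xsection /= !inE => -[].
    rewrite (_ : xsection _ _ = set0) ?measure0 ?mule0 //.
    apply/seteqP; split=> x //; rewrite /xsection /= inE => -[_ [/= Iu' _]].
    by move: Iu; rewrite notin_setE.
rewrite ge0_integralZl //; last first.
  by apply/measurable_EFinP; apply: measurable_funTS; exact: measurable_indic.
rewrite lee_wpmul2l ?lee_fin // integral_indic // le_measure ?inE //.
exact: measurableI.
Qed.

Definition ball (y : R * R) : set (R * R) := [set x | hdist y x <= L].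

Lemma measurable_ball y : measurable (ball y).
Proof. by apply: measurable_hdist_le => //; exact: measurable_cst. Qed.

Lemma U_ball y u : 0 < hradius y <= L -> - pi <= hangle y <= pi -> 0 < u < L ->
  U (xsection (ball y) u) = (arc_prob (angular_gap L (hradius y) u))%:E.
Proof.
move=> /andP[y0 yL] hy /andP[u0 uL].
have g0 : 0 <= angular_gap L (hradius y) u.
  by apply: angular_gap_ge0; rewrite ?y0 ?u0 ?yL ?ltW.
rewrite -(uniform_arc_prob hy g0); congr (U _).
apply/seteqP; split=> f; rewrite /xsection /= inE /ball /=.
  by rewrite hdist_leE // ltW.
by move=> h; rewrite hdist_leE // ltW.
Qed.

(** The angle 0 is arbitrary: by rotation invariance, proved in [ball_massE], the mass depends only
    on the radius of the centre. *)
Definition ball_mass (r : R) : R := fine (mu (ball (r, 0))).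

Lemma node_law_fin (A : set (R * R)) : measurable A -> mu A = (fine (mu A))%:E.
Proof.
move=> mA; rewrite fineK // ge0_fin_numE ?measure_ge0 //.
apply: (@le_lt_trans _ _ (mu setT)); last by rewrite node_law_setT // ltry.
by rewrite le_measure ?inE.
Qed.

Lemma ball_massE y : 0 < hradius y <= L -> - pi <= hangle y <= pi ->
  mu (ball y) = (ball_mass (hradius y))%:E.
Proof.
move=> hr ha; rewrite /ball_mass -node_law_fin; last exact: measurable_ball.
rewrite !node_lawE_in; try exact: measurable_ball.
apply: eq_integral => u; rewrite inE /= in_itv /= => hu.
have p0 := pi_gt0 R.
by rewrite !U_ball //=; lra.
Qed.

End node_masses.

(** * Orders of magnitude of ball masses in terms of the radius of the centre *)

Section mass_bounds.
Context {R : realType}.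
Variables (alpha L : R).
Hypotheses (a12 : 1 / 2 < alpha) (L8 : 8 <= L).
Local Notation rad := (radial_law alpha L).
Local Notation U := (uniform_prob (ltNpi R)).
Local Notation mu := (node_law alpha L).
Local Notation Z := (cosh (alpha * L) - 1).

Let a0 : 0 < alpha. Proof. by move: a12; lra. Qed.
Let L0 : 0 < L. Proof. by move: L8; lra. Qed.
Let aL : 4 <= alpha * L. Proof. by move: a12 L8; nra. Qed.

Lemma expR_ge_nat (n : nat) (x : R) : n%:R <= x -> 2 ^+ n <= expR x.
Proof.
move=> nx; apply: (@le_trans _ _ (expR n%:R)); last by rewrite ler_expR.
rewrite -[n%:R]mulr1 expRM_natl lerXn2r // ?nnegrE ?expR_ge0 //.
by have := expR_ge1Dx (1 : R); lra.
Qed.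

Lemma cosh1_ge_expR (x : R) : 2 <= x -> expR x / 4 <= cosh x - 1.
Proof.
move=> x2; have := cosh_ge_expR x; have : 2 ^+ 2 <= expR x by exact: expR_ge_nat.
lra.
Qed.

Lemma coshB_bounds (x y : R) : 0 <= x -> x <= y ->
  (y - x) * sinh x <= cosh y - cosh x /\ cosh y - cosh x <= (y - x) * sinh y.
Proof.
move=> x0 xy.
have df (z : R) : is_derive z 1 cosh (sinh z).
  rewrite /sinh /cosh; apply: is_derive_eq.
  by rewrite /GRing.scale /=; field.
have cf : continuous (@cosh R).
  by move=> z; apply: differentiable_continuous; apply/derivable1_diffP.
have [c] := @MVT_segment _ cosh sinh x y xy (fun z _ => df z) (continuous_subspaceT cf).
rewrite in_itv /= => /andP[xc cy] ->.
have sm (u v : R) : u <= v -> sinh u <= sinh v.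
  move=> uv; have : expR u <= expR v by rewrite ler_expR.
  have : expR (- v) <= expR (- u) by rewrite ler_expR lerN2.
  by rewrite /sinh; lra.
have yx : 0 <= y - x by lra.
by rewrite ![_ * (y - x)]mulrC !ler_wpM2l // sm.
Qed.

Let Z0 : 0 < Z. Proof. by apply: radial_norm_gt0. Qed.
Let Zge : expR (alpha * L) / 4 <= Z.
Proof. by apply: cosh1_ge_expR; move: aL; lra. Qed.
Let Zle : Z <= expR (alpha * L).
Proof. by have : 0 <= alpha * L; [move: aL; lra|move/cosh_le_expR; lra]. Qed.

Lemma radial_le (s t : R) : 0 <= s -> s <= t -> t <= L ->
  (rad `[s, t]%classic <= (2 * alpha * (t - s) * expR (- (alpha * (L - t))))%:E)%E.
Proof.
have ha0 := a0; have hL0 := L0; have haL := aL; have ha12 := a12; have hL8 := L8.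
have hZ0 := Z0; have hZge := Zge; have hZle := Zle.
move=> s0 st tL; have [_ ->] := radial_itv a0 L0 s0 st tL.
rewrite lee_fin ler_pdivrMr //.
have as0 : 0 <= alpha * s by nra.
have ast : alpha * s <= alpha * t by nra.
have [_ h] := coshB_bounds as0 ast; apply: le_trans h _.
apply: (@le_trans _ _ (alpha * (t - s) * (expR (alpha * t) / 2))).
  rewrite -mulrBr ler_wpM2l ?sinh_le_expR //; nra.
have -> : expR (alpha * t) = expR (- (alpha * (L - t))) * expR (alpha * L).
  by rewrite -expRD; congr expR; ring.
set E := expR (- _); have E0 : 0 <= alpha * (t - s) * E by rewrite mulr_ge0 ?expR_ge0 //; nra.
by have := ler_wpM2l E0 Zge; lra.
Qed.

Lemma radial_ge (s t : R) : 1 <= alpha * s -> 0 <= s -> s <= t -> t <= L ->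
  ((alpha / 4 * (t - s) * expR (- (alpha * (L - s))))%:E <= rad `[s, t[%classic)%E.
Proof.
have ha0 := a0; have hL0 := L0; have haL := aL; have ha12 := a12; have hL8 := L8.
have hZ0 := Z0; have hZge := Zge; have hZle := Zle.
move=> as1 s0 st tL; have [-> _] := radial_itv a0 L0 s0 st tL.
rewrite lee_fin ler_pdivlMr //.
have as0 : 0 <= alpha * s by nra.
have ast : alpha * s <= alpha * t by nra.
have [h _] := coshB_bounds as0 ast; apply: le_trans h.
apply: (@le_trans _ _ (alpha * (t - s) * (expR (alpha * s) / 4))); last first.
  by rewrite -mulrBr ler_wpM2l ?sinh_ge_expR //; nra.
have -> : expR (alpha * s) = expR (- (alpha * (L - s))) * expR (alpha * L).
  by rewrite -expRD; congr expR; ring.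
set E := expR (- _); have E0 : 0 <= alpha * (t - s) * E by rewrite mulr_ge0 ?expR_ge0 //; nra.
by have := ler_wpM2l E0 Zle; lra.
Qed.

Lemma radial0_le (t : R) : 0 <= t -> t <= L ->
  (rad `[0%R, t]%classic <= (4 * expR (- (alpha * (L - t))))%:E)%E.
Proof.
have ha0 := a0; have hL0 := L0; have haL := aL; have ha12 := a12; have hL8 := L8.
have hZ0 := Z0; have hZge := Zge; have hZle := Zle.
move=> t0 tL; have [_ ->] := radial_itv a0 L0 (lexx 0) t0 tL.
rewrite lee_fin ler_pdivrMr // mulr0 cosh0.
have at0 : 0 <= alpha * t by nra.
apply: (@le_trans _ _ (expR (alpha * t))); first by have := cosh_le_expR at0; lra.
have -> : expR (alpha * t) = expR (- (alpha * (L - t))) * expR (alpha * L).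
  by rewrite -expRD; congr expR; ring.
set E := expR (- _); have E0 : 0 <= E by exact: expR_ge0.
by have := ler_wpM2l E0 Zge; lra.
Qed.

Lemma radial0_ge (t : R) : 2 <= alpha * t -> 0 <= t -> t <= L ->
  ((expR (- (alpha * (L - t))) / 4)%:E <= rad `[0%R, t[%classic)%E.
Proof.
have ha0 := a0; have hL0 := L0; have haL := aL; have ha12 := a12; have hL8 := L8.
have hZ0 := Z0; have hZge := Zge; have hZle := Zle.
move=> at2 t0 tL; have [-> _] := radial_itv a0 L0 (lexx 0) t0 tL.
rewrite lee_fin ler_pdivlMr // mulr0 cosh0.
apply: le_trans (cosh1_ge_expR at2).
have -> : expR (alpha * t) = expR (- (alpha * (L - t))) * expR (alpha * L).
  by rewrite -expRD; congr expR; ring.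
set E := expR (- _); have E0 : 0 <= E by exact: expR_ge0.
by have := ler_wpM2l E0 Zle; lra.
Qed.

Lemma sqrt_gap_le (r u : R) : 1 <= r -> 1 <= u ->
  Num.sqrt (angular_gap L r u) <= 4 * expR ((L - r - u) / 2).
Proof.
move=> r1 u1; have e0 : 0 <= 4 * expR ((L - r - u) / 2) by rewrite mulr_ge0 ?expR_ge0.
rewrite -[leRHS]ger0_norm // -sqrtr_sqr; apply: ler_wsqrtr.
rewrite exprMn -expRM_natl.
have -> : 2%:R * ((L - r - u) / 2) = L - r - u by field.
by have := @angular_gap_le _ L r u (ltW L0) r1 u1; lra.
Qed.

(** A geometric series of ratio [exp(- (alpha - 1/2))], convergent because [alpha > 1/2], plus the
    contribution of the nodes of radius less than 2. *)
Definition ball_mass_const : R :=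
  64 / (1 - expR (- (alpha - 1 / 2))) + 4 * expR (2 * alpha).

Let rho := expR (- (alpha - 1 / 2)).
Let rho1 : rho < 1. Proof. by rewrite expR_lt1; move: a12; lra. Qed.

Lemma ball_mass_const_gt0 : 0 < ball_mass_const.
Proof.
rewrite /ball_mass_const addr_gt0 ?mulr_gt0 ?expR_gt0 ?invr_gt0 //.
by rewrite subr_gt0.
Qed.

Lemma ball_mass_fin (r : R) : (ball_mass alpha L r)%:E = mu (ball L (r, 0)).
Proof. by apply/esym/node_law_fin => //; exact: measurable_ball. Qed.

Lemma ball_mass_le1 (r : R) : ball_mass alpha L r <= 1.
Proof.
rewrite -lee_fin ball_mass_fin.
by rewrite -(node_law_setT a0 L0) le_measure ?inE //; exact: measurable_ball.
Qed.

Lemma ball_mass_ge0 (r : R) : 0 <= ball_mass alpha L r.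
Proof. by apply: fine_ge0; exact: measure_ge0. Qed.

(** In the unit strip at depth [j] from the boundary the node mass is at most [4 exp(- alpha j)] and
    the arc has probability at most [8 exp((j + 1 - r) / 2)]; the products form a geometric series
    in [j]. *)
Lemma ball_mass_le (r : R) : 0 < r -> r <= L ->
  ball_mass alpha L r <= ball_mass_const * expR (- (r / 2)).
Proof.
have ha0 := a0; have hL0 := L0; have haL := aL; have ha12 := a12; have hL8 := L8.
move=> r0 rL.
have p0 := pi_gt0 R.
have C4 : 4 <= ball_mass_const.
  have e1 : 1 <= expR (2 * alpha) by have := expR_ge1Dx (2 * alpha); lra.
  have : 0 < 64 / (1 - rho) by rewrite divr_gt0 // subr_gt0.
  by rewrite /ball_mass_const -/rho; lra.
(* For [r < 1] the claimed bound is at least 1, since the constant is at least 4. *)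
case: (leP 1 r) => r1; last first.
  apply: le_trans (ball_mass_le1 r) _.
  rewrite expRN ler_pdivlMr ?expR_gt0 // mul1r; apply: le_trans C4.
  have : expR (r / 2) <= expR 1 by rewrite ler_expR; lra.
  have := @expR_le_quadratic R (1/2) (lexx _).
  have -> : expR 1 = expR (1/2) * expR (1/2) :> R by rewrite -expRD; congr expR; field.
  have := expR_gt0 (1/2 : R); nra.
(* [N] strips reach down to the radius [L - N], which lies in [[1, 2)]: above it the estimates for
   [u >= 1] apply, below it arcs are bounded by 1. *)
pose N := Num.truncn (L - 1).
have /andP[N1 N2] : N%:R <= L - 1 < N.+1%:R by apply: truncn_itv; lra.
have N2' : L - 2 < N%:R by move: N2; rewrite -natr1; lra.
pose B := ball L (r, 0 : R).
have mB : measurable B by exact: measurable_ball.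
pose I0 : set R := `[0%R, L - N%:R]%classic.
pose I (j : nat) : set R := `]L - j%:R - 1, L - j%:R]%classic.
pose A0 := B `&` (I0 `*` setT); pose A (j : nat) := B `&` (I j `*` setT).
have mI0 : measurable I0 by exact: measurable_itv.
have mI j : measurable (I j) by exact: measurable_itv.
have mA0 : measurable A0 by apply: measurableI => //; exact: measurableX.
have mA j : measurable (A j) by apply: measurableI => //; exact: measurableX.
have mUA : measurable (\big[setU/set0]_(j < N) A j).
  by apply: bigsetU_measurable.
have h1 : (mu B <= mu (A0 `|` \big[setU/set0]_(j < N) A j))%E.
  apply: node_law_mono_in => //; first exact: measurableU.
  move=> u /andP[u0 uL]; rewrite le_measure ?inE //; try exact: measurable_xsection.
    by apply: measurable_xsection; exact: measurableU.
  move=> f; rewrite /xsection /= !inE => Bu.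
  case: (leP u (L - N%:R)) => uN.
    by left; split=> //; split=> //; rewrite /I0 /= in_itv /= (ltW u0).
  right; have /andP[j1 j2] : (Num.truncn (L - u))%:R <= L - u < (Num.truncn (L - u)).+1%:R.
    by apply: truncn_itv; lra.
  rewrite -natr1 in j2.
  have jN : (Num.truncn (L - u) < N)%N by rewrite -(ltr_nat R); lra.
  rewrite -bigcup_mkord; exists (Num.truncn (L - u)) => //.
  by split=> //; split=> //; rewrite /I /= in_itv /=; lra.
have arcle (u : R) : 0 < u < L -> U (xsection B u) = (arc_prob (angular_gap L r u))%:E.
  by move=> hu; rewrite U_ball //= ?r0 //; lra.
have g0 (u : R) : 0 < u < L -> 0 <= angular_gap L r u.
  by move=> hu; apply: angular_gap_ge0; lra.
have h2 : (mu A0 <= (4 * expR (2 * alpha) * expR (- (r / 2)))%:E)%E.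
  apply: (@le_trans _ _ (1%:E * rad I0)%E).
    apply: node_law_strip_le => // u hu _; rewrite arcle // lee_fin.
    by apply: arc_prob_le1; exact: g0.
  rewrite mul1e; apply: le_trans (radial0_le _ _) _; [lra|lra|].
  rewrite lee_fin -mulrA ler_wpM2l // -expRD ler_expR.
  have -> : L - (L - N%:R) = N%:R by ring.
  nra.
have h3 j : (j < N)%N -> (mu (A j) <= (64 * expR (- (r / 2)) * rho ^+ j)%:E)%E.
  move=> jN; have jN' : j.+1%:R <= N%:R :> R by rewrite ler_nat.
  rewrite -natr1 in jN'.
  have j0 : 0 <= j%:R :> R by exact: ler0n.
  apply: (@le_trans _ _ ((8 * expR ((j%:R + 1 - r) / 2))%:E * rad (I j))%E).
    apply: node_law_strip_le => //.
    move=> u hu; rewrite /I /= in_itv /= => /andP[uj _].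
    rewrite arcle // lee_fin; apply: le_trans (arc_prob_le (g0 _ hu)) _.
    have u1 : 1 <= u by lra.
    have := sqrt_gap_le r1 u1.
    have : expR ((L - r - u) / 2) <= expR ((j%:R + 1 - r) / 2) by rewrite ler_expR; lra.
    lra.
  apply: (@le_trans _ _ ((8 * expR ((j%:R + 1 - r) / 2))%:E * (4 * expR (- (alpha * j%:R)))%:E)%E).
    rewrite lee_wpmul2l ?lee_fin ?mulr_ge0 ?expR_ge0 //.
    have hj0 : 0 <= L - j%:R by lra.
    have hjL : L - j%:R <= L by lra.
    have := radial0_le hj0 hjL; have -> : L - (L - j%:R) = j%:R by ring.
    apply: le_trans; rewrite le_measure ?inE //.
      exact: mI.
    by move=> u; rewrite /I /= !in_itv /=; lra.
  rewrite -EFinM lee_fin.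
  have -> : rho ^+ j = expR (j%:R * (- (alpha - 1 / 2))) by rewrite expRM_natl.
  have -> : 8 * expR ((j%:R + 1 - r) / 2) * (4 * expR (- (alpha * j%:R))) =
    32 * expR (1 / 2) * (expR (- (r / 2)) * expR (j%:R * - (alpha - 1 / 2))).
    transitivity (32 * (expR ((j%:R + 1 - r) / 2) * expR (- (alpha * j%:R)))); first by ring.
    by rewrite -!mulrA -!expRD; congr (_ * expR _); field.
  rewrite [leRHS](_ : _ = 64 * (expR (- (r / 2)) * expR (j%:R * - (alpha - 1 / 2)))); last by ring.
  rewrite ler_wpM2r ?mulr_ge0 ?expR_ge0 //.
  by have := @expR_le_quadratic R (1/2) (lexx _); lra.
rewrite -lee_fin ball_mass_fin.
have h4 : (mu (A0 `|` \big[setU/set0]_(j < N) A j) <=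
    mu A0 + mu (\big[setU/set0]_(j < N) A j))%E by exact: measureU2.
have h5 : (mu (\big[setU/set0]_(j < N) A j) <= \sum_(j < N) mu (A j))%E.
  by apply: Boole_inequality => i _; exact: mA.
apply: le_trans h1 _; apply: le_trans h4 _.
rewrite /ball_mass_const mulrDl EFinD addeC; apply: leeD => //.
apply: le_trans h5 _.
apply: (@le_trans _ _ (\sum_(j < N) (64 * expR (- (r / 2)) * rho ^+ j)%:E)%E).
  by apply: lee_sum => j _; exact: h3.
rewrite sumEFin lee_fin -mulr_sumr.
rewrite [leRHS](_ : _ = 64 * expR (- (r / 2)) * (1 - rho)^-1); last by rewrite -/rho; ring.
rewrite ler_wpM2l ?mulr_ge0 ?expR_ge0 //.
have rho0 : 0 < 1 - rho by rewrite subr_gt0.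
rewrite -div1r ler_pdivlMr // mulrC.
have : rho ^+ N - 1 = (rho - 1) * \sum_(j < N) rho ^+ j by exact: subrX1.
by have : 0 <= rho ^+ N by [rewrite exprn_ge0 // expR_ge0]; lra.
Qed.

(** Lower bound for the mass of the outer strip [[L - 1, L)], a fixed proportion of the nodes. Lower
    bounds on ball masses are read off this strip. *)
Definition strip_mass : R := alpha * expR (- alpha) / 4.

Lemma strip_mass_gt0 : 0 < strip_mass.
Proof. by have ha0 := a0; rewrite /strip_mass divr_gt0 // mulr_gt0 // expR_gt0. Qed.

Let strip : set R := `[L - 1, L[%classic.

Let rad_strip : (strip_mass%:E <= rad strip)%E.
Proof.
have ha0 := a0; have hL0 := L0; have haL := aL; have ha12 := a12; have hL8 := L8.
have := @radial_ge (L - 1) L; rewrite (_ : L - (L - 1) = 1) ?mulr1; last by ring.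
rewrite /strip_mass mulrAC; apply; [nra|lra|lra|lra].
Qed.

Let mstrip : measurable strip. Proof. exact: measurable_itv. Qed.

Let gap_strip (r u : R) : 4 <= r -> L - 1 <= u ->
  angular_gap L r u <= 2 /\ Num.sqrt (angular_gap L r u) <= 8 * expR (- (r / 2)).
Proof.
move=> r4 hu; have hL8 := L8; have hL0 := L0.
have r1 : 1 <= r by lra. have u1 : 1 <= u by lra.
split.
  apply: le_trans (angular_gap_le (ltW L0) r1 u1) _.
  have : expR (L - r - u) <= expR (- 3) by rewrite ler_expR; lra.
  have : expR (- 3) <= 1 / 8 :> R.
    rewrite expRN -div1r ler_pdivrMr ?expR_gt0 //.
    have : 2 ^+ 3 <= expR (3 : R) by exact: expR_ge_nat.
    lra.
  lra.
apply: le_trans (sqrt_gap_le r1 u1) _.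
apply: (@le_trans _ _ (4 * (expR (1 / 2) * expR (- (r / 2))))).
  by rewrite ler_wpM2l // -expRD ler_expR; lra.
have := @expR_le_quadratic R (1/2) (lexx _); have := expR_gt0 (- (r / 2)); nra.
Qed.

(** In the outer strip the gaps differ by at least [(s - r) / 2 exp(- (r + s) / 2)] and
    [12 sqrt gap <= 96 exp(- r / 2)]; the quotient is [c], whence 192. At the other radii
    monotonicity is enough. *)
Lemma ball_massB_ge (r s : R) : 4 <= r -> r <= s -> s <= L ->
  ball_mass alpha L s + strip_mass / 192 * (s - r) * expR (- (s / 2))
  <= ball_mass alpha L r.
Proof.
move=> r4 rs sL; have ha0 := a0; have hL0 := L0; have hL8 := L8.
have p0 := pi_gt0 R; have sm0 := strip_mass_gt0.
pose c := (s - r) * expR (- (s / 2)) / 192.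
have sr0 : 0 <= s - r by lra.
have c0 : 0 <= c by exact: divr_ge0 (mulr_ge0 sr0 (expR_ge0 _)) (ler0n _ 192).
suff : (mu (ball L (s, 0%R)) + (strip_mass / 192 * (s - r) * expR (- (s / 2)))%:E
    <= mu (ball L (r, 0%R)))%E by rewrite -!ball_mass_fin -EFinD lee_fin.
apply: (@le_trans _ _ (mu (ball L (s, 0%R)) + c%:E * rad strip)%E).
  rewrite leeD2l //.
  have -> : strip_mass / 192 * (s - r) * expR (- (s / 2)) = c * strip_mass by rewrite /c; field.
  by rewrite EFinM lee_wpmul2l // lee_fin.
apply: node_law_strip_ge => //; try exact: measurable_ball.
move=> u hu; rewrite !U_ball //=; [|lra|lra|lra|lra].
rewrite -EFinD lee_fin indicE.
have r0 : 0 < r by lra. have u0 : 0 < u by lra. have uL : u <= L by lra.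
have h := angular_gapB r0 rs u0 uL.
have D0 : 0 <= (s - r) / 2 * expR (- (r + s) / 2).
  by rewrite mulr_ge0 ?expR_ge0 //; lra.
have g1 : 0 <= angular_gap L s u by apply: angular_gap_ge0; lra.
case: (boolP (u \in strip)) => [|_]; last first.
  by rewrite mulr0 addr0; apply: arc_prob_homo => //; lra.
rewrite inE /strip /= in_itv /= mulr1 => /andP[us _].
have [g2 sg] := gap_strip r4 us.
have [e|gne] := eqVneq (angular_gap L r u) 0.
  have sr : s = r.
    apply/eqP; rewrite eq_le rs andbT leNgt; apply/negP => sr.
    have : 0 < (s - r) / 2 * expR (- (r + s) / 2) by rewrite mulr_gt0 ?expR_gt0 //; lra.
    lra.
  by rewrite /c sr subrr !mul0r addr0.
have g20 : 0 < angular_gap L r u by rewrite lt_neqAle eq_sym gne; lra.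
have g12 : angular_gap L s u <= angular_gap L r u by lra.
have hB := arc_probB g1 g12 g2 g20.
suff : c <= (angular_gap L r u - angular_gap L s u) / (12 * Num.sqrt (angular_gap L r u)).
  by lra.
have sq0 : 0 < Num.sqrt (angular_gap L r u) by rewrite sqrtr_gt0.
rewrite ler_pdivlMr ?mulr_gt0 //; apply: le_trans h.
apply: (@le_trans _ _ (c * (12 * (8 * expR (- (r / 2)))))).
  by rewrite ler_wpM2l // ler_wpM2l.
have -> : expR (- (r + s) / 2) = expR (- (r / 2)) * expR (- (s / 2)).
  by rewrite -expRD; congr expR; field.
by rewrite /c le_eqVlt; apply/orP; left; apply/eqP; field.
Qed.

Lemma ball_mass_homo (r s : R) : 4 <= r -> r <= s -> s <= L ->
  ball_mass alpha L s <= ball_mass alpha L r.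
Proof.
move=> r4 rs sL; apply: le_trans (ball_massB_ge r4 rs sL).
have sr0 : 0 <= s - r by lra.
have sm := ltW strip_mass_gt0; rewrite lerDl; apply: mulr_ge0; last exact: expR_ge0.
by exact: mulr_ge0 (divr_ge0 sm (ler0n _ 192)) sr0.
Qed.

Lemma ball_mass_ge (r : R) : 4 <= r -> r + 1 <= L ->
  strip_mass / 384 * expR (- (r / 2)) <= ball_mass alpha L r.
Proof.
move=> r4 rL; have r1 : r <= r + 1 by lra.
apply: le_trans (ball_massB_ge r4 r1 rL).
have := ball_mass_ge0 (r + 1).
rewrite (_ : r + 1 - r = 1); last by ring.
have h2 : expR (- (r / 2)) <= 2 * expR (- ((r + 1) / 2)).
  have -> : - (r / 2) = 1 / 2 + - ((r + 1) / 2) by field.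
  rewrite expRD ler_wpM2r ?expR_ge0 //.
  by have := @expR_le_quadratic R (1/2) (lexx _); lra.
have := strip_mass_gt0; have := expR_gt0 (- (r / 2)).
nra.
Qed.

(** Balls of equal angle are nested, up to the null set of radii outside []0, L[]. *)
Lemma ball_diff_mass (r s a : R) : 4 <= r -> r <= s -> s <= L -> - pi <= a <= pi ->
  mu (ball L (r, a) `\` ball L (s, a)) =
  (ball_mass alpha L r - ball_mass alpha L s)%:E.
Proof.
move=> r4 rs sL ha; have ha0 := a0; have hL0 := L0; have hL8 := L8.
have mr := @measurable_ball R L (r, a); have ms := @measurable_ball R L (s, a).
have sub : mu (ball L (r, a) `&` ball L (s, a)) = mu (ball L (s, a)).
  apply/eqP; rewrite eq_le; apply/andP; split.
    by rewrite le_measure ?inE //; first [exact: measurableI|exact: subIsetr].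
  apply: node_law_mono_in => //; first exact: measurableI.
  move=> u hu; rewrite le_measure ?inE //; try exact: measurable_xsection.
    by apply: measurable_xsection; exact: measurableI.
  move=> f; rewrite /xsection /= !inE /ball /= => h; split=> //; move: h.
  rewrite !hdist_leE //=; try lra.
  have r0 : 0 < r by lra. have u0 : 0 < u by lra. have uL : u <= L by lra.
  have := angular_gapB r0 rs u0 uL.
  have : 0 <= (s - r) / 2 * expR (- (r + s) / 2).
    by rewrite mulr_ge0 ?expR_ge0 //; lra.
  lra.
have hr0 : 0 < r <= L by lra.
have hs0 : 0 < s <= L by lra.
have hr : mu (ball L (r, a)) = (ball_mass alpha L r)%:E.
  exact: (@ball_massE _ _ _ a0 L0 (r, a) hr0 ha).
have hs : mu (ball L (s, a)) = (ball_mass alpha L s)%:E.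
  exact: (@ball_massE _ _ _ a0 L0 (s, a) hs0 ha).
have mD : measurable (ball L (r, a) `\` ball L (s, a)) by exact: measurableD.
have [q hq] : exists q, mu (ball L (r, a) `\` ball L (s, a)) = q%:E.
  by exists (fine (mu (ball L (r, a) `\` ball L (s, a)))); exact: (node_law_fin a0 L0 mD).
rewrite hq; congr EFin.
have hD : mu (ball L (r, a)) = (mu (ball L (r, a) `\` ball L (s, a)) +
    mu (ball L (r, a) `&` ball L (s, a)))%E by exact: measureDI.
have [e] : (ball_mass alpha L r)%:E = (q%:E + (ball_mass alpha L s)%:E)%E.
  exact: etrans (esym hr) (etrans hD (congr2 adde hq (etrans sub hs))).
by rewrite e addrK.
Qed.

(** In the outer strip each ball cuts an arc where [1 - cos] is at most [16 exp(1 - r)]. Beyond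
    twice the sum of these two bounds the arcs are disjoint by [one_minus_cosD_le], so the whole arc
    of the second ball counts. *)
Lemma ball_separated_mass (y1 y2 : R * R) :
  4 <= hradius y1 -> hradius y1 <= L -> 4 <= hradius y2 -> hradius y2 + 1 <= L ->
  - pi <= hangle y2 <= pi ->
  32 * (expR (1 - hradius y1) + expR (1 - hradius y2))
    < 1 - cos (hangle y1 - hangle y2) ->
  ((strip_mass / 24 * expR (- (hradius y2 / 2)))%:E
    <= mu (ball L y2 `\` ball L y1))%E.
Proof.
case: y1 => r1 a1; case: y2 => r2 a2 /= r14 r1L r24 r2L ha2 sep.
have ha0 := a0; have hL0 := L0; have hL8 := L8; have sm0 := strip_mass_gt0.
pose c := expR (- (r2 / 2)) / 24.
have c0 : 0 <= c by exact: divr_ge0 (expR_ge0 _) (ler0n _ 24).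
apply: (@le_trans _ _ (mu set0 + c%:E * rad strip)%E).
  rewrite measure0 add0e.
  have -> : strip_mass / 24 * expR (- (r2 / 2)) = c * strip_mass by rewrite /c; field.
  by rewrite EFinM lee_wpmul2l // lee_fin.
have mD : measurable (ball L (r2, a2) `\` ball L (r1, a1)).
  by apply: measurableD; exact: measurable_ball.
apply: node_law_strip_ge => //.
move=> u hu; rewrite xsection0 measure0 add0e indicE.
case: (boolP (u \in strip)) => [|_]; last by rewrite mulr0 measure_ge0.
rewrite inE /strip /= in_itv /= mulr1 => /andP[us _].
have u1 : 1 <= u by lra.
have b1 : angular_gap L r1 u <= 16 * expR (1 - r1).
  apply: le_trans (angular_gap_le (ltW hL0) _ u1) _; first lra.
  by rewrite ler_wpM2l // ler_expR; lra.
have b2 : angular_gap L r2 u <= 16 * expR (1 - r2).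
  apply: le_trans (angular_gap_le (ltW hL0) _ u1) _; first lra.
  by rewrite ler_wpM2l // ler_expR; lra.
rewrite (_ : xsection _ u = xsection (ball L (r2, a2)) u); last first.
  apply/seteqP; split=> f; rewrite /xsection /= !inE /ball /=; first by case.
  move=> h; split=> // h'; move: h h'; rewrite !hdist_leE //=; try lra.
  move=> h h'.
  have := one_minus_cosD_le (a1 - f) (f - a2).
  have -> : a1 - f + (f - a2) = a1 - a2 by ring.
  have -> : cos (f - a2) = cos (a2 - f) by rewrite -cosN opprB.
  lra.
rewrite U_ball //=; [|lra].
rewrite lee_fin.
have [g2 _] := gap_strip r24 us.
have r20 : 0 < r2 by lra. have r2s : r2 <= r2 + 1 by lra.
have u0 : 0 < u by lra. have uL : u <= L by lra.
have h := angular_gapB r20 r2s u0 uL.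
have gs : 0 <= angular_gap L (r2 + 1) u by apply: angular_gap_ge0; lra.
(* Lower bound by comparison with the radius [r2 + 1], whose gap is nonnegative. Afterwards
   [g / (12 sqrt g) = sqrt g / 12] and [sqrt g >= exp(- r2 / 2) / 2] give the constant 24. *)
have glow : expR (- r2) / 4 <= angular_gap L r2 u.
  apply: (@le_trans _ _ ((r2 + 1 - r2) / 2 * expR (- (r2 + (r2 + 1)) / 2))); last lra.
  have -> : - (r2 + (r2 + 1)) / 2 = - r2 - 1 / 2 by field.
  rewrite (_ : r2 + 1 - r2 = 1); last by ring.
  rewrite expRD; have : 1 / 2 <= expR (- (1 / 2)) :> R.
    by have := expR_ge1Dx (- (1 / 2) : R); lra.
  have := expR_gt0 (- r2); nra.
have e0 := expR_gt0 (- r2).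
have g20 : 0 < angular_gap L r2 u by lra.
have := arc_probB (lexx 0) (ltW g20) g2 g20.
have -> : arc_prob (0 : R) = 0 by rewrite /arc_prob ler0n subr0 acos1 mul0r.
rewrite !subr0; apply: le_trans.
set s := Num.sqrt (angular_gap L r2 u).
have s0 : 0 < s by rewrite sqrtr_gt0.
have s2 : s ^+ 2 = angular_gap L r2 u by rewrite sqr_sqrtr // ltW.
rewrite -s2 (_ : s ^+ 2 / (12 * s) = s / 12); last by field; rewrite gt_eqF.
have : expR (- (r2 / 2)) / 2 <= s.
  rewrite -[leLHS]ger0_norm ?divr_ge0 ?expR_ge0 // -sqrtr_sqr; apply: ler_wsqrtr.
  rewrite expr_div_n -expRM_natl (_ : 2%:R * - (r2 / 2) = - r2); last by field.
  by lra.
by rewrite /c; lra.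
Qed.

Lemma angle_close_mass (y : R * R) (I : set R) (g : R) : measurable I ->
  - pi <= hangle y <= pi -> 0 <= g ->
  (mu [set x : R * R | I (hradius x) /\ (1 - cos (hangle y - hangle x) <= g)%R]
    <= (2 * Num.sqrt g)%:E * rad I)%E.
Proof.
move=> mI hy g0.
pose S : set R := [set f : R | 1 - cos (hangle y - f) <= g].
have mS : measurable S.
  rewrite (_ : S = [set f : R | 1 - g <= cos (hangle y - f)]).
    exact: measurable_cos_ge.
  by apply/seteqP; split=> f; rewrite /S /=; lra.
have e2 : [set x : R * R | I (hradius x) /\ 1 - cos (hangle y - hangle x) <= g]
    = I `*` S by apply/seteqP; split=> -[].
have e3 : U S = (arc_prob g)%:E by exact: uniform_arc_prob.
have e4 : mu (I `*` S) = (rad I * U S)%E by exact: node_lawE.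
rewrite e2 e4 muleC; apply: lee_wpmul2r; first exact: measure_ge0.
by rewrite e3 lee_fin; exact: arc_prob_le.
Qed.

End mass_bounds.

(** * Exchanging angles *)

Section iid.
Context d d' (T : measurableType d) (V : measurableType d') (R : realType).
Variables (P : probability T R) (mu : probability V R) (n : nat).
Variable X : 'I_n -> {RV P >-> V}.
Hypothesis iX : mutually_independent X.
Hypothesis lX : forall i A, measurable A -> distribution P (X i) A = mu A.
Local Open Scope ereal_scope.

(** With a trivial hub, estimates conditional on the hub become unconditional. *)
Lemma indep_rest_cst (J : {set 'I_n}) :
  indep_rest mu X (cst tt : {RV P >-> unit}) J.
Proof.
move=> A B mA mB.
have e : P [set w | forall k, k \in J -> B k (X k w)] = \prod_(k in J) mu (B k).
  rewrite iX //; apply: eq_bigr => k _; exact: lX.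
have [At|At] := pselect (A tt).
  rewrite (_ : _ @^-1` A = setT); last by apply/seteqP; split.
  by rewrite setTI e probability_setT mul1e.
rewrite (_ : _ @^-1` A = set0); last by apply/seteqP; split.
by rewrite set0I measure0 mul0e.
Qed.

Lemma indep_rest_node (i : 'I_n) (J : {set 'I_n}) : i \notin J ->
  indep_rest mu X (X i) J.
Proof.
move=> iJ A B mA mB.
pose C k := if k == i then A else B k.
have mC k : measurable (C k) by rewrite /C; case: ifP.
have := iX (i |: J)%SET mC; rewrite big_setU1 //= {2}/C eqxx.
rewrite (eq_bigr (fun k => mu (B k))); last first.
  move=> k kJ; rewrite /C ifN; first exact: lX.
  by apply: contraNneq iJ => <-.
move=> <-; congr (P _); apply/seteqP; split=> w /=.
  move=> [Aw h] k; rewrite in_setU1 /C.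
  by case: eqP => [->//|_ /= kJ]; exact: h.
move=> h; split; first by have := h i; rewrite setU11 /C eqxx; exact.
move=> k kJ; have := h k; rewrite in_setU1 kJ orbT /C.
by case: eqP => [ki|_]; [move: iJ; rewrite -ki kJ|exact].
Qed.

Lemma indep_rest_nodes (i j : 'I_n) (J : {set 'I_n}) : i != j ->
  i \notin J -> j \notin J -> indep_rest mu X (pairRV (X i) (X j)) J.
Proof.
move=> ij iJ jJ; apply: indep_restS => //; apply: indep_rest_node.
by rewrite in_setU1 negb_or ij.
Qed.

End iid.

Section angle_permutation.
Context d (T : measurableType d) (R : realType) (P : probability T R) (n : nat).
Variables (alpha L : R).
Variable X : 'I_n -> {RV P >-> (R * R)%type}.
Hypothesis iX : iid_with_law (node_law alpha L : set (R * R) -> \bar R) X.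

Definition permute_angles (s : 'S_n) (x : 'I_n -> R * R) : 'I_n -> R * R :=
  fun i => (hradius (x i), hangle (x (s i))).

Definition node_tuple (s : 'S_n) (w : T) : n.-tuple (R * R) :=
  [tuple permute_angles s (fun i => X i w) i | i < n].

Lemma measurable_node_tuple s : measurable_fun setT (node_tuple s).
Proof.
apply/measurable_fun_tnthP => i.
rewrite (_ : _ \o _ = (fun w => ((X i w).1, (X (s i) w).2))); last first.
  by apply/funext => w; rewrite /= tnth_mktuple.
apply: measurable_fun_pair.
  exact: (measurableT_comp measurable_fst).
exact: (measurableT_comp measurable_snd).
Qed.

Definition rectangle (A B : 'I_n -> set R) : set (n.-tuple (R * R)) :=
  [set t | forall i, A i (tnth t i).1 /\ B i (tnth t i).2].

Definition rectangles : set (set (n.-tuple (R * R))) :=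
  [set S | exists A B, [/\ forall i, measurable (A i), forall i, measurable (B i)
    & S = rectangle A B]].

(** Radius and angle of a node are independent, so the probability splits into a product over radii
    and a product over angles; the latter is merely reindexed by [s]. *)
Lemma node_tuple_rectangle s A B : (forall i, measurable (A i)) ->
  (forall i, measurable (B i)) ->
  (P (node_tuple s @^-1` rectangle A B) =
   (\prod_i radial_law alpha L (A i)) * (\prod_i uniform_prob (ltNpi R) (B i)))%E.
Proof.
move=> mA mB; have [ind law] := iX.
pose C i := A i `*` B ((s^-1)%g i).
have mC i : measurable (C i) by exact: measurableX.
have e : node_tuple s @^-1` rectangle A B =
    [set w | forall i, i \in [set: 'I_n]%SET -> C i (X i w)].
  apply/seteqP; split=> w /= h i.
    move=> _; split=> /=.
      by have [+ _] := h i; rewrite /node_tuple tnth_mktuple.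
    by have [_] := h ((s^-1)%g i); rewrite /node_tuple tnth_mktuple /= permKV.
  rewrite /node_tuple tnth_mktuple /=; split; first by have [+ _] := h i (finset.in_setT _).
  by have [_ /=] := h (s i) (finset.in_setT _); rewrite permK.
rewrite e ind //.
under eq_bigr => i _.
  have -> : P (X i @^-1` C i) = (radial_law alpha L (A i) *
      uniform_prob (ltNpi R) (B ((s^-1)%g i)))%E.
    by rewrite -node_lawE //; exact: law.
  over.
rewrite big_split /=; congr (_ * _)%E; first by apply: eq_bigl => i; rewrite inE.
rewrite (reindex_inj (@perm_inj _ s)) /=.
by apply: eq_big => i; [rewrite inE|rewrite permK].
Qed.

Lemma measurable_rectanglesE :
  @measurable _ (n.-tuple (R * R)%type) = <<s rectangles >>.
Proof.
apply/seteqP; split.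
  have mcoor (i : 'I_n) : measurable_fun setT
      (fun t : g_sigma_algebraType rectangles => tnth t i : R * R).
    have mc1 : measurable_fun setT
        (fun t : g_sigma_algebraType rectangles => (tnth t i : R * R).1).
      move=> _ A mA; rewrite setTI; apply: sub_sigma_algebra.
      exists (fun k => if k == i then A else setT), (fun=> setT); split=> //.
        by move=> k; case: ifP.
      apply/seteqP; split=> t /=.
        by move=> At k; split=> //; case: eqP => [->|].
      by move=> h; have [+ _] := h i; rewrite eqxx.
    have mc2 : measurable_fun setT
        (fun t : g_sigma_algebraType rectangles => (tnth t i : R * R).2).
      move=> _ A mA; rewrite setTI; apply: sub_sigma_algebra.
      exists (fun=> setT), (fun k => if k == i then A else setT); split=> //.
        by move=> k; case: ifP.
      apply/seteqP; split=> t /=.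
        by move=> At k; split=> //; case: eqP => [->|].
      by move=> h; have [_ +] := h i; rewrite eqxx.
    rewrite (_ : (fun t => _) = (fun t : g_sigma_algebraType rectangles =>
      ((tnth t i : R * R).1, (tnth t i : R * R).2))); last first.
      by apply/funext => t; case: (tnth t i).
    exact: measurable_fun_pair.
  apply: smallest_sub; first exact: smallest_sigma_algebra.
  elim/big_ind: _ => [Z []|U1 U2 h1 h2 Z [/h1|/h2]//|i _ Z [A mA <-]].
  exact: mcoor.
apply: smallest_sub; first exact: sigma_algebra_measurable.
move=> _ [A [B [mA mB ->]]].
rewrite (_ : rectangle A B = \bigcap_(i in [set: 'I_n])
    ((fun t : n.-tuple (R * R) => tnth t i) @^-1` (A i `*` B i))); last first.
  by apply/seteqP; split=> t /= h i => [_|]; [exact: h|exact: (h i)].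
apply: fin_bigcap_measurable => // i _.
rewrite -[X in measurable X]setTI.
by apply: (measurable_tnth i) => //; exact: measurableX.
Qed.

(** Rectangles are stable under intersection and generate the sigma-algebra, and their probability
    does not involve [s]. *)
Lemma node_tuple_perm s S : measurable S ->
  P (node_tuple s @^-1` S) = P (node_tuple 1%g @^-1` S).
Proof.
move=> mS.
pose m1 : {measure set _ -> \bar R} :=
  measure_function_pushforward__canonical__measure_function_Measure P (measurable_node_tuple s).
pose m2 : {measure set _ -> \bar R} :=
  measure_function_pushforward__canonical__measure_function_Measure P (measurable_node_tuple 1%g).
change (m1 S = m2 S).
apply: (measure_unique rectangles (fun=> setT)) => //.
- exact: measurable_rectanglesE.
- move=> _ _ [A1 [B1 [mA1 mB1 ->]]] [A2 [B2 [mA2 mB2 ->]]].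
  exists (fun i => A1 i `&` A2 i), (fun i => B1 i `&` B2 i).
  split; [by move=> i; exact: measurableI..|].
  apply/seteqP; split=> t /=.
    by move=> [h1 h2] i; have [? ?] := h1 i; have [? ?] := h2 i; split.
  by move=> h; split=> i; have [[? ?] [? ?]] := h i.
- by move=> _; exists (fun=> setT), (fun=> setT); split=> //; apply/seteqP; split.
- by apply/seteqP; split=> // x _; exists 0%N.
- by move=> _ [A [B [mA mB ->]]]; rewrite /m1 /m2 /= /pushforward !node_tuple_rectangle.
- move=> _; rewrite /m1 /= /pushforward preimage_setT probability_setT ltry //.
Qed.

End angle_permutation.

(** A set [s] of the family is determined by its part outside [g]. *)
Lemma card_sets_fixed_on (F : finType) (A : {set {set F}}) (g : {set F}) (b : pred F) :
  (forall s, s \in A -> forall c, c \in g -> (c \in s) = b c) ->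
  (#|A| <= 2 ^ (#|F| - #|g|))%N.
Proof.
move=> h; have inj : {in A &, injective (fun s : {set F} => s :\: g)%SET}.
  move=> s1 s2 s1A s2A /setP e; apply/setP => c; have := e c; rewrite !inE.
  by case: (boolP (c \in g)) => //= cg _; rewrite (h s1 s1A c cg) (h s2 s2A c cg).
rewrite -(card_in_imset inj) -(cardsC g) addKn -card_powerset.
apply: subset_leq_card; apply/fintype.subsetP => _ /imsetP[s _ ->].
by rewrite powersetE finset.setDE finset.subsetIr.
Qed.

(** * Exchanging the angles of the two nodes of chosen cells *)

Section cell_swaps.
Context (n : nat) (F : finType) (G : {set F}).
Implicit Types (e : {ffun 'I_n -> F}) (s : {set F}) (i j k : 'I_n).

Definition swappable e s i j : bool :=
  [&& j != i, e j == e i, e i \in (G :&: s)%SET & cell_two [set: 'I_n]%SET (e i) e].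

Definition swap_fun e s i : 'I_n := odflt i [pick j | swappable e s i j].

Lemma cell_twoP e c i j k : cell_two [set: 'I_n]%SET c e -> i != j ->
  e i = c -> e j = c -> e k = c -> k = i \/ k = j.
Proof.
move=> /eqP two ij ei ej ek.
have ki : k \in [set i; j]%SET; last by move: ki; rewrite !inE => /orP[]/eqP; tauto.
rewrite (_ : [set i; j]%SET = [set k in [set: 'I_n]%SET | pred1 c (e k)]%SET).
  by rewrite !inE /= ek eqxx.
apply/eqP; rewrite eqEcard; apply/andP; split.
  by apply/fintype.subsetP => l; rewrite !inE => /orP[]/eqP ->; rewrite /= ?ei ?ej eqxx.
by rewrite cards2 ij [X in (X <= _)%N](_ : _ = 2%N).
Qed.

Lemma swap_funK e s : involutive (swap_fun e s).
Proof.
move=> i; rewrite {2}/swap_fun; case: pickP => [j|h] /=; last first.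
  by rewrite /swap_fun; case: pickP => //= j; rewrite h.
move=> /and4P[ji /eqP eji iGs two]; rewrite /swap_fun; case: pickP => [k|h] /=.
  move=> /and4P[kj /eqP ekj _ _].
  have := @cell_twoP e (e i) i j k two; rewrite eq_sym ji => /(_ isT erefl eji).
  by rewrite ekj eji => /(_ erefl) [//|kE]; move: kj; rewrite kE eqxx.
by have := h i; rewrite /swappable [i == j]eq_sym ji eji eqxx iGs two.
Qed.

(** The assignment [e] is a separate parameter: cells are read from the radii, so an exchange of
    angles leaves them unchanged and all states [s] act on the same cells. *)
Definition swap_perm e s : 'S_n := perm (can_inj (swap_funK e s)).

Lemma swap_perm_out e s i : e i \notin G -> swap_perm e s i = i.
Proof.
move=> eG; rewrite permE /swap_fun; case: pickP => //= j /and4P[_ _].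
by rewrite inE (negbTE eG).
Qed.

Lemma swap_perm_off e s i : e i \notin s -> swap_perm e s i = i.
Proof.
move=> es; rewrite permE /swap_fun; case: pickP => //= j /and4P[_ _].
by rewrite inE (negbTE es) andbF.
Qed.

Lemma swap_perm_on e s i j : i != j -> e j = e i -> e i \in G -> e i \in s ->
  cell_two [set: 'I_n]%SET (e i) e -> swap_perm e s i = j.
Proof.
move=> ij eji eG es two; rewrite permE /swap_fun; case: pickP => [k|h] /=.
  move=> /and4P[ki /eqP eki _ _].
  by have [ke|//] := cell_twoP two ij erefl eji eki; rewrite ke eqxx in ki.
by have := h j; rewrite /swappable eq_sym ij eji eqxx two inE eG es.
Qed.

Context {R : realType} (L : R).
Implicit Types x : 'I_n -> R * R.

(* [rhg_deg nu x] is [degree x] for [L = rhg_radius nu n]. *)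
Definition degree x i : nat := #|[pred k | (i != k) && (hdist (x i) (x k) <= L)]|.

(** Counted in the unpermuted configuration, for an arbitrary position [z], so that both states of a
    pair are compared on the same set of other nodes. *)
Definition nbr_count x i j (z : R * R) : nat :=
  #|[set k | [&& k != i, k != j & hdist z (x k) <= L]]%SET|.

Definition in_cells e : {set 'I_n} := [set k | e k \in G]%SET.

(** Nodes outside the window do not move, and those of the window change each of the two degrees by
    at most their number, whatever the states of the other cells. *)
Lemma degree_swap_noinv e s x i j : e i \in G -> e j \in G ->
  let y := permute_angles (swap_perm e s) x in
  (degree y j <= degree y i)%N ->
  (nbr_count x i j (y j) <= nbr_count x i j (y i) + 2 * #|in_cells e|)%N.
Proof.
move=> iG jG y.
have yE k : e k \notin G -> y k = x k.
  by move=> kG; rewrite /y /permute_angles swap_perm_out //; case: (x k).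
have degE k : degree y k = #|[set l | (k != l) && (hdist (y k) (y l) <= L)]%SET|.
  by rewrite cardsE.
have low : (nbr_count x i j (y j) <= degree y j + #|in_cells e|)%N.
  apply: (@leq_trans #|([set k | (j != k) && (hdist (y j) (y k) <= L)] :|: in_cells e)%SET|).
    apply: subset_leq_card; apply/fintype.subsetP => k; rewrite !inE.
    move=> /and3P[_ kj hk]; case: (boolP (e k \in G)) => [|kG]; rewrite ?orbT ?orbF //.
    by rewrite eq_sym kj (yE k kG) hk.
  by apply: leq_trans (leq_card_setU _ _).1 _; rewrite leq_add2r /degree ?cardsE /nbr_count.
have upp : (degree y i <= nbr_count x i j (y i) + #|in_cells e|)%N.
  rewrite degE; apply: (@leq_trans #|([set k | [&& k != i, k != j & hdist (y i) (x k) <= L]] :|: in_cells e)%SET|).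
    apply: subset_leq_card; apply/fintype.subsetP => k; rewrite !inE.
    move=> /andP[ik hk]; case: (boolP (e k \in G)) => [|kG]; rewrite ?orbT ?orbF //.
    rewrite eq_sym ik -(yE k kG) hk andbT /=.
    by apply: contraNneq kG => ->.
  exact: (leq_card_setU _ _).1.
by move=> h; lia.
Qed.

Definition excess x i j (z1 z2 : R * R) : nat :=
  #|[set k | [&& k != i, k != j, hdist z1 (x k) <= L & ~~ (hdist z2 (x k) <= L)]]%SET|.

(** Both sides count the union of the two neighbourhoods. *)
Lemma nbr_count_excess x i j z1 z2 :
  (nbr_count x i j z1 + excess x i j z2 z1 = nbr_count x i j z2 + excess x i j z1 z2)%N.
Proof.
pose A u1 u2 := [set k | [&& k != i, k != j, hdist u1 (x k) <= L & hdist u2 (x k) <= L]]%SET.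
have h u1 u2 : nbr_count x i j u1 = (#|A u1 u2| + excess x i j u1 u2)%N.
  rewrite /nbr_count -(cardsID [set k | hdist u2 (x k) <= L]%SET).
  by congr (_ + _)%N; apply: eq_card => k; rewrite !inE; do !case: (_ <= _); do !case: (_ == _).
have AC : A z1 z2 = A z2 z1.
  by apply/setP => k; rewrite !inE; do !case: (_ <= _); do !case: (_ == _).
by rewrite (h z1 z2) (h z2 z1) AC; lia.
Qed.

Definition pt x i j : R * R := (hradius (x i), hangle (x j)).

(* The pair [i, j] can be ordered by degree in only one of its two states:
   exchanging the two angles changes the degree difference by much more than
   all the other nodes of the window and the difference of radii can. *)
Definition rigid_pair x (t : nat) i j : bool :=
  [&& (excess x i j (pt x i i) (pt x j i) <= t)%N,
      (excess x i j (pt x i j) (pt x j j) <= t)%N &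
      ~~ ((excess x i j (pt x j i) (x j) <= excess x i j (x j) (pt x j i) + 4 * t)%N &&
          (excess x i j (x j) (pt x j i) <= excess x i j (pt x j i) (x j) + 4 * t)%N)].

Definition no_inversion e x : bool :=
  [forall i, forall j, (e i == e j) && (e i \in G) && (hradius (x i) < hradius (x j))
     ==> (degree x j <= degree x i)%N].

Definition good_cell e x (t : nat) c : bool :=
  [&& c \in G, cell_two [set: 'I_n]%SET c e &
   [exists i, exists j, [&& i != j, e i == c, e j == c,
     hradius (x i) < hradius (x j) & rigid_pair x t i j]]].

(** Around a good cell, the states without inversion either all exchange it or all leave it. One of
    each kind would bound the difference of the counts at the radius of [j], taken with the two
    angles, by [2 t + t] in both directions, while rigidity makes it exceed [4 t]. So the trace of
    these states on the good cells is prescribed. *)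
Lemma card_no_inversion e x (t : nat) : (#|in_cells e| <= t)%N ->
  (#|[set s | no_inversion e (permute_angles (swap_perm e s) x)]%SET|
    <= 2 ^ (#|F| - #|[set c | good_cell e x t c]%SET|))%N.
Proof.
move=> Wt.
pose B c := [forall s : {set F}, (c \in s) ==>
   ~~ no_inversion e (permute_angles (swap_perm e s) x)].
apply: (@card_sets_fixed_on _ _ _ (predC B)) => s; rewrite inE => ns c.
rewrite inE => gc; case: (boolP (c \in s)) => cs; apply/esym.
  apply/negP => /forallP/(_ s); by rewrite cs /= ns.
apply/negbTE; rewrite negbK; apply/forallP => s'; apply/implyP => cs'.
apply/negP => ns'.
move: gc => /and3P[cG two /existsP[i /existsP[j /and5P[ij /eqP ei /eqP ej rij]]]].
have [iG jG] : e i \in G /\ e j \in G by rewrite ei ej.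
have noinv u : no_inversion e (permute_angles (swap_perm e u) x) ->
    (degree (permute_angles (swap_perm e u) x) j <= degree (permute_angles (swap_perm e u) x) i)%N.
  by move=> /forallP/(_ i)/forallP/(_ j); rewrite ei ej eqxx cG rij.
have si : swap_perm e s i = i by rewrite swap_perm_off // ei.
have sj : swap_perm e s j = j by rewrite swap_perm_off // ej.
have si' : swap_perm e s' i = j by apply: swap_perm_on; rewrite ?ei ?ej.
have sj' : swap_perm e s' j = i.
  by apply: swap_perm_on; rewrite ?ei ?ej // eq_sym.
have xj : x j = pt x j j by rewrite /pt; case: (x j).
have := degree_swap_noinv iG jG (noinv _ ns).
have := degree_swap_noinv iG jG (noinv _ ns').
rewrite /permute_angles si sj si' sj' -!/(pt x _ _).
move=> h1 h2 /and3P[a1 a2 a3]; move: a3; rewrite xj.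
have n1 := nbr_count_excess x i j (pt x i i) (pt x j i).
have n2 := nbr_count_excess x i j (pt x i j) (pt x j j).
have n3 := nbr_count_excess x i j (pt x j i) (pt x j j).
by lia.
Qed.

End cell_swaps.

Lemma measurable_fin_partition d (T : measurableType d) (I : finType)
    (f : T -> I) (Q : I -> set T) :
  (forall i, measurable ([set w | f w = i] `&` Q i)) ->
  measurable [set w | Q (f w) w].
Proof.
move=> mQ.
rewrite (_ : mkset _ = \bigcup_(i in [set: I]) ([set w | f w = i] `&` Q i)).
  by apply: fin_bigcup_measurable => // i _; exact: mQ.
apply/seteqP; split=> w /=; first by move=> h; exists (f w).
by move=> [i _ [/= <-]].
Qed.

Lemma pr_fin_partition d (T : measurableType d) (R : realType)
    (P : probability T R) (I : finType) (f : T -> I) (Q : I -> set T) :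
  (forall i, measurable ([set w | f w = i] `&` Q i)) ->
  pr P [set w | Q (f w) w] = \sum_i pr P ([set w | f w = i] `&` Q i).
Proof.
move=> mQ; apply: pr_partition => //; first exact: measurable_fin_partition.
move=> w; rewrite (bigD1 (f w)) //= big1 => [|i fi]; last first.
  by rewrite indicE memNset // => -[/= e _]; rewrite e eqxx in fi.
rewrite addr0 !indicE; congr (_%:R); congr nat_of_bool.
by apply/idP/idP; rewrite !inE; [|case].
Qed.

(** * Averaging over the states of the cells *)

Section swap_average.
Context d (T : measurableType d) (R : realType) (P : probability T R) (n : nat).
Variables (alpha L : R) (F : finType) (G : {set F}) (cell : R -> F).
Variable X : 'I_n -> {RV P >-> (R * R)%type}.
Hypothesis iX : iid_with_law (node_law alpha L : set (R * R) -> \bar R) X.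
Hypothesis mcell : forall c, measurable [set r | cell r = c].

Definition cells (x : 'I_n -> R * R) : {ffun 'I_n -> F} :=
  [ffun i => cell (hradius (x i))].

Lemma measurable_cells d1 (T1 : measurableType d1) (y : 'I_n -> T1 -> R * R) e :
  (forall i, measurable_fun setT (y i)) ->
  measurable [set w | cells (fun i => y i w) = e].
Proof.
move=> my; apply: (@measurable_fin_info _ _ _ _
  (fun i w => cell (hradius (y i w))) [set f | f = e]) => i c.
have mr : measurable_fun setT (fun w => hradius (y i w)).
  exact: (measurableT_comp measurable_fst (my i)).
by rewrite -[X in measurable X]setTI; exact: mr (mcell c).
Qed.

Lemma measurable_no_inversion d1 (T1 : measurableType d1)
    (y : 'I_n -> T1 -> R * R) e : (forall i, measurable_fun setT (y i)) ->
  measurable [set w | no_inversion G L e (fun i => y i w)].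
Proof.
move=> my.
pose b (p : 'I_n * 'I_n * bool) (w : T1) : bool := let: (i, j, o) := p in
  if o then hradius (y i w) < hradius (y j w) else hdist (y i w) (y j w) <= L.
pose dg (f : {ffun 'I_n * 'I_n * bool -> bool}) (i : 'I_n) :=
  #|[pred k | (i != k) && f (i, k, false)]|.
pose Q (f : {ffun 'I_n * 'I_n * bool -> bool}) : bool :=
  [forall i, forall j, (e i == e j) && (e i \in G) && f (i, j, true)
     ==> (dg f j <= dg f i)%N].
have bE w : no_inversion G L e (fun i => y i w) = Q [ffun p => b p w].
  apply: eq_forallb => i; apply: eq_forallb => j; rewrite ffunE /=.
  by congr (_ ==> (_ <= _)%N); apply: eq_card => k; rewrite !inE ffunE.
rewrite (_ : mkset _ = [set w | Q [ffun p => b p w]]); last first.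
  by apply/funext => w; rewrite /mkset bE.
apply: (@measurable_bool_info _ _ _ b Q) => -[[i j] []] /=.
  have mr k : measurable_fun setT (fun w => hradius (y k w)).
    exact: (measurableT_comp measurable_fst (my k)).
  have := measurable_fun_ltr (mr i) (mr j).
  by move/(_ measurableT [set true]); rewrite setTI; exact.
exact: measurable_hdist_le.
Qed.

Let x w i := X i w.
Let E (s : {set F}) := [set w | no_inversion G L (cells (x w))
  (permute_angles (swap_perm G (cells (x w)) s) (x w))].

Let mX i : measurable_fun setT (fun w => X i w). Proof. by []. Qed.

Let mP (s : 'S_n) i : measurable_fun setT (fun w => permute_angles s (x w) i).
Proof.
apply: measurable_fun_pair.
  exact: (measurableT_comp measurable_fst).
exact: (measurableT_comp measurable_snd).
Qed.

Let E_ s e := [set w | cells (x w) = e] `&`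
  [set w | no_inversion G L e (permute_angles (swap_perm G e s) (x w))].

Let mE_ s e : measurable (E_ s e).
Proof.
apply: measurableI; first exact: (measurable_cells e mX).
exact: (measurable_no_inversion e (mP (swap_perm G e s))).
Qed.

Let mE s : measurable (E s).
Proof. exact: (measurable_fin_partition (mE_ s)). Qed.

(** The permutation is random, but only through the cells: where they equal [e] it is a fixed one,
    and [node_tuple_perm] applies piece by piece. The cells themselves are not affected since radii
    do not move. *)
Let prE_ s e : pr P (E_ s e) = pr P (E_ finset.set0 e).
Proof.
pose S : set (n.-tuple (R * R)) := [set t | cells (tnth t) = e] `&`
  [set t | no_inversion G L e (tnth t)].
have mS : measurable S.
  have mt i : measurable_fun setT (fun t : n.-tuple (R * R) => tnth t i).
    exact: measurable_tnth.
  apply: measurableI; first exact: (measurable_cells e mt).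
  exact: (measurable_no_inversion e mt).
have h s' : E_ s' e = node_tuple X (swap_perm G e s') @^-1` S.
  have tE w : tnth (node_tuple X (swap_perm G e s') w) =
      permute_angles (swap_perm G e s') (x w).
    by apply/funext => i; rewrite tnth_mktuple.
  have cE w : cells (permute_angles (swap_perm G e s') (x w)) = cells (x w).
    by apply/ffunP => i; rewrite !ffunE.
  by rewrite predeqE => w; rewrite /E_ /S /setI /preimage /mkset tE cE; split.
by move: mS h; move: S => S mS h; rewrite /pr (h s) (h finset.set0)
  (node_tuple_perm iX _ mS) -(node_tuple_perm iX (swap_perm G e finset.set0) mS).
Qed.

Let prE s : pr P (E s) = pr P [set w | no_inversion G L (cells (x w)) (x w)].
Proof.
have part s' : pr P (E s') = \sum_e pr P (E_ s' e).
  exact: (pr_fin_partition P (mE_ s')).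
have E0 : E finset.set0 = [set w | no_inversion G L (cells (x w)) (x w)].
  apply/funext => w; rewrite /E /mkset; congr (is_true (no_inversion _ _ _ _)).
  by apply/funext => i; rewrite /permute_angles swap_perm_off ?inE //; case: (x w i).
rewrite -E0; transitivity (\sum_e pr P (E_ finset.set0 e)).
  by rewrite part; apply: eq_bigr => e _; exact: prE_.
exact/esym/part.
Qed.

Let cardT_set : #|{set F}| = (2 ^ #|F|)%N.
Proof. by rewrite -[in RHS]cardsT -card_powerset powersetT cardsT. Qed.

(** All states have the same probability of no inversion, so [2^#|F|] times it is the mean number of
    states without inversion, which outside [B] is at most [2^(#|F| - g0)] by
    [card_no_inversion]. *)
Lemma no_inversion_le (B : set T) (t g0 : nat) : measurable B -> (g0 <= #|F|)%N ->
  (forall w, ~ B w -> (#|in_cells G (cells (x w))| <= t)%N /\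
    (g0 <= #|[set c | good_cell G L (cells (x w)) (x w) t c]%SET|)%N) ->
  pr P [set w | no_inversion G L (cells (x w)) (x w)] <= pr P B + 2^-1 ^+ g0.
Proof.
move=> mB gF hB; set p := pr P _.
have N0 : 0 < 2 ^+ #|F| :> R by rewrite exprn_gt0.
rewrite -(ler_pM2l N0).
have -> : 2 ^+ #|F| * p = \sum_(s : {set F}) pr P (E s).
  rewrite (eq_bigr (fun=> p)); last by move=> s _; exact: prE.
  by rewrite sumr_const cardT_set -[p *+ _]mulr_natl natrX.
have -> : 2 ^+ #|F| * (pr P B + 2^-1 ^+ g0) = \sum_(s : {set F}) pr P B + 2 ^+ (#|F| - g0).
  rewrite sumr_const cardT_set -[pr P B *+ _]mulr_natl natrX mulrDr; congr (_ + _).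
  by rewrite -{1}(subnK gF) exprD -mulrA -exprMn mulfV ?expr1n ?mulr1.
apply: (@le_trans _ _ (\sum_(s : {set F}) (pr P B + pr P (E s `\` B)))).
  apply: ler_sum => s _; apply: prU2 => //; first exact: measurableD.
  by move=> w Ew; have [?|?] := pselect (B w); [left|right].
rewrite big_split lerD2l; apply: sum_pr_le => [s|w]; first exact: measurableD.
have [Bw|nBw] := pselect (B w).
  rewrite big1 ?exprn_ge0 // => s _.
  by rewrite indicE memNset // => -[].
have [W g] := hB w nBw.
rewrite (eq_bigr (fun s : {set F} => (no_inversion G L (cells (x w))
  (permute_angles (swap_perm G (cells (x w)) s) (x w)))%:R)); last first.
  move=> s _; rewrite indicE; congr (_%:R); congr nat_of_bool.
  by apply/idP/idP; rewrite inE; [case|].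
rewrite -natr_sum -natrX ler_nat.
apply: (@leq_trans (2 ^ (#|F| - #|[set c | good_cell G L (cells (x w)) (x w) t c]%SET|))%N).
  apply: (leq_trans _ (@card_no_inversion _ _ _ _ L _ (x w) _ W)).
  rewrite -sum1dep_card [leqRHS]big_mkcond /=; apply: leq_sum => s _.
  by case: (no_inversion _ _ _ _).
by rewrite leq_exp2l // leq_sub2l.
Qed.

End swap_average.

(** * Inversions in a window of radii *)

(** Measurability and [hub_le] together, for an event [S] given in any form equivalent to a
    condition on the hub and the classes. *)
Lemma hub_event d d' (T : measurableType d) (V : measurableType d') (R : realType)
    (P : probability T R) (mu : probability V R) (n : nat) (X : 'I_n -> {RV P >-> V})
    (dU : measure_display) (U : measurableType dU) (Y : {RV P >-> U})
    (J : {set 'I_n}) (F : finType) (f0 : F) (kap : U -> V -> F)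
    (Q : U -> pred {ffun 'I_n -> F}) (A : set U) (eps : R) (S : set T) :
  indep_rest mu X Y J -> (forall f, measurable [set z : U * V | kap z.1 z.2 = f]) ->
  (forall e, measurable [set y | Q y e]) -> measurable A -> 0 <= eps ->
  (forall y, A y -> class_prob J f0 (class_weight mu kap y) (Q y) <= eps) ->
  (forall w, S w <-> A (Y w) /\ Q (Y w) (classes X Y J f0 kap w)) ->
  measurable S /\ pr P S <= eps * pr P (Y @^-1` A).
Proof.
move=> iY mkap mQ mA eps0 h hS.
have -> : S = [set w | A (Y w) /\ Q (Y w) (classes X Y J f0 kap w)].
  by apply/funext => w; exact/propext.
by split; [exact: (measurable_class_event X Y J f0 mkap mQ mA)|exact: (hub_le iY mkap mQ mA eps0 h)].
Qed.

Section class_weight_sum.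
Context d' (V : measurableType d') (R : realType) (mu : probability V R).
Variables (dU : measure_display) (U : measurableType dU).
Variables (F : finType) (kap : U -> V -> F).
Hypothesis mkap : forall f, measurable [set z : U * V | kap z.1 z.2 = f].

Lemma measurable_class_weight (y : U) (D : pred F) : measurable [set x | D (kap y x)].
Proof. by apply: (measurable_fin_preim D) => f; exact: measurable_kap. Qed.

Lemma class_weight_sum (y : U) (D : pred F) :
  \sum_(f | D f) class_weight mu kap y f = pr mu [set x | D (kap y x)].
Proof.
have mD f : measurable [set x | kap y x = f /\ D f].
  by apply: (@measurable_fin_preim _ _ _ (kap y) [set g | g = f /\ D f]) => g; exact: measurable_kap.
rewrite (pr_partition mu mD (measurable_class_weight y D)); last first.
  move=> x; rewrite (bigD1 (kap y x)) //= big1 => [|f fx].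
    rewrite addr0 !indicE; congr (_%:R); congr nat_of_bool.
    by apply/idP/idP; rewrite !inE /=; [|case].
  by rewrite indicE memNset // => -[/= e _]; rewrite e eqxx in fx.
rewrite big_mkcond; apply: eq_bigr => f _; case: ifPn => Df.
  by congr (pr mu _); apply/seteqP; split=> x /=; [|case].
rewrite (_ : [set x | _] = set0) ?pr_set0 //.
by apply/seteqP; split=> x //= [_]; exact/negP.
Qed.

Lemma class_weight_ge0 y f : 0 <= class_weight mu kap y f.
Proof. exact: pr_ge0. Qed.

Lemma class_weight_sum1 y : \sum_f class_weight mu kap y f = 1.
Proof.
rewrite (class_weight_sum y predT) (_ : mkset _ = setT) ?pr_setT //.
by apply/seteqP.
Qed.

End class_weight_sum.

Section two_node_cells.
Context d (T : measurableType d) (R : realType) (P : probability T R) (n : nat).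
Variables (alpha L : R) (F : finType) (G : {set F}) (cell : R -> F).
Variable X : 'I_n -> {RV P >-> (R * R)%type}.
Hypothesis iX : iid_with_law (node_law alpha L : set (R * R) -> \bar R) X.
Hypothesis mcell : forall c, measurable [set r | cell r = c].
Variable i0 : 'I_n.

(** The same measure as [node_law], which is normalised only for positive parameters; as the law of
    a node it comes with the structure of a probability. *)
Definition first_law : probability (R * R)%type R := distribution P (X i0).
Local Notation mu := first_law.

Lemma iid_first_law i A : measurable A -> distribution P (X i) A = mu A.
Proof. by have [_ h] := iX => mA; exact: etrans (h i A mA) (esym (h i0 A mA)). Qed.

Lemma first_lawE A : measurable A -> mu A = node_law alpha L A.
Proof. by have [_ h] := iX => mA; exact: h. Qed.

Lemma pr_first_law i A : measurable A -> pr P (X i @^-1` A) = pr mu A.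
Proof. by move=> mA; have := iid_first_law i mA; rewrite /pr /= => <-. Qed.

Lemma pr_first_law_le A (c : R) : measurable A ->
  (node_law alpha L A <= c%:E)%E -> pr mu A <= c.
Proof. by move=> mA h; rewrite -lee_fin -prE // first_lawE. Qed.

Lemma pr_first_law_ge A (c : R) : measurable A ->
  (c%:E <= node_law alpha L A)%E -> c <= pr mu A.
Proof. by move=> mA h; rewrite -lee_fin -prE // first_lawE. Qed.

Lemma measurable_cell_radius c : measurable [set x : R * R | cell (hradius x) = c].
Proof.
rewrite (_ : mkset _ = [set r | cell r = c] `*` setT).
  exact: measurableX.
by apply/seteqP; split=> -[r f] //= [].
Qed.

Lemma pr_cell c : (pr mu [set x : R * R | cell (hradius x) = c])%:E =
  radial_law alpha L [set r | cell r = c].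
Proof.
rewrite -prE; last exact: measurable_cell_radius.
rewrite first_lawE; last exact: measurable_cell_radius.
rewrite (_ : mkset _ = [set r | cell r = c] `*` setT); last first.
  by apply/seteqP; split=> -[r f] //= [].
rewrite node_lawE // probability_setT mule1 //.
Qed.

Variables (theta b : R).
Hypothesis theta1 : theta < 1.
Hypothesis b0 : 0 <= b.
Hypothesis cell_le : forall c, c \in G -> (radial_law alpha L [set r | cell r = c] <= theta%:E)%E.
Hypothesis cell_ge : forall c, c \in G -> (b%:E <= radial_law alpha L [set r | cell r = c])%E.
Hypothesis ntheta : n%:R * theta <= 1 / 2.

Definition pairs_mean : R := #|G|%:R * ('C(n, 2)%:R * b ^+ 2 / 2).

Let x w i := X i w.

(** The hub is trivial and the class of a node is its cell. [two_cells_lower] applies to the true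
    mean; its bound decreases in the mean, which is at least [pairs_mean]. *)
Lemma few_pairs_le : 0 < pairs_mean ->
  measurable [set w | (two_cells [set: 'I_n]%SET G (cells cell (x w)))%:R <= pairs_mean / 2] /\
  pr P [set w | (two_cells [set: 'I_n]%SET G (cells cell (x w)))%:R <= pairs_mean / 2]
   <= 4 / pairs_mean + 4 * (((1 - theta)^-1) ^+ 4 - 1).
Proof.
move=> m0.
pose kap (y : unit) (z : R * R) := cell (hradius z).
have mkap f : measurable [set z : unit * (R * R) | kap z.1 z.2 = f].
  rewrite -[X in measurable X]setTI.
  have mf : measurable_fun setT (fun z : unit * (R * R) => z.2.1).
    exact: (measurableT_comp measurable_fst measurable_snd).
  exact: (mf measurableT _ (mcell f)).
have wE y c : (class_weight mu kap y c)%:E = radial_law alpha L [set r | cell r = c].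
  exact: pr_cell.
have iY := indep_rest_cst (proj1 iX) iid_first_law [set: 'I_n]%SET.
pose f0 := cell 0.
pose Q (y : unit) := [pred e : {ffun 'I_n -> F} | (two_cells [set: 'I_n]%SET G e)%:R <= pairs_mean / 2].
have mQ e : measurable [set y | Q y e].
  have [h|h] := boolP (Q tt e).
    by rewrite (_ : mkset _ = setT) //; apply/seteqP; split=> // -[].
  by rewrite (_ : mkset _ = set0) //; apply/seteqP; split=> // -[] /=; rewrite (negbTE h).
have e1 w : classes X (cst tt : {RV P >-> unit}) [set: 'I_n]%SET f0 kap w = cells cell (x w).
  by apply/ffunP => k; rewrite !ffunE finset.in_setT.
have w0 y f : 0 <= class_weight mu kap y f by exact: class_weight_ge0.
have w1 y : \sum_f class_weight mu kap y f = 1 by exact: class_weight_sum1.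
have wth y c : c \in G -> class_weight mu kap y c <= theta.
  by move=> cG; rewrite -lee_fin wE; exact: cell_le.
have wb y c : c \in G -> b <= class_weight mu kap y c.
  by move=> cG; rewrite -lee_fin wE; exact: cell_ge.
have mean y : pairs_mean <= two_cells_mean [set: 'I_n]%SET f0 (class_weight mu kap y) G.
  apply: le_trans (two_cells_mean_ge f0 (w0 y) (w1 y) (wth y) _ b0 (wb y)) => //.
    by rewrite cardsT card_ord.
  by rewrite cardsT card_ord.
have K0 : 0 <= 4 / pairs_mean + 4 * (((1 - theta)^-1) ^+ 4 - 1).
  have mt := mean tt.
  have [c cG] : exists c, c \in G.
    apply/set0Pn; apply: contraTneq m0 => G0.
    by rewrite /pairs_mean G0 cards0 mul0r ltxx.
  have th0 : 0 <= theta by apply: le_trans (wth tt c cG).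
  rewrite addr_ge0 // ?divr_ge0 // ?(ltW m0) // mulr_ge0 // subr_ge0 exprn_ege1 //.
  by rewrite invf_ge1 ?subr_gt0 // lerBlDr lerDl.
have [] := hub_event (f0 := f0) iY mkap mQ measurableT K0 _ (S := [set w | (two_cells [set: 'I_n]%SET G (cells cell (x w)))%:R <= pairs_mean / 2]); last 2 first.
- by move=> w; rewrite /mkset e1; split=> // -[].
- move=> mS h; split=> //; apply: le_trans h _.
  by rewrite ler_piMr // preimage_setT pr_setT.
move=> y _.
have mp : 0 < two_cells_mean [set: 'I_n]%SET f0 (class_weight mu kap y) G by apply: lt_le_trans (mean y).
have h := two_cells_lower (w0 y) (w1 y) theta1 (wth y) mp.
apply: (@le_trans _ _ (4 / two_cells_mean [set: 'I_n]%SET f0 (class_weight mu kap y) G + 4 * (((1 - theta)^-1) ^+ 4 - 1))).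
  apply: le_trans h; rewrite !class_probE; apply: class_E_le => // e.
  rewrite ler_nat /Q /=; case: (lerP _ (pairs_mean / 2)) => //= he; rewrite lt0b.
  by apply: le_trans he _; rewrite ler_pM2r // invr_gt0.
by rewrite lerD2r ler_wpM2l // lef_pV2.
Qed.

End two_node_cells.

Section measurable_comparisons.
Context d (T : measurableType d) (R : realType).
Implicit Types f g : T -> R.

Lemma measurable_le_set f g : measurable_fun setT f -> measurable_fun setT g ->
  measurable [set w | f w <= g w].
Proof.
move=> mf mg; have := measurable_fun_ler mf mg.
by move/(_ measurableT [set true]); rewrite setTI; exact.
Qed.

Lemma measurable_lt_set f g : measurable_fun setT f -> measurable_fun setT g ->
  measurable [set w | f w < g w].
Proof.
move=> mf mg; have := measurable_fun_ltr mf mg.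
by move/(_ measurableT [set true]); rewrite setTI; exact.
Qed.

Lemma measurable_eq_set f g : measurable_fun setT f -> measurable_fun setT g ->
  measurable [set w | f w = g w].
Proof.
move=> mf mg; rewrite (_ : mkset _ = [set w | f w <= g w] `&` [set w | g w <= f w]).
  by apply: measurableI; exact: measurable_le_set.
apply/seteqP; split=> w /=; first by move=> ->.
by move=> [h1 h2]; apply/eqP; rewrite eq_le h1.
Qed.

Lemma measurable_bool_set (b : T -> bool) : measurable [set w | b w] ->
  forall c, measurable [set w | b w = c].
Proof.
move=> mb [] //; rewrite (_ : mkset _ = ~` [set w | b w]); first exact: measurableC.
by apply/seteqP; split=> w /=; [move=> ->|move/negP/negbTE].
Qed.

Lemma measurable_one_minus_cos f g : measurable_fun setT f -> measurable_fun setT g ->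
  measurable_fun setT (fun w => 1 - cos (f w - g w)).
Proof.
move=> mf mg; apply: measurable_funB => //.
have mc : measurable_fun setT (@cos R).
  by apply: continuous_measurable_fun; exact: continuous_cos.
by apply: (measurableT_comp mc); exact: measurable_funB.
Qed.

End measurable_comparisons.

Lemma ord_pair_gt1 (n : nat) (i j : 'I_n) : i != j -> (1 < n)%N.
Proof. by move: (ltn_ord i) (ltn_ord j); rewrite -val_eqE /=; lia. Qed.

(** * Pairs of nodes of one cell that fail to be rigid *)

Section bad_pairs.
Context d (T : measurableType d) (R : realType) (P : probability T R) (n : nat).
Variables (alpha L : R) (F : finType) (G : {set F}) (cell : R -> F).
Variable X : 'I_n -> {RV P >-> (R * R)%type}.
Hypotheses (a12 : 1 / 2 < alpha) (L8 : 8 <= L).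
Hypothesis iX : iid_with_law (node_law alpha L : set (R * R) -> \bar R) X.
Hypothesis mcell : forall c, measurable [set r | cell r = c].
Variable i0 : 'I_n.
Variables (theta t0 Dm : R).
Hypothesis cell_le : forall c, c \in G -> (radial_law alpha L [set r | cell r = c] <= theta%:E)%E.
Hypotheses (t04 : 4 <= t0) (t0L : t0 + 2 <= L).
Hypothesis cell_window : forall c r, c \in G -> cell r = c -> t0 <= r <= t0 + 1.
Hypothesis cell_ball_mass : forall c r s, c \in G -> cell r = c -> cell s = c ->
  r <= s -> ball_mass alpha L r - ball_mass alpha L s <= Dm.
Hypothesis Dm0 : 0 <= Dm.
Local Notation mu := (first_law X i0).
Let x w i := X i w.
Let a0 : 0 < alpha. Proof. by move: a12; lra. Qed.
Let L0 : 0 < L. Proof. by move: L8; lra. Qed.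

Lemma theta_ge0 c : c \in G -> 0 <= theta.
Proof. by move=> cG; rewrite -lee_fin; apply: le_trans (cell_le cG). Qed.

Lemma pr_cell_le c : c \in G -> pr mu [set z : R * R | cell (hradius z) = c] <= theta.
Proof.
move=> cG; rewrite -lee_fin (pr_cell iX mcell); exact: cell_le.
Qed.

Lemma pr_two_cell_le c (i j : 'I_n) : c \in G -> i != j ->
  pr P [set w | cell (hradius (x w i)) = c /\ cell (hradius (x w j)) = c] <= theta ^+ 2.
Proof.
move=> cG ij; set C := [set z : R * R | cell (hradius z) = c].
have mC : measurable C by exact: measurable_cell_radius.
have lX := iid_first_law iX i0.
have iY := indep_rest_node (proj1 iX) lX (i := i) (J := [set j]%SET).
have := iY _ C (fun=> C) mC (fun=> mC); rewrite inE big_set1 => /(_ ij) e.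
have eS : [set w | cell (hradius (x w i)) = c /\ cell (hradius (x w j)) = c] =
    (X i @^-1` C) `&` [set w | forall k, k \in [set j]%SET -> C (X k w)].
  apply/seteqP; split=> w /= [h1 h2]; split=> //; first by move=> k; rewrite inE => /eqP ->.
  by apply: h2; rewrite inE.
have mS : measurable (X i @^-1` C) by exact: measurable_preim.
have h1 : P (X i @^-1` C) = (pr mu C)%:E by rewrite -(prE mu mC); exact: lX.
rewrite eS /pr e h1 (prE mu mC) /= expr2.
by apply: ler_pM; rewrite ?pr_ge0 //; exact: pr_cell_le.
Qed.

(** Pairs set aside before the anticoncentration argument: close angles make the two balls overlap
    too much, and equal radii are not strictly ordered. *)
Definition close_pair (g : R) c i j : set T :=
  [set w | [/\ cell (hradius (x w i)) = c, cell (hradius (x w j)) = c,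
    - pi <= hangle (x w i) <= pi &
    (1 - cos (hangle (x w i) - hangle (x w j)) <= g) || (hradius (x w i) == hradius (x w j))]].

(** With node [i] as hub, the cell and the angle of node [j] are independent, and a coincidence of
    radii is a null event. *)
Lemma close_pair_le (g : R) c i j : c \in G -> i != j -> 0 <= g ->
  measurable (close_pair g c i j) /\
  pr P (close_pair g c i j) <= 2 * Num.sqrt g * theta ^+ 2.
Proof.
move=> cG ij g0; have th0 := theta_ge0 cG.
pose kap (y z : R * R) := (cell (hradius z) == c) &&
  ((1 - cos (hangle y - hangle z) <= g) || (hradius y == hradius z)).
pose V2 := ((R * R) * (R * R))%type.
have m1 : measurable_fun setT (fun z : V2 => z.1.1) by exact: (measurableT_comp measurable_fst measurable_fst).
have m2 : measurable_fun setT (fun z : V2 => z.1.2) by exact: (measurableT_comp measurable_snd measurable_fst).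
have m3 : measurable_fun setT (fun z : V2 => z.2.1) by exact: (measurableT_comp measurable_fst measurable_snd).
have m4 : measurable_fun setT (fun z : V2 => z.2.2) by exact: (measurableT_comp measurable_snd measurable_snd).
have mkap f : measurable [set z : V2 | kap z.1 z.2 = f].
  apply: (@measurable_bool_set _ _ (fun z : V2 => kap z.1 z.2)).
  rewrite (_ : mkset _ = [set z : V2 | cell z.2.1 = c] `&`
    ([set z : V2 | 1 - cos (z.1.2 - z.2.2) <= g] `|` [set z : V2 | z.1.1 = z.2.1])).
    apply: measurableI; first by rewrite -[X in measurable X]setTI; exact: (m3 measurableT _ (mcell c)).
    apply: measurableU; last exact: measurable_eq_set.
    by apply: measurable_le_set => //; exact: measurable_one_minus_cos.
  apply/seteqP; split=> z /=; rewrite /kap.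
    by move=> /andP[/eqP h1 /orP[h2|/eqP h2]]; split=> //; [left|right].
  move=> [h1 h2]; rewrite [cell _]h1 eqxx /=; apply/orP.
  by case: h2 => [|/eqP]; [left|right].
pose A := [set y : R * R | cell (hradius y) = c] `&` [set y | - pi <= hangle y <= pi].
have mA : measurable A.
  apply: measurableI; first exact: measurable_cell_radius.
  rewrite (_ : mkset _ = setT `*` `[- pi, pi]%classic); first exact: measurableX.
  by apply/seteqP; split=> -[r f] /=; rewrite in_itv //= => -[].
have iY := indep_rest_node (proj1 iX) (iid_first_law iX i0) (i := i) (J := [set j]%SET).
rewrite inE in iY.
pose Q (y : R * R) := [pred e : {ffun 'I_n -> bool} | e j].
have mQ e : measurable [set y | Q y e].
  have [h|h] := boolP (e j).
    by rewrite (_ : mkset _ = setT) //; apply/seteqP; split.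
  by rewrite (_ : mkset _ = set0) //; apply/seteqP; split=> // y /=; rewrite (negbTE h).
have eps0 : 0 <= 2 * Num.sqrt g * theta by rewrite !mulr_ge0 ?sqrtr_ge0.
have [||mS hS] := @hub_event _ _ _ _ _ _ _ _ X _ _ (X i) [set j]%SET _ false kap Q A
   (2 * Num.sqrt g * theta) (close_pair g c i j) (iY ij) mkap mQ mA eps0; last 1 first.
- split=> //; apply: le_trans hS _; rewrite expr2 mulrA; apply: ler_wpM2l => //.
  rewrite (pr_first_law iX i0 i mA); apply: le_trans (pr_cell_le cG).
  by apply: pr_mono => //; [exact: measurable_cell_radius|move=> z []].
- move=> y [Ay1 Ay2].
  have w0 := class_weight_ge0 mu kap y.
  have := @class_prob_markov _ _ [set j]%SET _ false _ w0 (Q y)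
    (fun e => (class_count [set j]%SET id e)%:R) 1 ltr01.
  rewrite class_E_count; last exact: class_weight_sum1.
  rewrite cards1 mul1r divr1 => /(_ _ _)/le_trans; apply => //.
    by move=> e /= ej; rewrite ler1n card_gt0; apply/set0Pn; exists j; rewrite !inE eqxx.
  rewrite class_weight_sum //.
  pose S1 := [set z : R * R | cell (hradius z) = c /\ 1 - cos (hangle y - hangle z) <= g].
  pose S2 : set (R * R) := [set hradius y] `*` setT.
  have mS1 : measurable S1.
    rewrite (_ : S1 = [set z : R * R | cell (hradius z) = c] `&` [set z : R * R | 1 - cos (hangle y - z.2) <= g]).
      apply: measurableI; first exact: measurable_cell_radius.
      by apply: measurable_le_set => //; apply: measurable_one_minus_cos => //; exact: measurable_snd.
    by [].
  have mS2 : measurable S2 by exact: measurableX.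
  have mS : measurable [set z | kap y z] by exact: (measurable_class_weight mkap y id).
  apply: le_trans (prU2 mu mS mS1 mS2 _) _.
    move=> z /andP[/eqP h1 /orP[h2|/eqP h2]]; [by left|by right; split].
  have -> : pr mu S2 = 0.
    apply: EFin_inj; rewrite -prE // (first_lawE iX) // node_lawE // radial_set1 //.
    by rewrite mul0e.
  rewrite addr0; apply: (pr_first_law_le iX) => //.
  have h5 : (node_law alpha L S1 <= (2 * Num.sqrt g)%:E * radial_law alpha L [set r | cell r = c])%E.
    exact: (angle_close_mass alpha L (mcell c) Ay2 g0).
  apply: le_trans h5 _.
  by rewrite (EFinM (2 * Num.sqrt g) theta); apply: lee_wpmul2l; [rewrite lee_fin mulr_ge0 ?sqrtr_ge0|exact: cell_le].
- move=> w; rewrite /close_pair /A /Q /kap /classes /= ffunE inE eqxx; split.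
    by move=> [h1 h2 h3 h4]; rewrite h2 eqxx.
  by move=> [[h1 h3] /andP[/eqP h2 h4]].
Qed.

Lemma excess_count J (D : pred (bool * bool * bool * bool)) (z1 z2 : R * R) (i j : 'I_n) w
    (e : {ffun 'I_n -> bool * bool * bool * bool}) : J = (~: [set i; j])%SET ->
  (forall k, k \in J -> D (e k) = (hdist z1 (x w k) <= L) && ~~ (hdist z2 (x w k) <= L)) ->
  excess L (x w) i j z1 z2 = class_count J D e.
Proof.
move=> -> h; apply: eq_card => k; rewrite !inE negb_or.
case: (boolP (k == i)) => //= ki; case: (boolP (k == j)) => //= kj.
by rewrite h // !inE negb_or ki.
Qed.

Let q : R := strip_mass alpha / 24 * expR (- ((t0 + 1) / 2)).

(** Markov's inequality for the two radial excesses, each of mean at most [n Dm]; then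
    anticoncentration of the difference of the angular excesses over [2 (4 t) + 1] values. *)
Definition rigid_error (t : nat) : R :=
  2 * (n%:R * Dm / t.+1%:R) + (8 * t + 1)%:R / Num.sqrt ((n - 1)%:R * (4 * q)).

Definition loose_pair (t : nat) (g : R) c i j : set T :=
  [set w | [/\ cell (hradius (x w i)) = c, cell (hradius (x w j)) = c,
    hradius (x w i) <= hradius (x w j), - pi <= hangle (x w i) <= pi /\ - pi <= hangle (x w j) <= pi &
    (g < 1 - cos (hangle (x w i) - hangle (x w j))) && ~~ rigid_pair L (x w) t i j]].

(** The hub consists of the two positions; every other node reports to which of four balls it
    belongs, centred at the two radii combined with the two angles. The separation by [g] gives both
    difference sets a mass at least [q], and ball masses at most 1/4 ensure [p1 + p2 + 2 q <= 1]. *)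
Lemma loose_pair_le (t : nat) (g : R) c i j : c \in G -> i != j ->
  64 * expR (1 - t0) <= g -> 4 * ball_mass_const alpha * expR (- (t0 / 2)) <= 1 ->
  measurable (loose_pair t g c i j) /\
  pr P (loose_pair t g c i j) <= rigid_error t * theta ^+ 2.
Proof.
move=> cG ij hg hB; have th0 := theta_ge0 cG.
pose V2 := ((R * R) * (R * R))%type.
pose four := (bool * bool * bool * bool)%type.
pose J := (~: [set i; j])%SET : {set 'I_n}.
pose kap (y : V2) (z : R * R) : four :=
  (hdist (y.1.1, y.1.2) z <= L, hdist (y.2.1, y.1.2) z <= L,
   hdist (y.1.1, y.2.2) z <= L, hdist (y.2.1, y.2.2) z <= L).
pose D12 (f : four) := f.1.1.1 && ~~ f.1.1.2.
pose D34 (f : four) := f.1.2 && ~~ f.2.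
pose D24 (f : four) := f.1.1.2 && ~~ f.2.
pose D42 (f : four) := f.2 && ~~ f.1.1.2.
have m11 : measurable_fun setT (fun z : V2 => z.1.1) by exact: (measurableT_comp measurable_fst measurable_fst).
have m12 : measurable_fun setT (fun z : V2 => z.1.2) by exact: (measurableT_comp measurable_snd measurable_fst).
have m21 : measurable_fun setT (fun z : V2 => z.2.1) by exact: (measurableT_comp measurable_fst measurable_snd).
have m22 : measurable_fun setT (fun z : V2 => z.2.2) by exact: (measurableT_comp measurable_snd measurable_snd).
have mkap f : measurable [set z : V2 * (R * R) | kap z.1 z.2 = f].
  have mb (u v : V2 -> R) c' : measurable_fun setT u -> measurable_fun setT v ->
      measurable [set z : V2 * (R * R) | (hdist (u z.1, v z.1) z.2 <= L) = c'].
    move=> mu' mv; apply: (@measurable_bool_set _ _ (fun z : V2 * (R * R) => hdist (u z.1, v z.1) z.2 <= L)).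
    apply: measurable_hdist_le; last exact: measurable_snd.
    by apply: measurable_fun_pair; exact: (measurableT_comp _ measurable_fst).
  case: f => [[[c1 c2] c3] c4].
  rewrite (_ : mkset _ =
    [set z : V2 * (R * R) | (hdist (z.1.1.1, z.1.1.2) z.2 <= L) = c1] `&`
    [set z : V2 * (R * R) | (hdist (z.1.2.1, z.1.1.2) z.2 <= L) = c2] `&`
    [set z : V2 * (R * R) | (hdist (z.1.1.1, z.1.2.2) z.2 <= L) = c3] `&`
    [set z : V2 * (R * R) | (hdist (z.1.2.1, z.1.2.2) z.2 <= L) = c4]).
    apply: measurableI; [apply: measurableI; [apply: measurableI|]|].
    - exact: (mb (fun y => y.1.1) (fun y => y.1.2)).
    - exact: (mb (fun y => y.2.1) (fun y => y.1.2)).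
    - exact: (mb (fun y => y.1.1) (fun y => y.2.2)).
    - exact: (mb (fun y => y.2.1) (fun y => y.2.2)).
  apply/seteqP; split=> z; rewrite /kap /mkset /setI; first by case=> h1 h2 h3 h4; split; [split; [split|]|].
  by move=> [[[h1 h2] h3] h4]; congr (_, _, _, _); [exact: h1|exact: h2|exact: h3|exact: h4].
pose inpi := [set f : R | - pi <= f <= pi].
have minpi : measurable inpi.
  rewrite (_ : inpi = `[- pi, pi]%classic); first exact: measurable_itv.
  by apply/seteqP; split=> f; rewrite /inpi /= in_itv.
pose A := [set y : V2 | cell y.1.1 = c] `&` [set y | cell y.2.1 = c] `&`
  [set y | y.1.1 <= y.2.1] `&` [set y | inpi y.1.2] `&` [set y | inpi y.2.2] `&`
  [set y | g < 1 - cos (y.1.2 - y.2.2)].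
have mpre (u : V2 -> R) (S : set R) : measurable_fun setT u -> measurable S -> measurable [set y | S (u y)].
  by move=> mu' mS; rewrite -[X in measurable X]setTI; exact: (mu' measurableT _ mS).
have mA : measurable A.
  do ?apply: measurableI.
  - exact: (mpre _ _ m11 (mcell c)).
  - exact: (mpre _ _ m21 (mcell c)).
  - exact: measurable_le_set.
  - exact: mpre.
  - exact: mpre.
  - by apply: measurable_lt_set => //; exact: measurable_one_minus_cos.
have [iJ jJ] : i \notin J /\ j \notin J by rewrite !inE !eqxx orbT.
have iY := indep_rest_nodes (proj1 iX) (iid_first_law iX i0) ij iJ jJ.
pose Q12 := [pred e : {ffun 'I_n -> four} | t.+1%:R <= (class_count J D12 e)%:R :> R].
pose Q34 := [pred e : {ffun 'I_n -> four} | t.+1%:R <= (class_count J D34 e)%:R :> R].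
pose Qa := [pred e : {ffun 'I_n -> four} |
   (class_count J D24 e <= class_count J D42 e + 4 * t)%N && (class_count J D42 e <= class_count J D24 e + 4 * t)%N].
pose Q (y : V2) := [pred e : {ffun 'I_n -> four} | [|| Q12 e, Q34 e | Qa e]].
have mQ e : measurable [set y | Q y e].
  have [h|h] := boolP [|| Q12 e, Q34 e | Qa e].
    by rewrite (_ : mkset _ = setT) //; apply/seteqP; split=> // y _; exact: h.
  by rewrite (_ : mkset _ = set0) //; apply/seteqP; split=> // y; rewrite /mkset /Q /= (negbTE h).
have sm0 := strip_mass_gt0 a12.
have q0 : 0 < q by rewrite /q mulr_gt0 ?expR_gt0 // divr_gt0.
have eps0 : 0 <= rigid_error t.
  by rewrite /rigid_error addr_ge0 ?mulr_ge0 ?invr_ge0 ?sqrtr_ge0.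
have [||mS hS] := @hub_event _ _ _ _ _ _ _ _ X _ _ (pairRV (X i) (X j)) J _ (true, true, true, true) kap Q A
   (rigid_error t) (loose_pair t g c i j) iY mkap mQ mA eps0; last 1 first.
- split=> //; apply: le_trans hS _; apply: ler_wpM2l => //.
  apply: le_trans (pr_two_cell_le cG ij); apply: pr_mono.
  + exact: (measurable_preim (pairRV (X i) (X j)) mA).
  + have mC k : measurable (X k @^-1` [set z : R * R | cell (hradius z) = c]).
      by apply: measurable_preim; exact: measurable_cell_radius.
    exact: (measurableI _ _ (mC i) (mC j)).
  + by move=> w [[[[[? ?] _] _] _] _].
- move=> y [[[[[c1 c2] r12] p1] p2] sep].
  have w0 := class_weight_ge0 mu kap y.
  have w1 := class_weight_sum1 mu mkap y.
  have /andP[r1a r1b] := cell_window cG c1; have /andP[r2a r2b] := cell_window cG c2.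
  pose r1 : R := y.1.1; pose r2 : R := y.2.1.
  have h14 : 4 <= r1 by exact: le_trans t04 r1a.
  have h24 : 4 <= r2 by exact: le_trans t04 r2a.
  have h12 : r1 <= r2 by exact: r12.
  have t1L : t0 + 1 <= L by move: t0L; lra.
  have h2L : r2 <= L by exact: le_trans r2b t1L.
  have h2t : t0 <= r2 by exact: r2a.
  have h2t' : r2 <= t0 + 1 by exact: r2b.
  have h2L1 : r2 + 1 <= L by move: t0L h2t'; lra.
  have h20 : 0 < r2 by apply: lt_le_trans h24.
  have mball z : measurable (ball L z) by exact: measurable_ball.
  have JE : (#|J| = n - 2)%N by rewrite cardsCs finset.setCK cards2 ij card_ord.
  have bound (D : pred four) : pr mu [set z | D (kap y z)] <= Dm ->
      class_prob J (true, true, true, true) (class_weight mu kap y)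
        [pred e | t.+1%:R <= (class_count J D e)%:R :> R] <= n%:R * Dm / t.+1%:R.
    move=> hD; have t1 : 0 < t.+1%:R :> R by rewrite ltr0n.
    have := @class_prob_markov _ _ J _ (true, true, true, true) _ w0
      [pred e | t.+1%:R <= (class_count J D e)%:R :> R] (fun e => (class_count J D e)%:R) t.+1%:R t1.
    rewrite class_E_count // (class_weight_sum mu mkap) => /(_ _ _)/le_trans; apply => //.
    apply: ler_wpM2r; first by rewrite invr_ge0 ltW.
    apply: ler_pM; [exact: ler0n|exact: pr_ge0| |exact: hD].
    by rewrite ler_nat JE; exact: leq_subr.
  pose Qb : pred {ffun 'I_n -> four} := fun e => Q34 e || Qa e.
  pose cp := class_prob J (true, true, true, true) (class_weight mu kap y).
  have u1 : cp (Q y) <= cp Q12 + cp Qb by apply: class_probU.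
  have u2 : cp Qb <= cp Q34 + cp Qa by apply: class_probU.
  apply: le_trans u1 _.
  rewrite /rigid_error mulr2n mulrDl mul1r -addrA; apply: lerD.
    apply: bound; apply: (pr_first_law_le iX); first exact: (measurable_class_weight mkap y D12).
    rewrite (_ : mkset _ = ball L (y.1.1, y.1.2) `\` ball L (y.2.1, y.1.2)); last first.
      by apply/seteqP; split=> z; [move=> /andP[? /negP]|move=> [? /negP ?]; apply/andP].
    rewrite (ball_diff_mass a12 L8 h14 h12 h2L) //.
    by rewrite lee_fin; exact: (cell_ball_mass cG).
  apply: le_trans u2 _.
  apply: lerD.
    apply: bound; apply: (pr_first_law_le iX); first exact: (measurable_class_weight mkap y D34).
    rewrite (_ : mkset _ = ball L (y.1.1, y.2.2) `\` ball L (y.2.1, y.2.2)); last first.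
      by apply/seteqP; split=> z; [move=> /andP[? /negP]|move=> [? /negP ?]; apply/andP].
    rewrite (ball_diff_mass a12 L8 h14 h12 h2L) //.
    by rewrite lee_fin; exact: (cell_ball_mass cG).
  have n1 : (#|J|.+1 = n - 1)%N.
    by rewrite JE subnSK // (ord_pair_gt1 ij).
  have mD z z' : measurable (ball L z `\` ball L z') := measurableD (mball z) (mball z').
  have qle (a a' : R) : - pi <= a <= pi -> - pi <= a' <= pi -> g < 1 - cos (a - a') ->
      q <= pr mu (ball L (r2, a') `\` ball L (r2, a)).
    move=> ha ha' hs; apply: (pr_first_law_ge iX); first exact: mD.
    have sp : 32 * (expR (1 - r2) + expR (1 - r2)) < 1 - cos (a - a').
      apply: le_lt_trans hs; apply: le_trans hg.
      have : expR (1 - r2) <= expR (1 - t0) by rewrite ler_expR lerD2l lerN2.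
      by lra.
    apply: le_trans (@ball_separated_mass _ _ _ a12 L8 (r2, a) (r2, a') h24 h2L h24 h2L1 ha' sp).
    rewrite lee_fin /q; apply: ler_wpM2l; first by rewrite divr_ge0 // ltW.
    by rewrite ler_expR lerN2 ler_pM2r.
  have ple (a : R) : - pi <= a <= pi -> pr mu (ball L (r2, a)) <= 1 / 4.
    move=> ha; apply: (pr_first_law_le iX); first exact: mball.
    have r2in : 0 < hradius (r2, a) <= L by apply/andP; split.
    have bE : node_law alpha L (ball L (r2, a)) = (ball_mass alpha L r2)%:E.
      exact: (ball_massE a0 L0 r2in ha).
    rewrite bE lee_fin; apply: le_trans (ball_mass_le a12 L8 h20 h2L) _.
    have cg := ball_mass_const_gt0 a12.
    have : expR (- (r2 / 2)) <= expR (- (t0 / 2)) by rewrite ler_expR lerN2 ler_pM2r.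
    by move: hB cg; nra.
  have e24 : [set z | D24 (kap y z)] = ball L (y.2.1, y.1.2) `\` ball L (y.2.1, y.2.2).
    by apply/seteqP; split=> z; [move=> /andP[? /negP]|move=> [? /negP ?]; apply/andP].
  have e42 : [set z | D42 (kap y z)] = ball L (y.2.1, y.2.2) `\` ball L (y.2.1, y.1.2).
    by apply/seteqP; split=> z; [move=> /andP[? /negP]|move=> [? /negP ?]; apply/andP].
  have s24 : \sum_(f | D24 f) class_weight mu kap y f = pr mu (ball L (y.2.1, y.1.2) `\` ball L (y.2.1, y.2.2)).
    by rewrite (class_weight_sum mu mkap) e24.
  have s42 : \sum_(f | D42 f) class_weight mu kap y f = pr mu (ball L (y.2.1, y.2.2) `\` ball L (y.2.1, y.1.2)).
    by rewrite (class_weight_sum mu mkap) e42.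
  have q24 := qle _ _ p2 p1; have q42 := qle _ _ p1 p2 sep.
  have {}q24 := q24 _.
  have sep' : g < 1 - cos (y.2.2 - y.1.2) by rewrite -cosN opprB.
  have {}q24 := q24 sep'.
  have l24 : pr mu (ball L (y.2.1, y.1.2) `\` ball L (y.2.1, y.2.2)) <= 1 / 4.
    by apply: le_trans (ple _ p1); apply: pr_mono; [exact: mD|exact: mball|move=> z []].
  have l42 : pr mu (ball L (y.2.1, y.2.2) `\` ball L (y.2.1, y.1.2)) <= 1 / 4.
    by apply: le_trans (ple _ p2); apply: pr_mono; [exact: mD|exact: mball|move=> z []].
  have := @class_anticoncentration _ _ J _ (true, true, true, true) _ D24 D42 w0 w1 _ q (4 * t) q0.
  rewrite s24 s42 n1 => /(_ _ q24 q42).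
  rewrite (_ : (2 * (4 * t) + 1 = 8 * t + 1)%N); last by rewrite mulnA.
  apply; last by lra.
  by move=> [[[f1 f2] f3] f4] /andP[_ +] /andP[+ _] => /negP.
- move=> w; pose e := classes X (pairRV (X i) (X j)) J (true, true, true, true) kap w.
  have eE k : k \in J -> e k = kap (x w i, x w j) (x w k) by move=> kJ; rewrite /e ffunE kJ.
  have xj : x w j = pt (x w) j j by rewrite /pt; case: (x w j).
  have x12 : excess L (x w) i j (pt (x w) i i) (pt (x w) j i) = class_count J D12 e.
    by apply: excess_count => // k kJ; rewrite eE.
  have x34 : excess L (x w) i j (pt (x w) i j) (pt (x w) j j) = class_count J D34 e.
    by apply: excess_count => // k kJ; rewrite eE.
  have x24 : excess L (x w) i j (pt (x w) j i) (x w j) = class_count J D24 e.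
    by apply: excess_count => // k kJ; rewrite eE // xj.
  have x42 : excess L (x w) i j (x w j) (pt (x w) j i) = class_count J D42 e.
    by apply: excess_count => // k kJ; rewrite eE // xj.
  have rE : ~~ rigid_pair L (x w) t i j = Q (x w i, x w j) e.
    have bb (b1 b2 b3 : bool) : ~~ [&& b1, b2 & ~~ b3] = [|| ~~ b1, ~~ b2 | b3].
      by case: b1; case: b2; case: b3.
    by rewrite /rigid_pair x12 x34 x24 x42 /Q /Q12 /Q34 /Qa /= bb !ler_nat -!ltnNge.
  rewrite /loose_pair /mkset rE; split.
    by move=> [h1 h2 h3 [h4 h5] /andP[h6 h7]]; split=> //; split=> //; split=> //; split=> //; split=> //; split.
  by move=> [[[[[[h1 h2] h3] h4] h5] h6] h7]; split=> //; rewrite h6.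
Qed.

End bad_pairs.

(** * Probability of no inversion, for general cells *)

Section no_inversion_bound.
Context d (T : measurableType d) (R : realType) (P : probability T R) (n : nat).
Variables (alpha L : R) (F : finType) (G : {set F}) (cell : R -> F).
Variable X : 'I_n -> {RV P >-> (R * R)%type}.
Hypotheses (a12 : 1 / 2 < alpha) (L8 : 8 <= L).
Hypothesis iX : iid_with_law (node_law alpha L : set (R * R) -> \bar R) X.
Hypothesis mcell : forall c, measurable [set r | cell r = c].
Variable i0 : 'I_n.
Variables (theta b t0 Dm g : R).
Hypothesis theta1 : theta < 1.
Hypothesis b0 : 0 <= b.
Hypothesis cell_le : forall c, c \in G -> (radial_law alpha L [set r | cell r = c] <= theta%:E)%E.
Hypothesis cell_ge : forall c, c \in G -> (b%:E <= radial_law alpha L [set r | cell r = c])%E.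
Hypothesis ntheta : n%:R * theta <= 1 / 2.
Hypotheses (t04 : 4 <= t0) (t0L : t0 + 2 <= L).
Hypothesis cell_window : forall c r, c \in G -> cell r = c -> t0 <= r <= t0 + 1.
Hypothesis cell_ball_mass : forall c r s, c \in G -> cell r = c -> cell s = c ->
  r <= s -> ball_mass alpha L r - ball_mass alpha L s <= Dm.
Hypothesis Dm0 : 0 <= Dm.
Hypothesis gE : 64 * expR (1 - t0) <= g.
Hypothesis hB : 4 * ball_mass_const alpha * expR (- (t0 / 2)) <= 1.
Let x w i := X i w.
Local Notation M := (pairs_mean n G b).

Lemma cell_two_ordered (e : {ffun 'I_n -> F}) (r : 'I_n -> R) c :
  cell_two [set: 'I_n]%SET c e ->
  exists i j, [/\ i != j, e i = c, e j = c & r i <= r j].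
Proof.
move=> /cards2P[i [j [ij S]]].
have [ei ej] : e i = c /\ e j = c.
  have : i \in [set i; j]%SET by rewrite !inE eqxx.
  have : j \in [set i; j]%SET by rewrite !inE eqxx orbT.
  by rewrite -S !inE /= => /eqP -> /eqP ->.
have [h|/ltW h] := leP (r i) (r j); first by exists i, j.
by exists j, i; rewrite eq_sym.
Qed.

(** The angle law charges only [[- pi, pi]], but a random variable may leave it on a null event,
    where the arc estimates do not apply. *)
Definition angle_out i : set T := [set w | ~ (- pi <= hangle (x w i) <= pi)].

Lemma angle_out_null i : measurable (angle_out i) /\ pr P (angle_out i) = 0.
Proof.
have m1 : measurable (~` `[- pi, pi]%classic : set R) by exact: measurableC.
have mS : measurable ([set: R] `*` (~` `[- pi, pi]%classic : set R)) by exact: measurableX.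
have e : angle_out i = X i @^-1` ([set: R] `*` (~` `[- pi, pi]%classic : set R)).
  apply/seteqP; split=> w; rewrite /angle_out /preimage /mkset /setX /setC /= in_itv /=.
    by move=> h; split.
  by case.
rewrite e; split; first exact: measurable_preim.
rewrite (pr_first_law iX i0 i mS); apply/EFin_inj; rewrite -prE // (first_lawE iX) // node_lawE //.
have U0 : uniform_prob (ltNpi R) (~` `[- pi, pi]%classic) = (0 / (2 * pi))%:E.
  by apply: (@uniform_probE _ _ set0 0 m1); [rewrite setICl|rewrite measure0].
by rewrite U0 mul0r mule0.
Qed.

(** The boolean selects the kind of failure; a single finite index type turns the number of failures
    into one sum of indicators for [pr_markov]. *)
Definition bad_pair (t : nat) (p : F * 'I_n * 'I_n * bool) : set T :=
  let: (c, i, j, k) := p in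
  if (c \in G) && (i != j) then
    if k then close_pair cell X g c i j else loose_pair L cell X t g c i j
  else set0.

Let g0' : 0 <= g.
Proof. by apply: le_trans gE; rewrite mulr_ge0 ?expR_ge0. Qed.

Lemma bad_pair_le t p : measurable (bad_pair t p) /\ pr P (bad_pair t p) <=
  if (p.1.1.1 \in G) then
    (if p.2 then 2 * Num.sqrt g else rigid_error n alpha t0 Dm t) * theta ^+ 2 else 0.
Proof.
have sm0 := strip_mass_gt0 a12.
have re0 : 0 <= rigid_error n alpha t0 Dm t.
  rewrite /rigid_error addr_ge0 ?mulr_ge0 ?invr_ge0 ?sqrtr_ge0 //.
case: p => [[[c i] j] k] /=; case: (boolP (c \in G)) => [cG|cG] /=; last first.
  by split; [exact: measurable0|rewrite pr_set0].
case: (boolP (i != j)) => [ij|_]; last first.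
  split; [exact: measurable0|rewrite pr_set0].
  by case: k; rewrite mulr_ge0 ?sqr_ge0 // mulr_ge0 ?sqrtr_ge0.
case: k; first exact: (close_pair_le iX mcell i0 cell_le).
exact: (loose_pair_le a12 L8 iX mcell i0 cell_le t04 t0L cell_window cell_ball_mass).
Qed.

(** Four exceptional events: at most [M / 2] cells with two nodes, at least [M / 4] bad pairs, more
    than [t] nodes in the window, an angle out of range. Outside them at least [M / 4 >= g0] cells
    are good. *)
Lemma no_inversion_bound (t g0 : nat) : 0 < M -> (g0 <= #|F|)%N -> g0%:R <= M / 4 ->
  pr P [set w | no_inversion G L (cells cell (x w)) (x w)] <=
   (4 / M + 4 * (((1 - theta)^-1) ^+ 4 - 1))
   + 4 / M * (#|G|%:R * n%:R ^+ 2 * theta ^+ 2 * (2 * Num.sqrt g + rigid_error n alpha t0 Dm t))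
   + n%:R * (#|G|%:R * theta) / t.+1%:R + 2^-1 ^+ g0.
Proof.
move=> M0 gF gM.
have [mB1 pB1] := few_pairs_le iX mcell i0 theta1 b0 cell_le cell_ge ntheta M0.
set B1 := [set w | _] in mB1 pB1.
pose B2 := [set w | M / 4 <= \sum_p \1_(bad_pair t p) w].
have mB2 : measurable B2.
  apply: measurable_le_set => //; apply: measurable_sum_indic => p.
  by have [] := bad_pair_le t p.
pose I3 (q : 'I_n * F) : set T :=
  if q.2 \in G then X q.1 @^-1` [set z : R * R | cell (hradius z) = q.2] else set0.
have mI3 q : measurable (I3 q).
  by rewrite /I3; case: ifP => // _; apply: measurable_preim; exact: measurable_cell_radius.
pose B3 := [set w | t.+1%:R <= \sum_q \1_(I3 q) w :> R].
have mB3 : measurable B3.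
  by apply: measurable_le_set => //; exact: measurable_sum_indic.
pose B4 := [set w | exists i, angle_out i w].
have mB4 : measurable B4.
  rewrite (_ : B4 = \bigcup_(i in [set: 'I_n]) angle_out i).
    by apply: fin_bigcup_measurable => // i _; have [] := angle_out_null i.
  by apply/seteqP; split=> w; [move=> [i h]; exists i|move=> [i _ h]; exists i].
have pB2 : pr P B2 <= 4 / M * (#|G|%:R * n%:R ^+ 2 * theta ^+ 2 * (2 * Num.sqrt g + rigid_error n alpha t0 Dm t)).
  have mE p : measurable (bad_pair t p) by have [] := bad_pair_le t p.
  have M40 : 0 <= M / 4 by rewrite divr_ge0 // ltW.
  have := pr_markov P mE mB2 M40 (fun w h => h).
  have -> : 4 / M = (M / 4)^-1 by rewrite invf_div.
  rewrite -(ler_pdivlMl _ _ (_ : 0 < M / 4)) ?divr_gt0 // => /le_trans; apply.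
  rewrite ler_wpM2l ?invr_ge0 //.
  pose s c := if c \in G then (2 * Num.sqrt g + rigid_error n alpha t0 Dm t) * theta ^+ 2 else 0.
  pose h c (k : bool) := if c \in G then (if k then 2 * Num.sqrt g else rigid_error n alpha t0 Dm t) * theta ^+ 2 else 0.
  apply: (@le_trans _ _ (\sum_p h p.1.1.1 p.2)).
    by apply: ler_sum => p _; have [] := bad_pair_le t p.
  rewrite -(pair_bigA _ (fun q k => h q.1.1 k)) /=.
  rewrite (eq_bigr (fun q => s q.1.1)); last first.
    by move=> q _; rewrite big_bool /s /h /=; case: ifP => _; [exact: (esym (mulrDl _ _ _))|exact: addr0].
  rewrite -(pair_bigA _ (fun q (j : 'I_n) => s q.1)) /=.
  rewrite (eq_bigr (fun q => n%:R * s q.1)); last first.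
    by move=> q _; rewrite sumr_const card_ord mulr_natl.
  rewrite -(pair_bigA _ (fun c (j : 'I_n) => n%:R * s c)) /=.
  rewrite (eq_bigr (fun c => n%:R ^+ 2 * s c)); last first.
    by move=> c _; rewrite sumr_const card_ord -[LHS]mulr_natl expr2 mulrA.
  rewrite -mulr_sumr -big_mkcond /= sumr_const -[X in _ * X <= _]mulr_natl.
  by rewrite le_eqVlt; apply/orP; left; apply/eqP; ring.
have pB3 : pr P B3 <= n%:R * (#|G|%:R * theta) / t.+1%:R.
  have t1 : 0 < t.+1%:R :> R by rewrite ltr0n.
  rewrite ler_pdivlMr // mulrC; apply: le_trans (pr_markov P mI3 mB3 (ltW t1) (fun w h => h)) _.
  apply: (@le_trans _ _ (\sum_(q : 'I_n * F) (if q.2 \in G then theta else 0))).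
    apply: ler_sum => q _; rewrite /I3; case: ifPn => qG; last by rewrite pr_set0.
    have mq := measurable_cell_radius mcell q.2.
    rewrite (pr_first_law iX i0 q.1 mq); exact: (pr_cell_le iX mcell i0 cell_le).
  rewrite -(pair_bigA _ (fun (k : 'I_n) c => if c \in G then theta else 0)) /=.
  by rewrite sumr_const card_ord -big_mkcond /= sumr_const !mulr_natl.
have pB4 : pr P B4 = 0.
  apply/le_anti; rewrite pr_ge0 andbT.
  have mO i : measurable (angle_out i) by have [] := angle_out_null i.
  apply: le_trans (pr_sum_le P mO mB4 (fun w h => h)) _.
  by rewrite big1 // => i _; have [] := angle_out_null i.
pose B := B1 `|` B2 `|` B3 `|` B4.
have mB : measurable B by do !apply: measurableU.
have pB : pr P B <= pr P B1 + pr P B2 + pr P B3.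
  have m12 := measurableU _ _ mB1 mB2; have m123 := measurableU _ _ m12 mB3.
  have := prU2 P mB m123 mB4 (fun w h => h); rewrite pB4 addr0 => /le_trans; apply.
  apply: le_trans (prU2 P m123 m12 mB3 (fun w h => h)) _; rewrite lerD2r.
  exact: (prU2 P m12 mB1 mB2 (fun w h => h)).
apply: le_trans (no_inversion_le (t := t) iX mcell mB gF _) _; last first.
  by rewrite lerD2r; apply: le_trans pB _; apply: lerD => //; apply: lerD.
move=> w nB.
have [nB1 nB2 nB3 nB4] : [/\ ~ B1 w, ~ B2 w, ~ B3 w & ~ B4 w].
  by split=> h; apply: nB; [left; left; left|left; left; right|left; right|right].
have W : #|in_cells G (cells cell (x w))|%:R <= \sum_q \1_(I3 q) w :> R.
  rewrite -sum1_card natr_sum big_mkcond /=.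
  rewrite (eq_bigr (fun q : 'I_n * F => \1_(I3 (q.1, q.2)) w)); last by case.
  rewrite -(pair_bigA _ (fun (k : 'I_n) c => \1_(I3 (k, c)) w)) /=.
  apply: ler_sum => k _; rewrite (bigD1 (cell (hradius (x w k)))) //=.
  rewrite !inE ffunE; case: ifPn => kG; last by rewrite addr_ge0 ?sumr_ge0.
  rewrite {1}/I3 /= kG indicE mem_set // lerDl; exact: sumr_ge0.
split.
  rewrite -ltnS -(ltr_nat R); apply: le_lt_trans W _.
  by rewrite ltNge; apply/negP.
(* A cell with exactly two nodes is good or carries a bad pair, indexed with the node of smaller
   radius first. *)
have two : (two_cells [set: 'I_n]%SET G (cells cell (x w)))%:R <=
    #|[set c | good_cell G L (cells cell (x w)) (x w) t c]%SET|%:R + \sum_p \1_(bad_pair t p) w :> R.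
  rewrite /two_cells -!sum1_card !natr_sum big_mkcond [X in _ <= X + _]big_mkcond /=.
  rewrite (eq_bigr (fun p => \1_(bad_pair t (p.1.1.1, p.1.1.2, p.1.2, p.2)) w)); last by case=> [[[]]].
  rewrite -(pair_bigA _ (fun q (k : bool) => \1_(bad_pair t (q.1.1, q.1.2, q.2, k)) w)) /=.
  rewrite -(pair_bigA _ (fun q j => \sum_(k : bool) \1_(bad_pair t (q.1, q.2, j, k)) w)) /=.
  rewrite -(pair_bigA _ (fun c i => \sum_j \sum_(k : bool) \1_(bad_pair t (c, i, j, k)) w)) /=.
  rewrite -big_split /=; apply: ler_sum => c _.
  have ind0 i j k : 0 <= \1_(bad_pair t (c, i, j, k)) w :> R by rewrite indicE.
  have s0 : 0 <= \sum_i \sum_j \sum_(k : bool) \1_(bad_pair t (c, i, j, k)) w :> R.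
    by do 3 (apply: sumr_ge0 => ? _).
  rewrite !inE; case: (boolP (good_cell _ _ _ _ _ _)) => gc.
    by case: ifP => _; rewrite ?lerDl // addr_ge0.
  rewrite add0r; case: ifPn => [/andP[cG two]|_ //].
  have [i [j [ij ei ej rij]]] := cell_two_ordered (fun i => hradius (x w i)) two.
  have ci : cell (hradius (x w i)) = c by rewrite -ei ffunE.
  have cj : cell (hradius (x w j)) = c by rewrite -ej ffunE.
  have pin k : - pi <= hangle (x w k) <= pi.
    by apply: contra_notT nB4 => /negP h; exists k.
  suff [k hk] : exists k, bad_pair t (c, i, j, k) w.
    rewrite (bigD1 i) //= (bigD1 j) //= (bigD1 k) //= -!addrA indicE mem_set //.
    by rewrite lerDl !addr_ge0 //; do ?(apply: sumr_ge0 => ? _).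
  pose cl := (1 - cos (hangle (x w i) - hangle (x w j)) <= g) || (hradius (x w i) == hradius (x w j)).
  have [hcl|] := boolP cl; first by exists true; rewrite /bad_pair cG ij; split; [exact: ci|exact: cj|exact: pin|exact: hcl].
  rewrite /cl negb_or -ltNge => /andP[hg hr].
  exists false; rewrite /bad_pair cG ij; split; [exact: ci|exact: cj|exact: rij|split; exact: pin|].
  rewrite hg /=.
  apply: contra gc => rig; rewrite /good_cell cG two /=.
  apply/existsP; exists i; apply/existsP; exists j.
  by rewrite ij ei ej !eqxx /= rig andbT lt_neqAle hr.
rewrite -(ler_nat R).
have h1 : M / 2 < (two_cells [set: 'I_n]%SET G (cells cell (x w)))%:R by rewrite ltNge; apply/negP.
have h2 : \sum_p \1_(bad_pair t p) w < M / 4 by rewrite ltNge; apply/negP.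
apply: le_trans gM _.
lra.
Qed.

End no_inversion_bound.

(** * Cutting a window of radii into cells *)

Section window_cells.
Context (R : realType) (alpha L t0 : R) (N : nat).
Hypotheses (a12 : 1 / 2 < alpha) (L8 : 8 <= L) (N0 : (0 < N)%N).
Hypotheses (t04 : 4 <= t0) (t0L : t0 + 2 <= L).
Let a0 : 0 < alpha. Proof. by move: a12; lra. Qed.
Let L0 : 0 < L. Proof. by move: L8; lra. Qed.
Let at0 : 1 <= alpha * t0. Proof. by move: a12 t04; nra. Qed.
Let t1L : t0 + 1 <= L. Proof. by move: t0L; lra. Qed.
Let NR : 0 < N%:R :> R. Proof. by rewrite ltr0n. Qed.

Definition cell_start (c : nat) : R := t0 + c%:R / N%:R.

(** [None] collects the radii outside the window, so that cells partition the line. *)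
Definition window_cell (r : R) : option 'I_N :=
  [pick c : 'I_N | cell_start c <= r < cell_start c.+1].

Lemma cell_start_mono (c c' : nat) : (c <= c')%N -> cell_start c <= cell_start c'.
Proof. by move=> cc; rewrite /cell_start lerD2l ler_pM2r ?invr_gt0 // ler_nat. Qed.

Lemma cell_start0 : cell_start 0 = t0.
Proof. by rewrite /cell_start mul0r addr0. Qed.

Lemma cell_startN : cell_start N = t0 + 1.
Proof. by rewrite /cell_start divff // gt_eqF. Qed.

Lemma cell_startS (c : nat) : cell_start c.+1 - cell_start c = N%:R^-1.
Proof. by rewrite /cell_start -natr1; field; rewrite gt_eqF. Qed.

Lemma cell_start_bounds (c : 'I_N) : t0 <= cell_start c /\ cell_start c.+1 <= t0 + 1.
Proof.
by split; [rewrite -cell_start0|rewrite -cell_startN]; apply: cell_start_mono.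
Qed.

Lemma window_cellP r c : window_cell r = Some c <-> cell_start c <= r < cell_start c.+1.
Proof.
rewrite /window_cell; case: pickP => [c'|] h; last by split=> //; rewrite h.
split=> [[<-]//|hc]; congr Some; apply/val_inj => /=.
move: h hc => /andP[h1 h2] /andP[h3 h4].
have lt1 : (c' < c.+1)%N.
  by rewrite ltnNge; apply/negP => /cell_start_mono; rewrite leNgt (le_lt_trans h1 h4).
have lt2 : (c < c'.+1)%N.
  by rewrite ltnNge; apply/negP => /cell_start_mono; rewrite leNgt (le_lt_trans h3 h2).
by apply/eqP; rewrite eqn_leq -ltnS lt1 -ltnS lt2.
Qed.

Lemma window_cell_itv (c : 'I_N) :
  [set r | window_cell r = Some c] = `[cell_start c, cell_start c.+1[%classic.
Proof. by apply/seteqP; split=> r /=; rewrite in_itv /= => /window_cellP. Qed.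

Lemma measurable_window_cell o : measurable [set r | window_cell r = o].
Proof.
have m (c : 'I_N) : measurable [set r | window_cell r = Some c].
  by rewrite window_cell_itv; exact: measurable_itv.
case: o => [c|] //.
rewrite (_ : mkset _ = ~` \bigcup_(c in [set: 'I_N]) [set r | window_cell r = Some c]).
  by apply: measurableC; apply: fin_bigcup_measurable.
apply/seteqP; split=> r /=; first by move=> h [c _ /=]; rewrite h.
by case e: window_cell => [c|] // h; exfalso; apply: h; exists c.
Qed.

Lemma radial_cell_le (c : 'I_N) : (radial_law alpha L [set r | window_cell r = Some c]
  <= (2 * alpha / N%:R * expR (- (alpha * (L - t0 - 1))))%:E)%E.
Proof.
have [h1 h2] := cell_start_bounds c; have h3 := cell_start_mono (leqnSn c).
have s0 : 0 <= cell_start c by apply: le_trans h1; apply: le_trans t04.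
have sL : cell_start c.+1 <= L by exact: le_trans h2 t1L.
rewrite window_cell_itv; have [-> e] := radial_itv a0 L0 s0 h3 sL; rewrite -e.
apply: le_trans (radial_le a12 L8 s0 h3 sL) _.
rewrite cell_startS lee_fin; apply: ler_wpM2l.
  by rewrite mulr_ge0 ?invr_ge0 // mulr_ge0 // ltW.
rewrite ler_expR lerN2; apply: ler_wpM2l; first exact: ltW.
by rewrite -addrA -opprD lerD2l lerN2.
Qed.

Lemma radial_cell_ge (c : 'I_N) :
  ((alpha / (4 * N%:R) * expR (- (alpha * (L - t0))))%:E <=
   radial_law alpha L [set r | window_cell r = Some c])%E.
Proof.
have [h1 h2] := cell_start_bounds c; have h3 := cell_start_mono (leqnSn c).
have s0 : 0 <= cell_start c by apply: le_trans h1; apply: le_trans t04.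
have sL : cell_start c.+1 <= L by exact: le_trans h2 t1L.
have s1 : 1 <= alpha * cell_start c by apply: (le_trans at0); rewrite ler_wpM2l // ltW.
rewrite window_cell_itv; apply: le_trans (radial_ge a12 L8 s1 s0 h3 sL).
rewrite cell_startS lee_fin invfM mulrA; apply: ler_wpM2l.
  by rewrite mulr_ge0 ?invr_ge0 // mulr_ge0 // ltW.
rewrite ler_expR lerN2; apply: ler_wpM2l; first exact: ltW.
by rewrite lerD2l lerN2.
Qed.

(** Over the whole window the ball mass drops by at most its value at [t0]. Cells where it drops by
    more than twice the resulting average are left out, so that two radii of a kept cell have nearly
    equal mean degrees. *)
Definition flat_cells : {set 'I_N} :=
  [set c : 'I_N | ball_mass alpha L (cell_start c) - ball_mass alpha L (cell_start c.+1)
    <= 2 / N%:R * ball_mass alpha L t0]%SET.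

Definition used_cells : {set option 'I_N} := (Some @: flat_cells)%SET.

Lemma card_used_cells_le : (#|used_cells| <= N)%N.
Proof.
rewrite card_imset; last by move=> ? ? [].
by apply: leq_trans (max_card _) _; rewrite card_ord.
Qed.

(** The drops telescope, and by Markov's inequality at most half of them exceed twice the
    average. *)
Lemma card_used_cells_ge : N%:R / 2 <= #|used_cells|%:R :> R.
Proof.
rewrite card_imset; last by move=> ? ? [].
have b0 : 0 < ball_mass alpha L t0.
  apply: lt_le_trans (ball_mass_ge a12 L8 t04 _); last exact: t1L.
  apply: mulr_gt0 (expR_gt0 _); apply: divr_gt0; [exact: strip_mass_gt0|by rewrite ltr0n].
pose D (c : nat) := ball_mass alpha L (cell_start c) - ball_mass alpha L (cell_start c.+1).
have D0 (c : 'I_N) : 0 <= D c.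
  have [h1 h2] := cell_start_bounds c; have h3 := cell_start_mono (leqnSn c).
  rewrite subr_ge0; apply: (ball_mass_homo a12 L8 _ h3); first exact: le_trans h1.
  by exact: le_trans h2 t1L.
have sumD : \sum_(c < N) D c <= ball_mass alpha L t0.
  rewrite -(big_mkord xpredT D) -[leLHS]opprK -sumrN.
  rewrite (eq_bigr (fun c => ball_mass alpha L (cell_start c.+1) - ball_mass alpha L (cell_start c))); last first.
    by move=> c _; rewrite /D opprB.
  rewrite telescope_sumr // opprB cell_start0 gerBl; exact: ball_mass_ge0.
have : 2 / N%:R * ball_mass alpha L t0 * #|~: flat_cells|%:R <= \sum_(c < N) D c.
  apply: (@le_trans _ _ (\sum_(c in ~: flat_cells) D c)).
    rewrite -sum1_card natr_sum mulr_sumr; apply: ler_sum => c.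
    by rewrite !inE -ltNge mulr1 => /ltW.
  rewrite [leRHS](bigID (mem (~: flat_cells)%SET)) /= lerDl.
  by apply: sumr_ge0 => c _; exact: D0.
move=> /le_trans/(_ sumD); rewrite mulrAC -[leRHS]mul1r ler_pM2r //.
have cE : (#|flat_cells| + #|~: flat_cells| = N)%N by rewrite cardsC card_ord.
have cR : #|flat_cells|%:R + #|~: flat_cells|%:R = N%:R :> R by rewrite -natrD cE.
rewrite mulrAC ler_pdivrMr // mul1r; lra.
Qed.

Lemma used_cell_window c r : c \in used_cells -> window_cell r = c -> t0 <= r <= t0 + 1.
Proof.
move=> /imsetP[c' _ ->] /window_cellP/andP[h1 h2].
have [h3 h4] := cell_start_bounds c'.
by rewrite (le_trans h3 h1) (le_trans (ltW h2) h4).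
Qed.

Lemma used_cell_window_lt c r : c \in used_cells -> window_cell r = c -> t0 <= r < t0 + 1.
Proof.
move=> /imsetP[c' _ ->] /window_cellP/andP[h1 h2].
have [h3 h4] := cell_start_bounds c'.
by rewrite (le_trans h3 h1) (lt_le_trans h2 h4).
Qed.

Lemma used_cell_ball_mass c r s : c \in used_cells -> window_cell r = c ->
  window_cell s = c -> r <= s ->
  ball_mass alpha L r - ball_mass alpha L s <= 2 / N%:R * ball_mass alpha L t0.
Proof.
move=> /imsetP[c' + ->]; rewrite inE => hc /window_cellP/andP[r1 r2] /window_cellP/andP[s1 s2] rs.
have [h3 h4] := cell_start_bounds c'.
have hL : cell_start c'.+1 <= L by exact: le_trans h4 t1L.
apply: le_trans hc; apply: lerB.
  apply: (ball_mass_homo a12 L8 _ r1); first exact: le_trans h3.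
  exact: le_trans (ltW r2) hL.
apply: (ball_mass_homo a12 L8 _ (ltW s2) hL).
by apply: (le_trans t04); apply: (le_trans h3).
Qed.

End window_cells.

Lemma leq_double_pred (n : nat) : (1 < n)%N -> (n <= 2 * n.-1)%N.
Proof. by case: n => // n; lia. Qed.

Section window_inversion.
Context d (T : measurableType d) (R : realType) (P : probability T R) (n : nat).
Variables (alpha L t0 : R) (N t g0 : nat).
Variable X : 'I_n -> {RV P >-> (R * R)%type}.
Hypotheses (a12 : 1 / 2 < alpha) (L8 : 8 <= L) (N0 : (0 < N)%N) (n2 : (1 < n)%N).
Hypotheses (t04 : 4 <= t0) (t0L : t0 + 2 <= L).
Hypothesis iX : iid_with_law (node_law alpha L : set (R * R) -> \bar R) X.

(* Orders of magnitude of the number of nodes of radius less than [t0], and of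
   the degree of a node of radius [t0]. *)
Definition window_count : R := n%:R * expR (- (alpha * (L - t0))).
Definition window_degree : R := n%:R * expR (- (t0 / 2)).
Local Notation K := window_count.
Local Notation D0 := window_degree.

(** A quarter of the lower bound on [pairs_mean] obtained from [N / 2] cells of mass at least
    [b]. *)
Definition window_pairs : R := alpha ^+ 2 * K ^+ 2 / (1024 * N%:R).

(** In order: scarcity of cells with two nodes, their correlation, bad pairs (close angles, unequal
    radii, lack of spread of the degree difference), an overcrowded window, and the fraction of
    states without inversion. *)
Definition window_error : R :=
  window_pairs^-1 + 60 / n%:R
  + 2048 * expR (2 * alpha) * (32 * expR (- (t0 / 2))
      + (4 * ball_mass_const alpha * D0 / (N%:R * t.+1%:R)
         + (8 * t + 1)%:R / Num.sqrt (strip_mass alpha / 24 * D0)))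
  + 2 * alpha * expR alpha * K / t.+1%:R + 2^-1 ^+ g0.

Let a0 : 0 < alpha. Proof. by move: a12; lra. Qed.
Let nR : 0 < n%:R :> R. Proof. by rewrite ltr0n (ltnW n2). Qed.
Let NR : 0 < N%:R :> R. Proof. by rewrite ltr0n. Qed.
Let tR : 0 < t.+1%:R :> R. Proof. by rewrite ltr0n. Qed.
Let K0 : 0 < K. Proof. by rewrite mulr_gt0 ?expR_gt0. Qed.
Let D00 : 0 < D0. Proof. by rewrite mulr_gt0 ?expR_gt0. Qed.
Let pairs0 : 0 < window_pairs.
Proof.
apply: divr_gt0; first by rewrite mulr_gt0 // exprn_gt0.
by apply: mulr_gt0 NR; rewrite ltr0n.
Qed.

Let theta : R := 2 * alpha / N%:R * expR (- (alpha * (L - t0 - 1))).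
Let b : R := alpha / (4 * N%:R) * expR (- (alpha * (L - t0))).

Let thetaE : theta = 8 * expR alpha * b.
Proof.
rewrite /theta /b (_ : - (alpha * (L - t0 - 1)) = alpha + - (alpha * (L - t0))); last by ring.
by rewrite expRD; field; rewrite gt_eqF.
Qed.

Let b0 : 0 < b. Proof. by rewrite mulr_gt0 ?expR_gt0 // divr_gt0 // mulr_gt0. Qed.

Let nb : n%:R * b = alpha * K / (4 * N%:R).
Proof. by rewrite /b /window_count; field; rewrite gt_eqF. Qed.

Let ntheta : n%:R * theta = 2 * alpha * expR alpha * K / N%:R.
Proof.
rewrite thetaE (_ : n%:R * _ = 8 * expR alpha * (n%:R * b)); last by ring.
by rewrite nb; field; rewrite gt_eqF.
Qed.

Let bin_ge : n%:R ^+ 2 / 4 <= 'C(n, 2)%:R :> R.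
Proof.
have h : (n ^ 2 <= 4 * 'C(n, 2))%N.
  have e : ('C(n, 2) * 2 = n * n.-1)%N by have := bin_ffact n 2; rewrite ffactnS ffactn1.
  have n1 : (n <= 2 * n.-1)%N by exact: leq_double_pred.
  rewrite -[4%N]/(2 * 2)%N -mulnA [(2 * 'C(n, 2))%N]mulnC e mulnCA -mulnn leq_mul2l n1 orbT.
  by [].
by rewrite ler_pdivrMr // -natrX -natrM ler_nat mulnC.
Qed.

(** Meant for [y = theta <= 1 / (2 n)], which gives the term [60 / n]. *)
Let inv4 (y : R) : 0 <= y <= 1 / 4 -> 4 * (((1 - y)^-1) ^+ 4 - 1) <= 120 * y.
Proof.
move=> /andP[y0 y4].
have h : (1 - y)^-1 <= 1 + 2 * y.
  rewrite -[leLHS]mul1r ler_pdivrMr; last by lra.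
  nra.
have h0 : 0 <= (1 - y)^-1 by rewrite invr_ge0; lra.
have : ((1 - y)^-1) ^+ 4 <= (1 + 2 * y) ^+ 4 by rewrite lerXn2r ?nnegrE //; lra.
have -> : (1 + 2 * y) ^+ 4 = 1 + y * (8 + y * (24 + y * (32 + 16 * y))) by ring.
have y1 : y * (32 + 16 * y) <= 9 by nra.
have y2 : y * (24 + y * (32 + 16 * y)) <= 22 by nra.
nra.
Qed.

(** [B] is the absence of inversions inside used cells, so outside it the claim is a mere negation;
    the work is to express each term of [no_inversion_bound] through [K] and the degree [D0]. *)
Lemma window_inversion : 2 * alpha * expR alpha * K / N%:R <= 1 / 2 ->
  4 * ball_mass_const alpha * expR (- (t0 / 2)) <= 1 ->
  (g0 <= N)%N -> g0%:R <= window_pairs ->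
  exists B : set T, [/\ measurable B, pr P B <= window_error &
    forall w, ~ B w -> exists i j, [/\ t0 <= hradius (X i w),
      hradius (X i w) < hradius (X j w), hradius (X j w) < t0 + 1 &
      (degree L (fun k => X k w) i < degree L (fun k => X k w) j)%N]].
Proof.
move=> hKN hB gN gp.
have i0 : 'I_n by exact: Ordinal (ltnW n2).
pose cell := @window_cell R t0 N; pose G := used_cells alpha L t0 N.
pose x w (k : 'I_n) := X k w.
have mcell := @measurable_window_cell R t0 N N0.
exists [set w | no_inversion G L (cells cell (x w)) (x w)]; split; last 1 first.
- move=> w /negP; rewrite negb_forall => /existsP[i]; rewrite negb_forall => /existsP[j].
  rewrite negb_imply -ltnNge => /andP[/andP[/andP[/eqP eij eG] rij] dij].
  exists i, j; split=> //.
    have [/andP[]] : t0 <= hradius (x w i) < t0 + 1 /\ True.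
      by split=> //; apply: (used_cell_window_lt N0 eG); rewrite ffunE.
    by [].
  have eG' : cells cell (x w) j \in G by rewrite -eij.
  have /andP[] // : t0 <= hradius (x w j) < t0 + 1.
  by apply: (used_cell_window_lt N0 eG'); rewrite ffunE.
- apply: (measurable_fin_partition (f := fun w => cells cell (x w))
    (Q := fun e => [set w | no_inversion G L e (x w)])) => e.
  apply: measurableI; first exact: measurable_cells.
  exact: measurable_no_inversion.
have nth : n%:R * theta <= 1 / 2 by rewrite ntheta.
have th0 : 0 < theta by rewrite thetaE; apply: mulr_gt0 b0; exact: mulr_gt0 (expR_gt0 _).
have n2R : 2 <= n%:R :> R by rewrite (ler_nat _ 2 n).
have th4 : theta <= 1 / 4 by move: nth n2R th0; nra.
have th1 : theta < 1 by apply: le_lt_trans th4 _; lra.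
have cle c : c \in G -> (radial_law alpha L [set r | cell r = c] <= theta%:E)%E.
  by move=> /imsetP[c' _ ->]; exact: radial_cell_le.
have cge c : c \in G -> (b%:E <= radial_law alpha L [set r | cell r = c])%E.
  by move=> /imsetP[c' _ ->]; exact: radial_cell_ge.
have win c r : c \in G -> cell r = c -> t0 <= r <= t0 + 1 by exact: used_cell_window.
pose Dm := 2 / N%:R * ball_mass alpha L t0.
have bm c r s : c \in G -> cell r = c -> cell s = c -> r <= s ->
    ball_mass alpha L r - ball_mass alpha L s <= Dm.
  exact: used_cell_ball_mass.
have Dm0 : 0 <= Dm by rewrite mulr_ge0 ?divr_ge0 // ball_mass_ge0.
have G1 : N%:R / 2 <= #|G|%:R :> R by exact: card_used_cells_ge.
have G2 : #|G|%:R <= N%:R :> R by rewrite ler_nat; exact: card_used_cells_le.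
pose M := pairs_mean n G b.
have Mge : 4 * window_pairs <= M.
  have -> : 4 * window_pairs = N%:R / 2 * (n%:R ^+ 2 / 4 * b ^+ 2 / 2).
    rewrite (_ : n%:R ^+ 2 / 4 * b ^+ 2 / 2 = (n%:R * b) ^+ 2 / 8); last by field.
    by rewrite nb /window_pairs; field; rewrite gt_eqF.
  apply: ler_pM => //; rewrite ?divr_ge0 ?mulr_ge0 ?sqr_ge0 //; try exact: ltW.
  by rewrite ler_pM2r ?invr_gt0 // ler_pM2r // exprn_gt0.
have M0 : 0 < M by apply: lt_le_trans Mge; rewrite mulr_gt0.
have gF : (g0 <= #|{: option 'I_N}|)%N.
  by apply: (leq_trans gN); rewrite card_option card_ord.
have gM : g0%:R <= M / 4 by lra.
apply: le_trans (no_inversion_bound a12 L8 iX mcell i0 th1 (ltW b0) cle cge nth t04 t0L win bm Dm0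
  (lexx _) hB t M0 gF gM) _.
have T1 : 4 / pairs_mean n G b <= window_pairs^-1.
  rewrite ler_pdivrMr // mulrC ler_pdivlMr //; exact: Mge.
have T2 : 4 * (((1 - theta)^-1) ^+ 4 - 1) <= 60 / n%:R.
  apply: le_trans (inv4 _) _; first by rewrite ltW.
  by rewrite ler_pdivlMr //; lra.
have T4 : n%:R * (#|G|%:R * theta) / t.+1%:R <= 2 * alpha * expR alpha * K / t.+1%:R.
  apply: ler_wpM2r; first by rewrite invr_ge0 ltW.
  apply: (@le_trans _ _ (N%:R * (n%:R * theta))).
    by rewrite mulrCA; apply: ler_wpM2r G2; rewrite ltW // mulr_gt0.
  by rewrite ntheta [X in X <= _](_ : _ = 2 * alpha * expR alpha * K) //; field; rewrite gt_eqF.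
have sq : Num.sqrt (64 * expR (1 - t0)) <= 16 * expR (- (t0 / 2)).
  have e1 : expR (1 / 2) <= 2 :> R.
    have := expR_le_quadratic (lexx (1 / 2 : R)); lra.
  have -> : 64 * expR (1 - t0) = (8 * (expR (1 / 2) * expR (- (t0 / 2)))) ^+ 2.
    rewrite exprMn -expRD -expRM_natl; congr (_ * expR _); [by ring|by field].
  rewrite sqrtr_sqr ger0_norm; last by rewrite !mulr_ge0 ?expR_ge0.
  have := expR_gt0 (- (t0 / 2)); nra.
have t00 : 0 < t0 by apply: lt_le_trans t04.
have t0L' : t0 <= L by move: t0L; lra.
have bmt := ball_mass_le a12 L8 t00 t0L'.
have R1 : 2 * (n%:R * Dm / t.+1%:R) <= 4 * ball_mass_const alpha * D0 / (N%:R * t.+1%:R).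
  rewrite invfM (_ : 2 * _ = 4 * (n%:R * ball_mass alpha L t0) * (N%:R^-1 * t.+1%:R^-1)); last first.
    by rewrite /Dm; ring.
  apply: ler_wpM2r; first by apply: mulr_ge0; rewrite invr_ge0 ltW.
  rewrite -[leRHS]mulrA; apply: ler_wpM2l => //.
  by rewrite /window_degree mulrCA; apply: ler_wpM2l => //; exact: ltW.
have sm0 := strip_mass_gt0 a12.
pose q := strip_mass alpha / 24 * expR (- ((t0 + 1) / 2)).
have R2 : (8 * t + 1)%:R / Num.sqrt ((n - 1)%:R * (4 * q)) <=
    (8 * t + 1)%:R / Num.sqrt (strip_mass alpha / 24 * D0).
  have dpos : 0 < strip_mass alpha / 24 * D0 by rewrite mulr_gt0 // divr_gt0.
  have dle : strip_mass alpha / 24 * D0 <= (n - 1)%:R * (4 * q).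
    have e1 : 1 / 2 <= expR (- (1 / 2)) :> R.
      by have := expR_ge1Dx (- (1 / 2) : R); lra.
    have n1 : n%:R / 2 <= (n - 1)%:R :> R by rewrite natrB ?(ltnW n2) //; lra.
    rewrite /q (_ : - ((t0 + 1) / 2) = - (t0 / 2) + - (1 / 2)); last by field.
    rewrite expRD /window_degree.
    rewrite (_ : strip_mass alpha / 24 * (n%:R * expR (- (t0 / 2))) =
      n%:R / 2 * (4 * (strip_mass alpha / 24 * (expR (- (t0 / 2)) * (1 / 2))))); last by field.
    have ep := expR_gt0 (- (t0 / 2)).
    have s24 : 0 <= strip_mass alpha / 24 by rewrite divr_ge0 ?ler0n // ltW.
    apply: ler_pM; [by rewrite divr_ge0 ?ler0n| |exact: n1|].
      by apply: mulr_ge0 => //; apply: mulr_ge0.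
    apply: ler_wpM2l; first exact: ler0n.
    apply: ler_wpM2l => //.
    by apply: ler_wpM2l => //; exact: ltW.
  apply: ler_wpM2l => //; rewrite lef_pV2 ?posrE ?sqrtr_gt0 //; last exact: lt_le_trans dle.
  exact: ler_wsqrtr.
pose S' := 32 * expR (- (t0 / 2)) + (4 * ball_mass_const alpha * D0 / (N%:R * t.+1%:R)
         + (8 * t + 1)%:R / Num.sqrt (strip_mass alpha / 24 * D0)).
have SS : 2 * Num.sqrt (64 * expR (1 - t0)) + rigid_error n alpha t0 Dm t <= S'.
  by rewrite /S' /rigid_error; apply: lerD; [lra|exact: lerD].
have S0 : 0 <= 2 * Num.sqrt (64 * expR (1 - t0)) + rigid_error n alpha t0 Dm t.
  apply: addr_ge0; first by rewrite mulr_ge0 ?ler0n ?sqrtr_ge0.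
  rewrite /rigid_error; apply: addr_ge0.
    by rewrite mulr_ge0 ?ler0n // divr_ge0 ?ler0n // mulr_ge0 ?ler0n.
  by rewrite divr_ge0 ?ler0n ?sqrtr_ge0.
(* [theta] and [b] differ by the factor [8 exp alpha], so the mean number of pairs in a common cell
   is comparable with [M], and bad pairs enter only through their conditional probability. *)
have T3 : 4 / M * (#|G|%:R * n%:R ^+ 2 * theta ^+ 2) <= 2048 * expR (2 * alpha).
  rewrite mulrAC ler_pdivrMr // /M /pairs_mean thetaE.
  have -> : expR (2 * alpha) = expR alpha ^+ 2 by rewrite -expRM_natl.
  have -> : 4 * (#|G|%:R * n%:R ^+ 2 * (8 * expR alpha * b) ^+ 2) =
    (1024 * expR alpha ^+ 2 * #|G|%:R * b ^+ 2) * (n%:R ^+ 2 / 4) by field.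
  have -> : 2048 * expR alpha ^+ 2 * (#|G|%:R * ('C(n, 2)%:R * b ^+ 2 / 2)) =
    (1024 * expR alpha ^+ 2 * #|G|%:R * b ^+ 2) * 'C(n, 2)%:R by field.
  apply: ler_wpM2l bin_ge; apply: mulr_ge0; last exact: sqr_ge0.
  by apply: mulr_ge0; [apply: mulr_ge0; [exact: ler0n|exact: sqr_ge0]|exact: ler0n].
rewrite /window_error -!/S'; apply: lerD => //; apply: lerD => //; apply: lerD.
  exact: lerD.
rewrite mulrA; apply: ler_pM => //.
apply: mulr_ge0; first by rewrite divr_ge0 ?ler0n // ltW.
by rewrite mulr_ge0 ?sqr_ge0 // mulr_ge0 ?ler0n ?sqr_ge0.
Qed.

End window_inversion.

(** * Order of the top degrees *)

Section degree_order.
Context d (T : measurableType d) (R : realType) (P : probability T R) (n : nat).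
Variables (alpha L : R).
Variable X : 'I_n -> {RV P >-> (R * R)%type}.
Hypotheses (a12 : 1 / 2 < alpha) (L8 : 8 <= L) (n2 : (1 < n)%N).
Hypothesis iX : iid_with_law (node_law alpha L : set (R * R) -> \bar R) X.
Variable i0 : 'I_n.
Local Notation mu := (first_law X i0).
Let x w i := X i w.
Let a0 : 0 < alpha. Proof. by move: a12; lra. Qed.
Let L0 : 0 < L. Proof. by move: L8; lra. Qed.

Let mhdist : measurable [set z : (R * R) * (R * R) | hdist z.1 z.2 <= L].
Proof. by apply: measurable_hdist_le; [exact: measurable_fst|exact: measurable_snd]. Qed.

Definition mean_degree (y : R * R) : R := (n - 1)%:R * pr mu (ball L y).

Let measurable_mean_degree : measurable_fun setT mean_degree.
Proof.
apply: measurable_funM; first exact: measurable_cst.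
have h := measurable_fun_xsection mu mhdist.
rewrite (_ : (fun y => _) = fine \o (mu \o xsection [set z : (R * R) * (R * R) | hdist z.1 z.2 <= L])).
  exact: measurableT_comp h.
apply/funext => y; rewrite /pr /=; congr (fine (mu _)).
by apply/seteqP; split=> z; rewrite /ball /xsection /= inE.
Qed.

(** The floor [Fl] on the mean keeps the deviation within the range of Chernoff's bound for nodes of
    very small mean degree. *)
Definition deviation (Fl l : R) (y : R * R) : R :=
  4 * Num.sqrt (Num.max (mean_degree y) Fl * l).

(** For [a = 4 sqrt (M l)] the exponent [a^2 / (8 M)] is [2 l], and [4 l <= M] gives [a <= 2 M].
    With [l = ln n] the bound [2 / n^2] survives a union over the nodes. *)
Lemma degree_deviation (Fl l : R) (i : 'I_n) : 0 < l -> 4 * l <= Fl ->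
  let S := [set w | deviation Fl l (x w i) <=
     `|(degree L (x w) i)%:R - mean_degree (x w i)|] in
  measurable S /\ pr P S <= 2 * expR (- (2 * l)).
Proof.
move=> l0 lF S.
pose J := (~: [set i])%SET : {set 'I_n}.
have iJ : i \notin J by rewrite !inE eqxx.
have JE : (#|J| = n - 1)%N by rewrite cardsCs finset.setCK cards1 card_ord.
pose kap (y z : R * R) : bool := hdist y z <= L.
have mkap f : measurable [set z : (R * R) * (R * R) | kap z.1 z.2 = f].
  exact: (measurable_bool_set mhdist).
have iY := indep_rest_node (proj1 iX) (iid_first_law iX i0) iJ.
pose Q (y : R * R) := [pred e : {ffun 'I_n -> bool} |
  deviation Fl l y <= `|(class_count J id e)%:R - mean_degree y|].
have mQ e : measurable [set y | Q y e].
  apply: measurable_le_set.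
    apply: measurable_funM; first exact: measurable_cst.
    have ms : measurable_fun setT (@Num.sqrt R).
      by apply: continuous_measurable_fun; exact: sqrt_continuous.
    apply: (measurableT_comp ms); apply: measurable_funM; last exact: measurable_cst.
    by apply: measurable_maxr => //; exact: measurable_cst.
  apply: measurableT_comp; first by apply: continuous_measurable_fun; exact: norm_continuous.
  by apply: measurable_funB => //; exact: measurable_cst.
have eps0 : 0 <= 2 * expR (- (2 * l)) :> R by rewrite mulr_ge0 ?ler0n ?expR_ge0.
have [||mS hS] := @hub_event _ _ _ _ _ _ _ _ X _ _ (X i) J _ false kap Q setT
   (2 * expR (- (2 * l))) S iY mkap mQ measurableT eps0; last 1 first.
- by split=> //; apply: le_trans hS _; rewrite preimage_setT pr_setT mulr1.
- move=> y _.
  have w0 := class_weight_ge0 mu kap y.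
  have w1 := class_weight_sum1 mu mkap y.
  have pE : \sum_(f | id f) class_weight mu kap y f = pr mu (ball L y).
    by rewrite (class_weight_sum mu mkap).
  have Fl0 : 0 < Fl by apply: lt_le_trans lF; rewrite mulr_gt0.
  set M := Num.max (mean_degree y) Fl.
  have MF : Fl <= M by rewrite /M le_max lexx orbT.
  have M0 : 0 < M by exact: lt_le_trans MF.
  have := @class_chernoff _ _ J _ false _ w0 w1 id M (deviation Fl l y) M0.
  rewrite pE JE -/(mean_degree y) => /(_ _ _).
  have -> : deviation Fl l y ^+ 2 / (8 * M) = 2 * l.
    rewrite /deviation -/M exprMn sqr_sqrtr; last by rewrite mulr_ge0 // ltW.
    by field; rewrite gt_eqF.
  apply; first by rewrite /M le_max lexx.
  rewrite /deviation mulr_ge0 ?ler0n ?sqrtr_ge0 //=.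
  have s0 := sqrtr_ge0 (M * l).
  have s2 : Num.sqrt (M * l) ^+ 2 = M * l by rewrite sqr_sqrtr // mulr_ge0 // ltW.
  have : 4 * l <= M by exact: le_trans MF.
  rewrite -/M; move: s0 s2; set s := Num.sqrt _ => s0 s2 lM.
  have : s ^+ 2 <= (M / 2) ^+ 2 by rewrite s2; nra.
  by rewrite ler_pXn2r ?nnegrE ?divr_ge0 ?(ltW M0) //; lra.
- move=> w; rewrite /S /Q /mkset.
  have -> : degree L (x w) i = class_count J id (classes X (X i) J false kap w).
    apply: eq_card => k; rewrite !inE ffunE !inE.
    by rewrite [k == i]eq_sym; case: (i != k).
  by split=> [h|[]//]; split.
Qed.

(** With [E = exp(- alpha (L - t))]: node [i] is below [t] with probability at most [4 E], and given
    its radius the other falls in an interval of length [eta] and mass at most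
    [2 alpha exp alpha eta E]. *)
Lemma close_radii (t eta : R) (i j : 'I_n) : i != j -> 0 <= t -> 0 <= eta -> eta <= 1 ->
  t + 1 <= L ->
  let S := [set w | [/\ 0 <= hradius (x w i) <= t, hradius (x w i) <= hradius (x w j)
     & hradius (x w j) <= hradius (x w i) + eta]] in
  measurable S /\ pr P S <=
    8 * alpha * expR alpha * eta * expR (- (alpha * (L - t))) ^+ 2.
Proof.
move=> ij t0 e0 e1 tL S.
pose kap (y z : R * R) : bool := (hradius y <= hradius z) && (hradius z <= hradius y + eta).
pose V2 := ((R * R) * (R * R))%type.
have m1 : measurable_fun setT (fun z : V2 => z.1.1) by exact: (measurableT_comp measurable_fst measurable_fst).
have m3 : measurable_fun setT (fun z : V2 => z.2.1) by exact: (measurableT_comp measurable_fst measurable_snd).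
have mkap f : measurable [set z : V2 | kap z.1 z.2 = f].
  apply: (@measurable_bool_set _ _ (fun z : V2 => kap z.1 z.2)).
  rewrite (_ : mkset _ = [set z : V2 | z.1.1 <= z.2.1] `&` [set z : V2 | z.2.1 <= z.1.1 + eta]).
    apply: measurableI; first exact: measurable_le_set.
    by apply: measurable_le_set => //; apply: measurable_funD => //; exact: measurable_cst.
  by apply/seteqP; split=> z /=; [move=> /andP[]|move=> [h1 h2]; apply/andP].
pose A : set (R * R) := `[0%R, t]%classic `*` setT.
have mA : measurable A by exact: measurableX.
have iY := indep_rest_node (proj1 iX) (iid_first_law iX i0) (i := i) (J := [set j]%SET).
rewrite inE in iY.
pose Q (y : R * R) := [pred e : {ffun 'I_n -> bool} | e j].
have mQ e : measurable [set y | Q y e].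
  have [h|h] := boolP (e j).
    by rewrite (_ : mkset _ = setT) //; apply/seteqP; split.
  by rewrite (_ : mkset _ = set0) //; apply/seteqP; split=> // y /=; rewrite (negbTE h).
set E := expR (- (alpha * (L - t))).
have E0 : 0 < E by exact: expR_gt0.
have eps0 : 0 <= 2 * alpha * expR alpha * eta * E.
  by rewrite !mulr_ge0 ?ler0n ?expR_ge0 // ltW.
have [||mS hS] := @hub_event _ _ _ _ _ _ _ _ X _ _ (X i) [set j]%SET _ false kap Q A
   (2 * alpha * expR alpha * eta * E) S (iY ij) mkap mQ mA eps0; last 1 first.
- split=> //; apply: le_trans hS _.
  rewrite (_ : 8 * alpha * expR alpha * eta * E ^+ 2 = 2 * alpha * expR alpha * eta * E * (4 * E)); last by ring.
  apply: ler_wpM2l => //; rewrite (pr_first_law iX i0 i mA).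
  apply: (pr_first_law_le iX) => //; rewrite node_lawE //.
  rewrite probability_setT mule1; apply: radial0_le => //; move: tL; lra.
- move=> y [/= yt _].
  have w0 := class_weight_ge0 mu kap y.
  have := @class_prob_markov _ _ [set j]%SET _ false _ w0 (Q y)
    (fun e => (class_count [set j]%SET id e)%:R) 1 ltr01.
  rewrite class_E_count; last exact: class_weight_sum1.
  rewrite cards1 mul1r divr1 => /(_ _ _)/le_trans; apply => //.
    by move=> e /= ej; rewrite ler1n card_gt0; apply/set0Pn; exists j; rewrite !inE eqxx.
  rewrite (class_weight_sum mu mkap).
  move: yt; rewrite in_itv /= => /andP[y0 yt].
  pose r : R := y.1.
  have rt : r + eta <= t + 1 by apply: lerD.
  have rL : r + eta <= L by exact: le_trans tL.
  have re : r <= r + eta by rewrite lerDl.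
  have mI : measurable (`[r, r + eta]%classic : set R) by exact: measurable_itv.
  rewrite (_ : mkset _ = `[r, r + eta]%classic `*` setT); last first.
    by apply/seteqP; split=> z; rewrite /kap /setX /mkset /= in_itv /= /hradius -/r; [move=> ->|case].
  apply: (pr_first_law_le iX); first exact: measurableX.
  rewrite node_lawE // probability_setT mule1.
  apply: le_trans (radial_le a12 L8 y0 re rL) _.
  rewrite lee_fin (_ : r + eta - r = eta); last by ring.
  rewrite (_ : 2 * alpha * expR alpha * eta * E = 2 * alpha * eta * (expR alpha * E)); last by ring.
  apply: ler_wpM2l; first by rewrite mulr_ge0 // mulr_ge0 // ltW.
  rewrite /E -expRD ler_expR.
  have : alpha * (r + eta) <= alpha * (t + 1) by rewrite ler_wpM2l // ltW.
  have -> : - (alpha * (L - (r + eta))) = alpha * (r + eta) - alpha * L by ring.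
  have -> : alpha + - (alpha * (L - t)) = alpha * (t + 1) - alpha * L by ring.
  by rewrite lerD2r.
- move=> w; rewrite /S /A /Q /kap /classes /mkset /setX /= ffunE finset.in_set1 eqxx; split.
    by move=> [h1 h2 h3]; split; [split=> //=; rewrite in_itv|apply/andP].
  by move=> [[/=]]; rewrite in_itv /= => h1 _ /andP[h2 h3].
Qed.

Definition radius_count (I : set R) (w : T) : nat := #|[set i | `[< I (hradius (x w i)) >]]%SET|.

Let measurable_radius (I : set R) : measurable I -> measurable [set z : R * R | I (hradius z)].
Proof.
move=> mI; rewrite (_ : mkset _ = I `*` setT); first exact: measurableX.
by apply/seteqP; split=> z //= [].
Qed.

Let pr_radius (I : set R) : measurable I ->
  (pr mu [set z : R * R | I (hradius z)])%:E = radial_law alpha L I.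
Proof.
move=> mI; have mS := measurable_radius mI; rewrite -prE // (first_lawE iX) //.
rewrite (_ : mkset _ = I `*` setT) ?node_lawE ?probability_setT ?mule1 //.
by apply/seteqP; split=> z //= [].
Qed.

(** Chernoff's bound with a deviation of half the mean [M]: [(M / 2)^2 / (8 M) = M / 32]. *)
Lemma radius_count_small (I : set R) (K : R) : measurable I -> 0 < K ->
  (K%:E <= n%:R%:E * radial_law alpha L I)%E ->
  let S := [set w | (radius_count I w)%:R <= K / 2] in
  measurable S /\ pr P S <= 2 * expR (- (K / 32)).
Proof.
move=> mI K0; rewrite -pr_radius // => hK S.
set p := pr mu _ in hK; have {}hK : K <= n%:R * p by rewrite -lee_fin EFinM.
pose kap (y : unit) (z : R * R) : bool := `[< I (hradius z) >].
have mkap f : measurable [set z : unit * (R * R) | kap z.1 z.2 = f].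
  apply: (@measurable_bool_set _ _ (fun z : unit * (R * R) => kap z.1 z.2)).
  rewrite (_ : mkset _ = setT `*` [set z : R * R | I (hradius z)]).
    by apply: measurableX => //; exact: measurable_radius.
  by apply/seteqP; split=> z; rewrite /kap /setX /mkset /=; [move/asboolP|case=> _ ?; apply/asboolP].
pose J := [set: 'I_n]%SET.
have iY := indep_rest_cst (proj1 iX) (iid_first_law iX i0) J.
pose Q (y : unit) := [pred e : {ffun 'I_n -> bool} | (class_count J id e)%:R <= K / 2].
have mQ e : measurable [set y | Q y e].
  have [h|h] := boolP (Q tt e).
    by rewrite (_ : mkset _ = setT) //; apply/seteqP; split=> // -[].
  by rewrite (_ : mkset _ = set0) //; apply/seteqP; split=> // -[] /=; rewrite (negbTE h).
have eps0 : 0 <= 2 * expR (- (K / 32)) :> R by rewrite mulr_ge0 ?ler0n ?expR_ge0.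
have [||mS hS] := @hub_event _ _ _ _ _ _ _ _ X _ _ (cst tt : {RV P >-> unit}) J _ false kap Q setT
   (2 * expR (- (K / 32))) S iY mkap mQ measurableT eps0; last 1 first.
- by split=> //; apply: le_trans hS _; rewrite preimage_setT pr_setT mulr1.
- move=> y _.
  have w0 := class_weight_ge0 mu kap y.
  have w1 := class_weight_sum1 mu mkap y.
  have pE : \sum_(f | id f) class_weight mu kap y f = p.
    rewrite (class_weight_sum mu mkap); congr (pr mu _).
    by apply/seteqP; split=> z; rewrite /kap /mkset; [move/asboolP|move=> ?; apply/asboolP].
  set M := n%:R * p; have M0 : 0 < M by exact: lt_le_trans hK.
  have := @class_chernoff _ _ J _ false _ w0 w1 id M (M / 2) M0.
  rewrite pE cardsT card_ord => /(_ (lexx _) _) h.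
  apply: (@le_trans _ _ (2 * expR (- ((M / 2) ^+ 2 / (8 * M))))); last first.
    apply: ler_wpM2l; first exact: ler0n.
    rewrite ler_expR lerN2 (_ : (M / 2) ^+ 2 / (8 * M) = M / 32); last by field; rewrite gt_eqF.
    by rewrite ler_pM2r ?invr_gt0 ?ltr0n.
  apply: le_trans (h _); last by move: M0; lra.
  rewrite !class_probE; apply: class_E_le => // e; rewrite ler_nat /Q /=.
  case: (lerP _ (K / 2)) => //= he; rewrite lt0b -/M ler_normr opprB; apply/orP; right.
  by move: he hK; rewrite -/M; lra.
- move=> w; rewrite /S /Q /mkset.
  have -> : radius_count I w = class_count J id (classes X (cst tt : {RV P >-> unit}) J false kap w).
    by apply: eq_card => k; rewrite !inE ffunE inE.
  by split=> [h|[]//]; split.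
Qed.

Lemma radius_count_large (I : set R) (K m : R) : measurable I -> 0 < m ->
  (n%:R%:E * radial_law alpha L I <= K%:E)%E ->
  let S := [set w | m <= (radius_count I w)%:R] in
  measurable S /\ pr P S <= K / m.
Proof.
move=> mI m0; rewrite -pr_radius // => hK S.
set p := pr mu _ in hK; have {}hK : n%:R * p <= K by rewrite -lee_fin EFinM.
have mE (i : 'I_n) : measurable (X i @^-1` [set z : R * R | I (hradius z)]).
  by apply: measurable_preim; exact: measurable_radius.
have cE w : (radius_count I w)%:R = \sum_i \1_(X i @^-1` [set z : R * R | I (hradius z)]) w :> R.
  rewrite /radius_count -sum1_card natr_sum big_mkcond /=; apply: eq_bigr => i _.
  rewrite !inE indicE; case: asboolP => h; first by rewrite mem_set.
  by rewrite memNset.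
have mS : measurable S.
  rewrite (_ : S = [set w | m <= \sum_i \1_(X i @^-1` [set z : R * R | I (hradius z)]) w]).
    by apply: measurable_le_set => //; exact: measurable_sum_indic.
  by apply/funext => w; rewrite /S /mkset cE.
split=> //; rewrite ler_pdivlMr // mulrC.
apply: le_trans (pr_markov P mE mS (ltW m0) _) _.
  by move=> w; rewrite /S /mkset cE.
apply: le_trans hK; rewrite (eq_bigr (fun=> p)); last first.
  by move=> i _; rewrite (pr_first_law iX i0 i (measurable_radius mI)).
by rewrite sumr_const card_ord -[leLHS]mulr_natl.
Qed.

End degree_order.

Lemma pr_bigcup_le d (T : measurableType d) (R : realType) (P : probability T R)
    (I : finType) (E : I -> set T) (c : R) :
  (forall i, measurable (E i) /\ pr P (E i) <= c) ->
  measurable [set w | exists i, E i w] /\ pr P [set w | exists i, E i w] <= #|I|%:R * c.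
Proof.
move=> h; have mE i : measurable (E i) by have [] := h i.
have mU : measurable [set w | exists i, E i w].
  rewrite (_ : mkset _ = \bigcup_(i in [set: I]) E i).
    exact: fin_bigcup_measurable.
  by apply/seteqP; split=> w; [move=> [i h']; exists i|move=> [i _ h']; exists i].
split=> //; apply: le_trans (pr_sum_le P mE mU (fun w h => h)) _.
rewrite mulr_natl -sumr_const; apply: ler_sum => i _.
by have [] := h i.
Qed.

Lemma expR_half_ge (R : realType) (y : R) : y <= 1 -> 2^-1 <= expR (- (y / 2)).
Proof. by move=> y1; have := expR_ge1Dx (- (y / 2)); lra. Qed.

(** Squared form of the separation in [F_gap]. With [e = exp(- r / 2)] the fluctuation side is
    linear in [e] and the gap side quadratic, so the condition is tightest at the largest radius,
    where it is assumed. *)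
Lemma gap_sqr_le (R : realFieldType) (c l m n e a f : R) : 0 < m -> 0 < e -> n <= 2 * m ->
  f <= m * (c * e) * l -> 512 * c * l <= a ^+ 2 * (n * e) ->
  8 ^+ 2 * f <= (m * (a * (e / 2))) ^+ 2.
Proof.
move=> m0 e0 nm hf hc.
have h1 : a ^+ 2 * (n * e) <= a ^+ 2 * (2 * m * e).
  by rewrite ler_wpM2l ?sqr_ge0 // ler_pM2r.
have h2 : 256 * c * l * (m * e) <= a ^+ 2 * (m * e) * (m * e).
  by rewrite ler_pM2r ?mulr_gt0 //; lra.
rewrite (_ : (m * (a * (e / 2))) ^+ 2 = a ^+ 2 * (m * e) * (m * e) / 4); last by field.
lra.
Qed.

Lemma lt_of_deviations (R : realFieldType) (u v fu fv fe s b : R) :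
  `|u - fu| < 4 * s -> `|v - fv| < b -> b <= 4 * s -> fv <= fe -> 8 * s <= fu - fe ->
  v < u.
Proof. by rewrite !ltr_norml => /andP[h1 _] /andP[_ h2] h3 h4 h5; lra. Qed.

(** * Degrees decrease with the radius close to the centre *)

Section top_degrees.
Context d (T : measurableType d) (R : realType) (P : probability T R) (n : nat).
Variables (alpha L : R).
Variable X : 'I_n -> {RV P >-> (R * R)%type}.
Hypotheses (a12 : 1 / 2 < alpha) (L8 : 8 <= L) (n2 : (1 < n)%N).
Hypothesis iX : iid_with_law (node_law alpha L : set (R * R) -> \bar R) X.
Let x w i := X i w.
Let a0 : 0 < alpha. Proof. by move: a12; lra. Qed.
Let L0 : 0 < L. Proof. by move: L8; lra. Qed.
Variables (t eta l : R).
Hypotheses (t4 : 4 <= t) (tL : t + 1 <= L) (eta0 : 0 < eta) (eta1 : eta <= 1) (l0 : 0 < l).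
Local Notation D0 := (window_degree n t).
Hypothesis D0_log : 3072 * l <= strip_mass alpha * D0.
Hypothesis D0_eta : 512 * ball_mass_const alpha * l <= (strip_mass alpha / 192) ^+ 2 * eta ^+ 2 * D0.

Definition top_error : R :=
  n%:R * (2 * expR (- (2 * l)))
  + n%:R ^+ 2 * (8 * alpha * expR alpha * eta * expR (- (alpha * (L - t))) ^+ 2)
  + n%:R * (4 * expR (- (alpha * (L - 4)))).

Let F (r : R) : R := (n - 1)%:R * ball_mass alpha L r.

Let n1R : 0 < (n - 1)%:R :> R. Proof. by rewrite ltr0n subn_gt0. Qed.

Let n1half : n%:R / 2 <= (n - 1)%:R :> R.
Proof.
have h : 2 <= n%:R :> R by rewrite (ler_nat _ 2 n).
by rewrite natrB ?(ltnW n2) //; lra.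
Qed.

Let F_homo (r s : R) : 4 <= r -> r <= s -> s <= L -> F s <= F r.
Proof.
move=> r4 rs sL; apply: ler_wpM2l; first exact: ltW.
exact: (ball_mass_homo a12 L8 r4 rs sL).
Qed.

Let F_log : 4 * l <= F t.
Proof.
have h := ball_mass_ge a12 L8 t4 tL.
have sm0 := strip_mass_gt0 a12.
have e0 := expR_gt0 (- (t / 2)).
have : n%:R / 2 * (strip_mass alpha / 384 * expR (- (t / 2))) <= F t.
  have s384 : 0 <= strip_mass alpha / 384 by apply: divr_ge0; [exact: ltW|exact: ler0n].
  apply: ler_pM; [apply: divr_ge0; exact: ler0n| |exact: n1half|exact: h].
  by apply: mulr_ge0 s384 (ltW e0).
move: D0_log; rewrite /window_degree; lra.
Qed.

(** Over a radial distance [eta] the mean degree drops by at least the sum of the deviations,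
    [4 sqrt (F r l)] each, allowed to two nodes. *)
Let F_gap (r : R) : 4 <= r -> r <= t -> 8 * Num.sqrt (F r * l) <= F r - F (r + eta).
Proof.
move=> r4 rt.
have reL : r + eta <= L by apply: le_trans tL; apply: lerD.
have re : r <= r + eta by rewrite lerDl ltW.
have sm0 := strip_mass_gt0 a12; have cb0 := ball_mass_const_gt0 a12.
have rL : r <= L by exact: le_trans reL.
have r0 : 0 < r by apply: lt_le_trans r4.
have h := ball_massB_ge a12 L8 r4 re reL.
have hb := ball_mass_le a12 L8 r0 rL.
pose A : R := strip_mass alpha / 192 * eta.
have A0 : 0 < A by apply: mulr_gt0 eta0; apply: divr_gt0 sm0 _; rewrite ltr0n.
set E := expR (- (r / 2)) in hb.
have E0 : 0 < E by exact: expR_gt0.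
have E1 : E / 2 <= expR (- ((r + eta) / 2)).
  rewrite (_ : - ((r + eta) / 2) = - (r / 2) + - (eta / 2)); last by field.
  by rewrite expRD ler_pM2l //; exact: expR_half_ge.
have gap : (n - 1)%:R * (A * (E / 2)) <= F r - F (r + eta).
  rewrite /F -mulrBr; apply: ler_wpM2l; first exact: ltW.
  apply: (@le_trans _ _ (A * expR (- ((r + eta) / 2)))).
    by apply: ler_wpM2l; first exact: ltW.
  by rewrite lerBrDl; move: h; rewrite (addrC r eta) addrK.
apply: le_trans gap.
have g0 : 0 <= (n - 1)%:R * (A * (E / 2)).
  by apply: mulr_ge0; [exact: ltW|apply: mulr_ge0; [exact: ltW|apply: divr_ge0; [exact: ltW|]]].
rewrite -[leRHS]ger0_norm // -sqrtr_sqr -[leLHS]ger0_norm; last by apply: mulr_ge0; [exact: ler0n|exact: sqrtr_ge0].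
rewrite -sqrtr_sqr; apply: ler_wsqrtr; rewrite exprMn sqr_sqrtr; last first.
  apply: mulr_ge0 (ltW l0); apply: mulr_ge0 (ltW n1R) _; exact: ball_mass_ge0.
have Et : expR (- (t / 2)) <= E by rewrite ler_expR lerN2 ler_pM2r.
have k1 : F r * l <= (n - 1)%:R * (ball_mass_const alpha * E) * l.
  by apply: ler_wpM2r; [exact: ltW|apply: ler_wpM2l hb; exact: ltW].
have k2 : 512 * ball_mass_const alpha * l <= A ^+ 2 * (n%:R * E).
  apply: le_trans D0_eta _; rewrite -exprMn -/A; apply: ler_wpM2l; first exact: sqr_ge0.
  by apply: ler_wpM2l Et; exact: ler0n.
apply: (gap_sqr_le n1R E0 _ k1 k2).
by move: n1half; rewrite ler_pdivrMr ?ltr0n // mulrC.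
Qed.

Lemma top_degrees : exists B : set T, [/\ measurable B, pr P B <= top_error &
  forall w, ~ B w ->
   (forall i, 4 <= hradius (x w i)) /\
   forall i j, i != j -> hradius (x w i) <= t ->
     hradius (x w i) <= hradius (x w j) -> (degree L (x w) j < degree L (x w) i)%N].
Proof.
have i0 : 'I_n by exact: Ordinal (ltnW n2).
pose Ft := F t.
pose E1 i := [set w | deviation L X i0 Ft l (x w i) <= `|(degree L (x w) i)%:R - mean_degree L X i0 (x w i)|].
pose E2 (p : 'I_n * 'I_n) := if p.1 != p.2 then
  [set w | [/\ 0 <= hradius (x w p.1) <= t, hradius (x w p.1) <= hradius (x w p.2)
     & hradius (x w p.2) <= hradius (x w p.1) + eta]] else set0.
pose E3 i := X i @^-1` (`[0%R, 4%R]%classic `*` setT).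
pose E4 i := X i @^-1` ((~` `]0%R, L[%classic) `*` setT).
have [m1 p1] := pr_bigcup_le (fun i => degree_deviation iX i0 i l0 F_log : measurable (E1 i) /\ pr P (E1 i) <= _).
have h2 p : measurable (E2 p) /\ pr P (E2 p) <= 8 * alpha * expR alpha * eta * expR (- (alpha * (L - t))) ^+ 2.
  rewrite /E2; case: (boolP (p.1 != p.2)) => ij.
    apply: (close_radii a12 L8 iX i0 ij) => //; [by apply: le_trans t4|exact: ltW].
  split; first exact: measurable0.
  by rewrite pr_set0 !mulr_ge0 ?expR_ge0 ?ler0n ?sqr_ge0 ?(ltW a0) ?(ltW eta0).
have [m2 p2] := pr_bigcup_le h2.
have h3 i : measurable (E3 i) /\ pr P (E3 i) <= 4 * expR (- (alpha * (L - 4))).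
  have mS : measurable (`[0%R, 4%R]%classic `*` setT : set (R * R)) by exact: measurableX.
  split; first exact: measurable_preim.
  rewrite (pr_first_law iX i0 i mS); apply: (pr_first_law_le iX) => //; rewrite node_lawE //.
  by rewrite probability_setT mule1; apply: radial0_le => //; move: L8; lra.
have [m3 p3] := pr_bigcup_le h3.
have h4 i : measurable (E4 i) /\ pr P (E4 i) <= 0.
  have mI : measurable (~` `]0%R, L[%classic : set R) by apply: measurableC.
  have mS : measurable ((~` `]0%R, L[%classic) `*` setT : set (R * R)) by exact: measurableX.
  split; first exact: measurable_preim.
  rewrite (pr_first_law iX i0 i mS); apply: (pr_first_law_le iX) => //; rewrite node_lawE //.
  by rewrite radial_out // mul0e.
have [m4 p4] := pr_bigcup_le h4.
have h5 i : measurable (angle_out X i) /\ pr P (angle_out X i) <= 0.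
  by have [? ->] := angle_out_null iX i0 i.
have [m5 p5] := pr_bigcup_le h5.
set B1 := [set w | exists i, E1 i w] in m1 p1.
set B2 := [set w | exists i, E2 i w] in m2 p2.
set B3 := [set w | exists i, E3 i w] in m3 p3.
set B4 := [set w | exists i, E4 i w] in m4 p4.
set B5 := [set w | exists i, angle_out X i w] in m5 p5.
have m12 := measurableU _ _ m1 m2; have m123 := measurableU _ _ m12 m3.
have m1234 := measurableU _ _ m123 m4; have mB := measurableU _ _ m1234 m5.
exists (B1 `|` B2 `|` B3 `|` B4 `|` B5); split=> //.
  have q1 := prU2 P m12 m1 m2 (fun w h => h).
  have q2 := prU2 P m123 m12 m3 (fun w h => h).
  have q3 := prU2 P m1234 m123 m4 (fun w h => h).
  have q4 := prU2 P mB m1234 m5 (fun w h => h).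
  move: p1 p2 p3 p4 p5; rewrite card_prod card_ord natrM -expr2 !mulr0 => p1 p2 p3 p4 p5.
  by rewrite /top_error; lra.
move=> w nB.
have n1 i : ~ E1 i w by move=> h; apply: nB; do 4 left; exists i.
have n2' p : ~ E2 p w by move=> h; apply: nB; do 3 left; right; exists p.
have n3 i : ~ E3 i w by move=> h; apply: nB; do 2 left; right; exists i.
have n4 i : ~ E4 i w by move=> h; apply: nB; left; right; exists i.
have n5 i : ~ angle_out X i w by move=> h; apply: nB; right; exists i.
have rin i : 0 < hradius (x w i) < L.
  by apply: contra_notT (n4 i) => /negP h; split=> //= h'; apply: h; move: h'; rewrite in_itv.
have r4 i : 4 <= hradius (x w i).
  rewrite leNgt; apply/negP => h; apply: (n3 i); split=> //=; rewrite in_itv /=.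
  by have /andP[h' _] := rin i; rewrite !ltW.
have ain i : - pi <= hangle (x w i) <= pi by apply: contra_notT (n5 i) => /negP.
split=> // i j ij rit rij.
have mdE k : mean_degree L X i0 (x w k) = F (hradius (x w k)).
  rewrite /mean_degree /F; congr (_ * _).
  have /andP[u1 u2] := rin k.
  have rk : 0 < hradius (x w k) <= L by rewrite u1 ltW.
  have mb : measurable (ball L (x w k)) by exact: measurable_ball.
  have e : first_law X i0 (ball L (x w k)) = (ball_mass alpha L (hradius (x w k)))%:E.
    by apply: etrans (first_lawE iX i0 mb) _; exact: (ball_massE a0 L0 rk (ain k)).
  by rewrite /pr e.
set ri := hradius (x w i) in rit rij *; set rj := hradius (x w j) in rij *.
have /andP[_ rjL] : 0 < rj < L by exact: rin.
have ri4 : 4 <= ri by exact: r4.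
have rje : ri + eta <= rj.
  rewrite leNgt; apply/negP => h; apply: (n2' (i, j)); rewrite /E2 /= ij; split=> //.
    by rewrite (le_trans _ ri4).
  exact: ltW.
have Fit : F t <= F ri by apply: F_homo => //; move: tL; lra.
have Fje : F rj <= F (ri + eta).
  by apply: F_homo => //; [apply: le_trans ri4 _; rewrite lerDl ltW|exact: ltW].
have gap := F_gap ri4 rit.
have s0 := sqrtr_ge0 (F ri * l).
have Fji : F rj <= F ri.
  apply: (le_trans Fje); rewrite -subr_ge0; apply: le_trans gap.
  by apply: mulr_ge0; [exact: ler0n|exact: s0].
have di : deviation L X i0 Ft l (x w i) = 4 * Num.sqrt (F ri * l).
  rewrite /deviation (mdE i) -/ri; congr (4 * Num.sqrt (_ * l)); exact: (max_l Fit).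
have dj : deviation L X i0 Ft l (x w j) <= 4 * Num.sqrt (F ri * l).
  rewrite /deviation (mdE j) -/rj; apply: ler_wpM2l; first exact: ler0n.
  apply: ler_wsqrtr; apply: ler_wpM2r; first exact: ltW.
  have hmax (u v z : R) : u <= z -> v <= z -> Num.max u v <= z.
    by move=> uz vz; rewrite ge_max uz.
  exact: (hmax (F rj) (F t) (F ri) Fji Fit).
have := n1 i; have := n1 j; rewrite /E1 /mkset => /negP; rewrite -ltNge (mdE j) -/rj => nj /negP.
rewrite -ltNge (mdE i) -/ri di => ni.
rewrite -(ltr_nat R); exact: lt_of_deviations ni nj dj Fje gap.
Qed.

End top_degrees.

(** * Ranks *)

Section ranks.
Context (R : realType) (n : nat) (r : 'I_n -> R) (s : 'S_n) (D : 'I_n -> nat).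
Hypothesis sorted : forall i j : 'I_n, (i <= j)%N -> r (s i) <= r (s j).

Lemma card_ord_lt (a : nat) : (a <= n)%N -> #|[set c : 'I_n | (c < a)%N]%SET| = a.
Proof. by move=> an; rewrite -sum1dep_card (big_ord_narrow an) sum1_card card_ord. Qed.

Lemma rank_ge (i : 'I_n) (Q : pred R) : (forall u, Q u -> u < r i) ->
  (#|[set k | Q (r k)]%SET| <= (s^-1)%g i)%N.
Proof.
move=> h; rewrite -[leqRHS](card_ord_lt (ltnW (ltn_ord _))).
rewrite -[leqRHS](card_imset _ (@perm_inj _ s)); apply: subset_leq_card.
apply/fintype.subsetP => k; rewrite inE => Qk; have ki := h _ Qk.
apply/imsetP; exists ((s^-1)%g k); last by rewrite permKV.
rewrite inE ltnNge; apply/negP => /sorted; rewrite !permKV.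
by rewrite leNgt ki.
Qed.

Lemma rank_lt (j : 'I_n) (Q : pred R) : (forall u, u <= r j -> Q u) ->
  ((s^-1)%g j < #|[set k | Q (r k)]%SET|)%N.
Proof.
move=> h; rewrite -[leqLHS](card_ord_lt (ltn_ord _)).
rewrite -[leqLHS](card_imset _ (@perm_inj _ s)); apply: subset_leq_card.
apply/fintype.subsetP => k /imsetP[c]; rewrite !inE ltnS => cj ->; apply: h.
by have := sorted cj; rewrite permKV.
Qed.

Lemma top_ranks (t : R) (k : nat) : (k <= #|[set i | (r i <= t)%R]%SET|)%N ->
  (forall i j, i != j -> r i <= t -> r i <= r j -> (D j < D i)%N) ->
  forall a b : 'I_n, (a < b)%N -> (a < k)%N -> (D (s b) < D (s a))%N.
Proof.
move=> kt h a b ab ak; apply: h; [|rewrite leNgt|exact/sorted/ltnW].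
  by rewrite (inj_eq perm_inj) -val_eqE /= neq_ltn ab.
apply/negP => ta; have := @rank_ge (s a) (fun u => u <= t) (fun u ut => le_lt_trans ut ta).
by rewrite permK => /(leq_trans kt); rewrite leqNgt ak.
Qed.

(** Otherwise degrees would be nonincreasing from each rank to the next between those of [i] and
    [j], against [D i < D j]. *)
Lemma consecutive_inversion (i j : 'I_n) : r i < r j -> (D i < D j)%N ->
  exists a b : 'I_n, [/\ b = a.+1 :> nat, ((s^-1)%g i <= a)%N, (a < (s^-1)%g j)%N &
    (D (s a) < D (s b))%N].
Proof.
move=> rij Dij; set i' := (s^-1)%g i; set j' := (s^-1)%g j.
have ij : (i' < j')%N.
  rewrite ltnNge; apply/negP => /sorted; rewrite !permKV.
  by rewrite leNgt rij.
apply: contrapT => no.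
(* The degree sequence extended to all naturals; the default 0 is not met at ranks up to that of
   [j]. *)
pose f m := if insub m is Some c then D (s (c : 'I_n)) else 0%N.
have fE (c : 'I_n) : f c = D (s c) by rewrite /f valK.
have step m : (i' <= m)%N -> (m < j')%N -> (f m.+1 <= f m)%N.
  move=> im mj; have mn : (m < n)%N by exact: ltn_trans (ltn_ord j').
  have mn' : (m.+1 < n)%N by exact: leq_ltn_trans (ltn_ord j').
  rewrite -[m]/(nat_of_ord (Ordinal mn)) -[(_).+1]/(nat_of_ord (Ordinal mn')) !fE leqNgt.
  by apply/negP => h; apply: no; exists (Ordinal mn), (Ordinal mn').
have : forall k, (i' + k <= j')%N -> (f (i' + k) <= f i')%N.
  elim=> [|k ih] hk; first by rewrite addn0.
  rewrite addnS; rewrite addnS in hk.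
  by apply: leq_trans (step _ (leq_addr _ _) hk) (ih (ltnW hk)).
move=> /(_ (j' - i')%N); rewrite subnKC ?(ltnW ij) // => /(_ (leqnn _)).
by rewrite !fE /i' /j' !permKV leqNgt Dij.
Qed.

End ranks.

Section event.
Context (R : realType) (nu : R) (n : nat) (k : nat) (lo hi : R).

(** The event of the theorem for abstract [k], [lo] and [hi], to which it unfolds by conversion. It
    quantifies over all orderings [s] by radius, so none has to be chosen measurably. *)
Definition degree_event (x : 'I_n -> R * R) : Prop :=
  forall s : 'S_n, radius_ordering x s ->
    let D (i : 'I_n) : nat := rhg_deg nu x (s i) in
    (forall i : 'I_n, (k < i.+1)%N ->
       (forall a b : 'I_n, b = a.+1 :> nat -> (b.+1 <= k)%N -> (D b < D a)%N) /\
       (forall a : 'I_n, a.+1 = k -> (D i < D a)%N)) /\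
    (exists a b : 'I_n, [/\ b = a.+1 :> nat, lo <= a.+1%:R <= hi & (D a < D b)%N]).

Local Notation L := (rhg_radius nu n).

Lemma rhg_degE (x : 'I_n -> R * R) i : rhg_deg nu x i = degree L x i.
Proof. by apply: eq_card => j; rewrite !inE. Qed.

(** An inversion inside the window [[t0, t0 + 1)] yields one at consecutive ranks. All nodes of
    radius below [t0] come before it, and it lies among those of radius below [t0 + 1], which places
    its rank between [lo] and [hi]. *)
Lemma degree_eventP (x : 'I_n -> R * R) (t t0 : R) :
  (k <= #|[set i | (hradius (x i) <= t)%R]%SET|)%N ->
  (forall i j, i != j -> hradius (x i) <= t -> hradius (x i) <= hradius (x j) ->
     (degree L x j < degree L x i)%N) ->
  (exists i j, [/\ t0 <= hradius (x i), hradius (x i) < hradius (x j),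
     hradius (x j) < t0 + 1 & (degree L x i < degree L x j)%N]) ->
  lo <= #|[set i | hradius (x i) < t0]%SET|%:R ->
  #|[set i | hradius (x i) < t0 + 1]%SET|%:R <= hi ->
  degree_event x.
Proof.
move=> kt top [i [j [t0i rij jt0 Dij]]] hlo hhi s ord D.
have DE c : D c = degree L x (s c) by rewrite /D rhg_degE.
pose r c := hradius (x c).
have ranks := @top_ranks _ _ r s (degree L x) ord t k kt top.
split.
  (* Indices start at 0: [a.+1 = k] designates the node of rank [k], and [k < c.+1] a node of larger
     rank. *)
  move=> c kc; split=> [a b ba bk|a ak]; rewrite !DE; apply: ranks.
  - by rewrite ba.
  - by rewrite -ba; exact: ltnW.
  - by rewrite ak -ltnS.
  - by rewrite -ak.
have [a [b [ba ia aj Dab]]] := @consecutive_inversion _ _ r s (degree L x) ord i j rij Dij.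
exists a, b; split; [by []| |by rewrite !DE].
have h1 := @rank_ge _ _ r s ord i (fun u => u < t0) (fun u ut => lt_le_trans ut t0i).
have h2 := @rank_lt _ _ r s ord j (fun u => u < t0 + 1) (fun u uj => le_lt_trans uj jt0).
apply/andP; split.
  by apply: le_trans hlo _; rewrite ler_nat; apply: leq_trans h1 (leq_trans ia (leqnSn _)).
apply: le_trans hhi; rewrite ler_nat; exact: leq_trans (ltnW h2).
Qed.

Lemma measurable_degree_event d (T : measurableType d) (X : 'I_n -> T -> R * R) :
  (forall i, measurable_fun setT (X i)) ->
  measurable [set w | degree_event (fun i => X i w)].
Proof.
move=> mX.
pose b (p : 'I_n * 'I_n * bool) (w : T) : bool := let: (i, j, o) := p in
  if o then hradius (X i w) <= hradius (X j w) else hdist (X i w) (X j w) <= L.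
pose dg (f : {ffun 'I_n * 'I_n * bool -> bool}) (i : 'I_n) :=
  #|[pred k | (i != k) && f (i, k, false)]|.
pose Q : set {ffun 'I_n * 'I_n * bool -> bool} := [set f : {ffun 'I_n * 'I_n * bool -> bool} | forall s : 'S_n,
  (forall i j : 'I_n, (i <= j)%N -> f (s i, s j, true)) ->
    let D (i : 'I_n) : nat := dg f (s i) in
    (forall i : 'I_n, (k < i.+1)%N ->
       (forall a b : 'I_n, b = a.+1 :> nat -> (b.+1 <= k)%N -> (D b < D a)%N) /\
       (forall a : 'I_n, a.+1 = k -> (D i < D a)%N)) /\
    (exists a b : 'I_n, [/\ b = a.+1 :> nat, lo <= a.+1%:R <= hi & (D a < D b)%N])].
have dgE w i : dg [ffun p => b p w] i = rhg_deg nu (fun i => X i w) i.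
  by apply: eq_card => j; rewrite !inE ffunE.
rewrite (_ : mkset _ = [set w | Q [ffun p => b p w]]).
  apply: (@measurable_bool_info _ _ _ b Q) => -[[i j] []] /=.
    by apply: measurable_le_set; exact: (measurableT_comp measurable_fst).
  exact: measurable_hdist_le.
apply/funext => w; apply/propext; rewrite /mkset /degree_event /Q; split=> h s ord.
  have ord' : radius_ordering (fun i => X i w) s.
    by move=> i j ij; have := ord i j ij; rewrite ffunE.
  by have := h s ord'; rewrite /= !(funext (fun i => dgE w i)).
have ord' (i j : 'I_n) : (i <= j)%N -> [ffun p => b p w] (s i, s j, true) = true.
  by move=> ij; rewrite ffunE; exact: ord.
by have := h s ord'; rewrite /= !(funext (fun i => dgE w i)).
Qed.

End event.

Section degree_event_probability.
Context d (T : measurableType d) (R : realType) (P : probability T R) (n : nat).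
Variables (alpha nu : R) (X : 'I_n -> {RV P >-> (R * R)%type}).
Local Notation L := (rhg_radius nu n).
Hypotheses (a12 : 1 / 2 < alpha) (L8 : 8 <= L) (n2 : (1 < n)%N).
Hypothesis iX : rhg_nodes alpha nu X.
Variables (k : nat) (lo hi l t eta t0 : R) (N m g0 : nat).

Let a0 : 0 < alpha. Proof. by move: a12; lra. Qed.
Let nR : 0 < n%:R :> R. Proof. by rewrite ltr0n (ltnW n2). Qed.
Let iX' : iid_with_law (node_law alpha L : set (R * R) -> \bar R) X.
Proof. exact: iX. Qed.

(** The mean count is at least [K / 4], and half of it is [K / 8]: the origin of the constant 8 in
    [window_start]. *)
Lemma few_inner_nodes (s : R) : 4 <= s -> s <= L ->
  let S := [set w | (radius_count X `[0%R, s[%classic w)%:R <= window_count n alpha L s / 8] in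
  measurable S /\ pr P S <= 2 * expR (- (window_count n alpha L s / 128)).
Proof.
move=> s4 sL S; have i0 : 'I_n by exact: Ordinal (ltnW n2).
pose K := window_count n alpha L s; have K0 : 0 < K by rewrite mulr_gt0 ?expR_gt0.
have K40 : 0 < K / 4 by apply: divr_gt0 K0 _; rewrite ltr0n.
have as2 : 2 <= alpha * s by move: a12 s4; nra.
have s0 : 0 <= s by apply: le_trans s4.
have h : ((K / 4)%:E <= n%:R%:E * radial_law alpha L `[0%R, s[%classic)%E.
  have n0 : (0 <= n%:R%:E :> \bar R)%E by rewrite lee_fin ltW.
  apply: le_trans (lee_wpmul2l n0 (radial0_ge a12 L8 as2 s0 sL)).
  by rewrite -EFinM /K /window_count mulrA.
have mI : measurable (`[0%R, s[%classic : set R) by exact: measurable_itv.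
have := radius_count_small iX' i0 mI K40 h.
rewrite (_ : K / 4 / 2 = K / 8); last by field.
by rewrite (_ : K / 4 / 32 = K / 128) //; field.
Qed.

Lemma many_inner_nodes (s : R) : 0 <= s -> s + 1 <= L -> 0 < hi ->
  let S := [set w | hi <= (radius_count X `[0%R, s + 1]%classic w)%:R] in
  measurable S /\ pr P S <= 4 * expR alpha * window_count n alpha L s / hi.
Proof.
move=> s0 sL hi0 S; have i0 : 'I_n by exact: Ordinal (ltnW n2).
have s10 : 0 <= s + 1 by rewrite addr_ge0.
have mI : measurable (`[0%R, s + 1]%classic : set R) by exact: measurable_itv.
have h : (n%:R%:E * radial_law alpha L `[0%R, (s + 1)%R]%classic <=
    (4 * expR alpha * window_count n alpha L s)%:E)%E.
  have n0 : (0 <= n%:R%:E :> \bar R)%E by rewrite lee_fin ltW.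
  apply: le_trans (lee_wpmul2l n0 (radial0_le a12 L8 s10 sL)) _.
  rewrite -EFinM lee_fin /window_count.
  rewrite (_ : - (alpha * (L - (s + 1))) = alpha + - (alpha * (L - s))); last by ring.
  by rewrite expRD le_eqVlt; apply/orP; left; apply/eqP; ring.
exact: (radius_count_large iX' i0 mI hi0 h).
Qed.

(** Two radii are at work: [t], below which degrees are ordered and [k] nodes are found, and [t0],
    where the window of (ii) begins. The deterministic argument is [degree_eventP]. *)
Lemma degree_event_prob :
  4 <= t -> t + 1 <= L -> 0 < eta -> eta <= 1 -> 0 < l ->
  3072 * l <= strip_mass alpha * window_degree n t ->
  512 * ball_mass_const alpha * l <= (strip_mass alpha / 192) ^+ 2 * eta ^+ 2 * window_degree n t ->
  k%:R <= window_count n alpha L t / 8 ->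
  (0 < N)%N -> 4 <= t0 -> t0 + 2 <= L ->
  2 * alpha * expR alpha * window_count n alpha L t0 / N%:R <= 1 / 2 ->
  4 * ball_mass_const alpha * expR (- (t0 / 2)) <= 1 ->
  (g0 <= N)%N -> g0%:R <= window_pairs n alpha L t0 N ->
  lo <= window_count n alpha L t0 / 8 -> 0 < hi ->
  1 - (top_error n alpha L t eta l + 2 * expR (- (window_count n alpha L t / 128))
       + window_error n alpha L t0 N m g0 + 2 * expR (- (window_count n alpha L t0 / 128))
       + 4 * expR alpha * window_count n alpha L t0 / hi)
  <= pr P [set w | degree_event nu k lo hi (fun i => X i w)].
Proof.
move=> t4 tL e0 e1 l0 hl he hk N0 t04 t0L hK hB gN gp hlo hi0.
have i0 : 'I_n by exact: Ordinal (ltnW n2).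
have [B1 [m1 p1 h1]] := top_degrees a12 L8 n2 iX' t4 tL e0 e1 l0 hl he.
have [B2 [m2 p2 h2]] := window_inversion m a12 L8 N0 n2 t04 t0L iX' hK hB gN gp.
have tL' : t <= L by apply: le_trans tL; rewrite lerDl.
have t0L' : t0 <= L by apply: le_trans t0L; rewrite lerDl ler0n.
have t01 : t0 + 1 <= L by apply: le_trans t0L; rewrite lerD2l ler1n.
have t00 : 0 <= t0 by apply: le_trans t04.
have [m3 p3] := few_inner_nodes t4 tL'; set B3 := [set w | _] in m3 p3.
have [m4 p4] := few_inner_nodes t04 t0L'; set B4 := [set w | _] in m4 p4.
have [m5 p5] := many_inner_nodes t00 t01 hi0; set B5 := [set w | _] in m5 p5.
have m12 := measurableU _ _ m1 m2; have m123 := measurableU _ _ m12 m3.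
have m1234 := measurableU _ _ m123 m4; have mB := measurableU _ _ m1234 m5.
have mE : measurable [set w | degree_event nu k lo hi (fun i => X i w)].
  by apply: measurable_degree_event.
pose B := B1 `|` B2 `|` B3 `|` B4 `|` B5.
have pB : pr P B <= top_error n alpha L t eta l + window_error n alpha L t0 N m g0 +
    2 * expR (- (window_count n alpha L t / 128)) + 2 * expR (- (window_count n alpha L t0 / 128))
    + 4 * expR alpha * window_count n alpha L t0 / hi.
  apply: le_trans (prU2 P mB m1234 m5 (fun w h => h)) _; apply: lerD p5.
  apply: le_trans (prU2 P m1234 m123 m4 (fun w h => h)) _; apply: lerD p4.
  apply: le_trans (prU2 P m123 m12 m3 (fun w h => h)) _; apply: lerD p3.
  by apply: le_trans (prU2 P m12 m1 m2 (fun w h => h)) _; apply: lerD.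
apply: (@le_trans _ _ (pr P (~` B))).
  rewrite pr_setC // lerD2l lerN2; apply: le_trans pB _.
  by rewrite le_eqVlt; apply/orP; left; apply/eqP; ring.
apply: pr_mono => //; first exact: measurableC.
move=> w nB.
have n1 : ~ B1 w by move=> h; apply: nB; do 4 left.
have n2' : ~ B2 w by move=> h; apply: nB; do 3 left; right.
have n3 : ~ B3 w by move=> h; apply: nB; do 2 left; right.
have n4 : ~ B4 w by move=> h; apply: nB; left; right.
have n5 : ~ B5 w by move=> h; apply: nB; right.
have [r4 top] := h1 w n1.
have cnt (s : R) (Q : pred R) : (forall u, `[0%R, s[%classic u -> Q u) ->
    (radius_count X `[0%R, s[%classic w <= #|[set i | Q (hradius (X i w))]%SET|)%N.
  move=> hQ; apply: subset_leq_card; apply/fintype.subsetP => i.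
  by rewrite !finset.in_set => /asboolP h; exact: (hQ _ h).
apply: (degree_eventP (t := t) (t0 := t0)).
- apply: leq_trans (cnt t (fun u => u <= t) _); last first.
    by move=> u /=; rewrite in_itv /= => /andP[_ /ltW].
  rewrite -(ler_nat R); apply: le_trans hk _.
  by apply: ltW; rewrite ltNge; apply/negP.
- exact: top.
- exact: h2.
- apply: (@le_trans _ _ (radius_count X `[0%R, t0[%classic w)%:R).
    by apply: le_trans hlo _; apply: ltW; rewrite ltNge; apply/negP.
  rewrite ler_nat; apply: (cnt t0 (fun u => u < t0)).
  by move=> u /=; rewrite in_itv /= => /andP[].
apply: (@le_trans _ _ (radius_count X `[0%R, t0 + 1]%classic w)%:R); last first.
  by apply: ltW; rewrite ltNge; apply/negP.
rewrite ler_nat; apply: subset_leq_card; apply/fintype.subsetP => i; rewrite !finset.in_set => ri.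
have r0 : 0 <= hradius (X i w) by exact: le_trans (ler0n R 4) (r4 i).
apply/asboolP; rewrite /= in_itv /=; apply/andP; split; [exact: r0|exact: ltW].
Qed.

End degree_event_probability.

(** * Asymptotics *)

Lemma div_le_third (R : realFieldType) (u v e : R) : 0 < v -> 0 < e ->
  3 * u / e <= v -> u / v <= e / 3.
Proof.
move=> v0 e0; rewrite ler_pdivrMr // ler_pdivrMr // => h.
by rewrite mulrAC ler_pdivlMr ?ltr0n //; lra.
Qed.

Section asymptotics.
Context (R : realType) (alpha nu : R).
Hypotheses (a12 : 1 / 2 < alpha) (nu0 : 0 < nu).
Local Notation beta := (1 / (1 + 8 * alpha)).
Let a0 : 0 < alpha. Proof. by move: a12; lra. Qed.
Let b1 : 1 + 8 * alpha != 0. Proof. by rewrite gt_eqF //; move: a0; lra. Qed.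
Let b0 : 0 < beta. Proof. by apply: divr_gt0 => //; move: a0; lra. Qed.

(** With [c = a / (m + 1)], [exp (a x) = exp (c x)^(m + 1) >= (c x)^(m + 1)], and the extra power of
    [x] beats the constant. *)
Lemma pow_le_expR (a C : R) (m : nat) : 0 < a ->
  \forall x \near +oo, C * x ^+ m <= expR (a * x).
Proof.
move=> ap; pose c := a / m.+1%:R.
have m1 : 0 < m.+1%:R :> R by rewrite ltr0n.
have c0 : 0 < c by exact: divr_gt0.
have cm0 : 0 < c ^+ m.+1 by exact: exprn_gt0.
near=> x.
have x0 : 0 < x by near: x; exact: nbhs_pinfty_gt (num_real _).
have xC : C / c ^+ m.+1 <= x by near: x; exact: nbhs_pinfty_ge (num_real _).
have -> : a * x = m.+1%:R * (c * x) by rewrite /c; field; rewrite gt_eqF.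
rewrite expRM_natl; apply: (@le_trans _ _ ((c * x) ^+ m.+1)); last first.
  have h : c * x <= expR (c * x) by apply: (le_trans _ (expR_ge1Dx _)); rewrite lerDr.
  have cx : 0 <= c * x by apply: mulr_ge0; exact: ltW.
  exact: lerXn2r _ cx (expR_ge0 _) h.
have -> : (c * x) ^+ m.+1 = c ^+ m.+1 * x * x ^+ m by rewrite exprMn [x ^+ m.+1]exprS mulrA.
rewrite ler_pM2r ?exprn_gt0 //.
by move: xC; rewrite ler_pdivrMr // mulrC.
Unshelve. all: by end_near. Qed.

(** The radius [t] that solves [window_count = 8 n^beta exp lc]. Part (i) takes
    [lc = - 2 alpha ln (ln n)], part (ii) takes [lc = ln w]. *)
Definition window_start (n : nat) (lc : R) : R :=
  rhg_radius nu n - (ln n%:R - (ln 8 + beta * ln n%:R + lc)) / alpha.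

(** The exponent of the degree rests on [(1 - beta) / (2 alpha) = 4 beta], the identity that
    characterises [beta]. *)
Lemma window_startE (n : nat) (lc : R) : (0 < n)%N ->
  let t := window_start n lc in let x := ln n%:R in
  [/\ window_count n alpha (rhg_radius nu n) t = 8 * expR (beta * x + lc),
      window_degree n t = nu * expR (4 * beta * x - (ln 8 + lc) / (2 * alpha)) &
      expR (- (t / 2)) = window_degree n t / n%:R].
Proof.
move=> n0 t x; have nR : 0 < n%:R :> R by rewrite ltr0n.
have nE : expR x = n%:R by rewrite lnK ?posrE.
have an0 : alpha != 0 by rewrite gt_eqF.
split.
- rewrite /window_count -nE -expRD.
  rewrite (_ : x + _ = ln 8 + (beta * x + lc)); last first.
    by rewrite /t /window_start -/x; field; rewrite an0 b1.
  by rewrite expRD lnK ?posrE // ltr0n.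
- have nuE : nu = expR (ln nu) by rewrite lnK ?posrE.
  rewrite /window_degree -{1}nE -expRD [X in _ = X * _]nuE -expRD.
  congr expR; rewrite /t /window_start /rhg_radius -/x ln_div ?posrE //.
  by rewrite -/x; field; rewrite an0 b1.
by rewrite /window_degree mulrAC divff ?mul1r // gt_eqF.
Qed.

Lemma window_start_bounds (n : nat) (lc : R) : (0 < n)%N ->
  let t := window_start n lc in
  4 * nu <= window_degree n t -> 16 * window_degree n t <= n%:R ->
  4 <= t /\ t + 2 <= rhg_radius nu n.
Proof.
move=> n0 t h1 h2; have nR : 0 < n%:R :> R by rewrite ltr0n.
have [_ _ e] := window_startE lc n0.
have e1 : expR (1 / 2) <= 2 :> R by have := expR_le_quadratic (lexx (1 / 2 : R)); lra.
have e2 : expR 1 <= 4 :> R.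
  rewrite (_ : 1 = 2%:R * (1 / 2)); last by field.
  by rewrite expRM_natl; have := expR_ge0 (1 / 2 : R); nra.
have e4 : expR 2 <= 16 :> R.
  rewrite (_ : 2 = 2%:R * 1); last by ring.
  by rewrite expRM_natl; have := expR_ge0 (1 : R); nra.
split.
  suff : expR (- (t / 2)) <= expR (- 2) by rewrite ler_expR; lra.
  rewrite e expRN ler_pdivrMr // ler_pdivlMl ?expR_gt0 //.
  apply: le_trans h2; apply: ler_wpM2r; last exact: e4.
  by rewrite /window_degree mulr_ge0 ?expR_ge0.
suff : expR 1 <= expR ((rhg_radius nu n - t) / 2) by rewrite ler_expR; lra.
rewrite (_ : (rhg_radius nu n - t) / 2 = ln (n%:R / nu) + - (t / 2)); last by rewrite /rhg_radius; field.
rewrite expRD lnK ?posrE ?divr_gt0 // e.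
have -> : n%:R / nu * (window_degree n t / n%:R) = window_degree n t / nu.
  by field; rewrite !gt_eqF.
by apply: le_trans e2 _; rewrite ler_pdivlMr.
Qed.

Let cb := ball_mass_const alpha.
Let sm := strip_mass alpha.
Let cb0 : 0 < cb. Proof. exact: ball_mass_const_gt0. Qed.
Let sm0 : 0 < sm. Proof. exact: strip_mass_gt0. Qed.
Let a8 : R := nu * expR (- (ln 8 / (2 * alpha))).
Let a80 : 0 < a8. Proof. by rewrite mulr_gt0 ?expR_gt0. Qed.

Lemma expRN_le (x c : R) : 0 < c -> c <= x -> expR (- x) <= c^-1.
Proof.
move=> c0 cx; rewrite expRN lef_pV2 ?posrE ?expR_gt0 //.
by apply: (le_trans cx); apply: le_trans (expR_ge1Dx x); lra.
Qed.

(** Makes the separation condition of [top_degrees] an equality for [eta = ce exp(- 2 beta x)], the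
    degree being [a8 x exp(4 beta x)]. *)
Let ce : R := Num.sqrt (512 * cb / ((sm / 192) ^+ 2 * a8)).
Let ce0 : 0 < ce.
Proof.
rewrite sqrtr_gt0; apply: divr_gt0; first by apply: mulr_gt0 cb0; rewrite ltr0n.
by apply: mulr_gt0 a80; apply: exprn_gt0; apply: divr_gt0 sm0 _; rewrite ltr0n.
Qed.

(** The shift by [- 2 alpha ln x] multiplies the degree by [x = ln n], which cancels the logarithm
    in [eta]; the mean number of pairs of close radii is then of order [x^(- 4 alpha)]. *)
Lemma top_error_small (delta : R) : 0 < delta -> \forall x \near +oo,
  forall n : nat, (0 < n)%N -> ln n%:R = x ->
  let t := window_start n (- (2 * alpha * ln x)) in
  exists eta : R, [/\ 4 <= t, t + 2 <= rhg_radius nu n, 0 < eta, eta <= 1 &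
   [/\ 3072 * x <= sm * window_degree n t,
    512 * cb * x <= (sm / 192) ^+ 2 * eta ^+ 2 * window_degree n t,
    top_error n alpha (rhg_radius nu n) t eta x <= delta &
    2 * expR (- (window_count n alpha (rhg_radius nu n) t / 128)) <= delta]].
Proof.
move=> d0.
have c4 : 0 < 1 - 4 * beta.
  have h : 0 < 1 + 8 * alpha by move: a0; lra.
  rewrite subr_gt0 mulrA mulr1 ltr_pdivrMr // mul1r; move: a12; lra.
have b4 : 0 < 4 * beta by move: b0; lra.
have b2 : 0 < 2 * beta by move: b0; lra.
have a21 : 0 < 2 * alpha - 1 by move: a12; lra.
(* An integer above [2 alpha]: since [exp (beta x)] dominates [x^m], the count
   [8 exp (beta x) x^(- 2 alpha)] is large. *)
pose m := (Num.truncn (2 * alpha)).+1.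
have am : 2 * alpha <= m%:R by apply/ltW; rewrite /m truncnS_gt.
near=> x.
have x1 : 1 <= x by near: x; exact: nbhs_pinfty_ge (num_real _).
have h1 : 16 * a8 * x ^+ 1 <= expR ((1 - 4 * beta) * x) by near: x; exact: pow_le_expR.
have h2 : 4 * nu / a8 * x ^+ 0 <= expR (4 * beta * x) by near: x; exact: pow_le_expR.
have h3 : 3072 / (sm * a8) * x ^+ 0 <= expR (4 * beta * x) by near: x; exact: pow_le_expR.
have h4 : ce * x ^+ 0 <= expR (2 * beta * x) by near: x; exact: pow_le_expR.
have h5 : 3 * 2 / delta * x ^+ 0 <= expR (1 * x) by near: x; exact: pow_le_expR.
have h6 : 3 * (512 * alpha * expR alpha * ce) / delta <= x by near: x; exact: nbhs_pinfty_ge (num_real _).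
have h7 : 3 * (4 * expR (4 * alpha + 2 * alpha * ln nu)) / delta * x ^+ 0 <= expR ((2 * alpha - 1) * x).
  by near: x; exact: pow_le_expR.
have h8 : 32 / delta * x ^+ m <= expR (beta * x) by near: x; exact: pow_le_expR.
move=> n n0 nx; set t := window_start n (- (2 * alpha * ln x)); exists (ce * expR (- (2 * beta * x))).
have nR : 0 < n%:R :> R by rewrite ltr0n.
have nE : n%:R = expR x by rewrite -nx lnK ?posrE.
have x0 : 0 < x by apply: lt_le_trans x1.
have lx : expR (ln x) = x by rewrite lnK ?posrE.
have [] := window_startE (- (2 * alpha * ln x)) n0; rewrite -/t nx => Kt Dt et.
have {}Dt : window_degree n t = a8 * x * expR (4 * beta * x).
  have e : expR (4 * beta * x - (ln 8 + - (2 * alpha * ln x)) / (2 * alpha)) =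
      expR (- (ln 8 / (2 * alpha))) * expR (ln x) * expR (4 * beta * x).
    have an0 : alpha != 0 by rewrite gt_eqF.
    by rewrite -!expRD; congr expR; field; rewrite an0 b1.
  by rewrite Dt e lx /a8; ring.
have E4 := expR_gt0 (4 * beta * x).
have E2 := expR_gt0 (- (2 * beta * x)).
have D4 : 4 * nu <= window_degree n t.
  rewrite Dt; move: h2; rewrite expr0 mulr1 ler_pdivrMr // => h2'.
  by apply: (le_trans h2'); rewrite [leRHS]mulrAC mulrC ler_peMr // mulr_ge0 // ltW.
have D16 : 16 * window_degree n t <= n%:R.
  rewrite Dt nE mulrA (mulrA 16) (_ : expR x = expR ((1 - 4 * beta) * x) * expR (4 * beta * x)).
    by rewrite ler_pM2r // -[X in _ * X <= _]expr1.
  by rewrite -expRD; congr expR; ring.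
have [t4 t2] := window_start_bounds n0 D4 D16.
split=> //; first exact: mulr_gt0.
  rewrite expRN ler_pdivrMr ?expR_gt0 // [leRHS]mul1r.
  by move: h4; rewrite expr0 mulr1.
have eta2 : (ce * expR (- (2 * beta * x))) ^+ 2 * expR (4 * beta * x) = ce ^+ 2.
  have e : expR (- (2 * beta * x)) ^+ 2 * expR (4 * beta * x) = 1.
    by rewrite -expRM_natl -expRD -[RHS]expR0; congr expR; ring.
  by rewrite exprMn -[LHS]mulrA e mulr1.
have sa : 0 < (sm / 192) ^+ 2 * a8.
  by apply: mulr_gt0 a80; apply: exprn_gt0; apply: divr_gt0 sm0 _; rewrite ltr0n.
split.
- have sa8 : 0 < sm * a8 := mulr_gt0 sm0 a80.
  rewrite Dt; move: h3; rewrite expr0 mulr1 (ler_pdivrMr _ _ sa8) => h3'.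
  rewrite (_ : sm * (a8 * x * expR (4 * beta * x)) = (expR (4 * beta * x) * (sm * a8)) * x); last by ring.
  by rewrite ler_pM2r.
- rewrite Dt (_ : _ * (a8 * x * _) = (sm / 192) ^+ 2 * a8 * x * ((ce * expR (- (2 * beta * x))) ^+ 2 * expR (4 * beta * x))); last by ring.
  rewrite eta2 sqr_sqrtr; last first.
    by apply: divr_ge0; [apply: mulr_ge0 (ltW cb0); exact: ler0n|exact: ltW].
  rewrite le_eqVlt; apply/orP; left; apply/eqP.
  rewrite (_ : _ * x * _ = 512 * cb * x * (((sm / 192) ^+ 2 * a8) / ((sm / 192) ^+ 2 * a8))); last by ring.
  by rewrite divff ?mulr1 // gt_eqF.
- rewrite /top_error.
  have -> : delta = delta / 3 + delta / 3 + delta / 3 by field.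
  apply: lerD; [apply: lerD|].
  + rewrite nE (_ : expR x * _ = 2 * expR (- x)); last first.
      by rewrite mulrCA -expRD; congr (2 * expR _); ring.
    rewrite expRN; apply: (div_le_third (expR_gt0 _) d0).
    by move: h5; rewrite expr0 mulr1 mul1r.
  + rewrite (_ : n%:R ^+ 2 * _ = 8 * alpha * expR alpha * (ce * expR (- (2 * beta * x))) *
        (window_count n alpha (rhg_radius nu n) t) ^+ 2); last by rewrite /window_count; ring.
    have K2 : window_count n alpha (rhg_radius nu n) t ^+ 2 =
        64 * (expR (2 * beta * x) * expR (- (4 * alpha * ln x))).
      rewrite Kt exprMn -expRM_natl -expRD (_ : 8 ^+ 2 = 64); last by ring.
      by congr (64 * expR _); ring.
    have e1 : expR (- (2 * beta * x)) * expR (2 * beta * x) = 1 by rewrite mulrC expRxMexpNx_1.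
    rewrite K2 (_ : _ * (64 * _) = 512 * alpha * expR alpha * ce * (expR (- (2 * beta * x)) * expR (2 * beta * x)) *
      expR (- (4 * alpha * ln x))); last by ring.
    rewrite e1 mulr1.
    have lnx0 : 0 <= ln x by exact: ln_ge0.
    have ex : expR (- (4 * alpha * ln x)) <= x^-1.
      rewrite -{2}lx -expRN ler_expR lerN2; move: a12 lnx0; nra.
    have c0 : 0 < 512 * alpha * expR alpha * ce.
      by apply: mulr_gt0 ce0; apply: mulr_gt0 (expR_gt0 _); apply: mulr_gt0 a0; rewrite ltr0n.
    apply: le_trans (ler_wpM2l (ltW c0) ex) _.
    exact: (div_le_third x0 d0 h6).
  + have -> : - (alpha * (rhg_radius nu n - 4)) = (4 * alpha + 2 * alpha * ln nu) - 2 * alpha * x.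
      by rewrite /rhg_radius ln_div ?posrE // nx; ring.
    have -> : n%:R * (4 * expR (4 * alpha + 2 * alpha * ln nu - 2 * alpha * x)) =
        4 * expR (4 * alpha + 2 * alpha * ln nu) * expR (- ((2 * alpha - 1) * x)).
      have e : expR x * expR (4 * alpha + 2 * alpha * ln nu - 2 * alpha * x) =
          expR (4 * alpha + 2 * alpha * ln nu) * expR (- ((2 * alpha - 1) * x)).
        by rewrite -!expRD; congr expR; ring.
      by rewrite nE mulrCA e mulrA.
    rewrite expRN; apply: (div_le_third (expR_gt0 _) d0).
    by move: h7; rewrite expr0 mulr1.
have Kge : 256 / delta <= window_count n alpha (rhg_radius nu n) t.
  rewrite Kt expRD (_ : 256 / delta = 8 * (32 / delta)); last by field; rewrite gt_eqF.
  apply: ler_wpM2l; first exact: ler0n.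
  have hx : x ^+ m * expR (- (2 * alpha * ln x)) >= 1.
    rewrite -{1}lx -expRM_natl -expRD -[leLHS]expR0 ler_expR.
    by have := ln_ge0 x1; move: am; nra.
  apply: (@le_trans _ _ (32 / delta * (x ^+ m * expR (- (2 * alpha * ln x))))).
    by rewrite ler_peMr // divr_ge0 ?ler0n // ltW.
  by rewrite mulrA; apply: ler_wpM2r h8; exact: expR_ge0.
have K1 : 0 < 2 / delta by apply: divr_gt0 d0; rewrite ltr0n.
have Kd : 2 / delta <= window_count n alpha (rhg_radius nu n) t / 128.
  by rewrite ler_pdivlMr ?ltr0n //; apply: le_trans Kge; rewrite mulrAC -natrM.
apply: le_trans (ler_wpM2l (ler0n _ 2) (expRN_le K1 Kd)) _.
by rewrite invf_div mulrC divfK.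
Unshelve. all: by end_near. Qed.

End asymptotics.

Section window_error_choice.
Context (R : realType) (alpha L t eps S : R) (n g0 : nat).
Hypotheses (a12 : 1 / 2 < alpha) (e0 : 0 < eps) (e1 : eps <= 1 / 2) (S0 : 0 < S) (n0 : (0 < n)%N).
Local Notation K := (window_count n alpha L t).
Local Notation cb := (ball_mass_const alpha).
Local Notation sm := (strip_mass alpha).
Hypothesis DE : window_degree n t = S ^+ 2.
Hypothesis EE : expR (- (t / 2)) = S ^+ 2 / n%:R.
Hypothesis g0e : 2^-1 ^+ g0 <= eps.
Hypothesis hpairs : eps^-1 + g0%:R <= alpha ^+ 2 * K ^+ 2 * eps ^+ 2 / (2048 * S).
Hypothesis hn : 60 / n%:R <= eps.
Hypothesis hD : 32 * (S ^+ 2 / n%:R) <= eps.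
Hypothesis hS : eps^-1 + g0%:R <= S.
Hypothesis hK : 2 * alpha * expR alpha * K <= eps ^+ 2 * S.

Definition error_const : R := 4 + 2048 * expR (2 * alpha) * (1 + (4 * cb + 9 / Num.sqrt (sm / 24))).

(** Take [N] about [S / eps^2] cells and a threshold [m] about [eps S], where [S] is the square root
    of the degree. Then the effect of radii [S^2 / (N m)] and the anticoncentration bound [m / S]
    are of order [eps], and so is [K / m] as [K] is at most of order [eps^2 S]; cells with two nodes
    number about [K^2 eps^2 / S], large by [hpairs]. *)
Lemma window_error_choice : exists N m : nat,
  [/\ (0 < N)%N, 2 * alpha * expR alpha * K / N%:R <= 1 / 2, (g0 <= N)%N,
    g0%:R <= window_pairs n alpha L t N &
    window_error n alpha L t N m g0 <= eps * error_const].
Proof.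
have a0 : 0 < alpha by move: a12; lra.
have ei : 0 < eps^-1 by rewrite invr_gt0.
have gS : g0%:R <= S by apply: le_trans hS; rewrite lerDr ltW.
have eS : eps^-1 <= S by apply: le_trans hS; rewrite lerDl ler0n.
have eS1 : 1 <= eps * S by rewrite mulrC -ler_pdivrMr // mul1r.
have e20 : 0 < eps ^+ 2 by exact: exprn_gt0.
have e21 : eps ^+ 2 <= 1 / 2 by move: e0 e1; nra.
have S1 : 1 <= S by move: eS1 e1 S0; nra.
pose q := S / eps ^+ 2.
have q0 : 0 < q by exact: divr_gt0.
have Sq : S <= q by rewrite ler_pdivlMr //; move: S0 e21; nra.
pose N := (Num.truncn q).+1; pose m := Num.truncn (eps * S).
have Nq : q <= N%:R by apply: ltW; exact: truncnS_gt.
have N2 : N%:R <= 2 * q.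
  have h : (Num.truncn q)%:R <= q by rewrite truncn_le // ltW.
  by rewrite /N -natr1; move: h (le_trans S1 Sq); lra.
have mS : eps * S <= m.+1%:R by apply: ltW; exact: truncnS_gt.
have mS' : m%:R <= eps * S by rewrite truncn_le // mulr_ge0 // ltW.
have N0 : 0 < N%:R :> R by rewrite ltr0n.
have m0 : 0 < m.+1%:R :> R by rewrite ltr0n.
have nR : 0 < n%:R :> R by rewrite ltr0n.
have epS : 0 < eps * S by exact: mulr_gt0.
have P1 : eps^-1 + g0%:R <= window_pairs n alpha L t N.
  apply: (le_trans hpairs); rewrite /window_pairs.
  rewrite -(mulrA (alpha ^+ 2 * K ^+ 2)); apply: ler_wpM2l; first by rewrite mulr_ge0 ?sqr_ge0.
  rewrite ler_pdivrMr; last by apply: mulr_gt0 S0; rewrite ltr0n.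
  rewrite mulrC ler_pdivlMr; last by apply: mulr_gt0 N0; rewrite ltr0n.
  move: N2; rewrite /q mulrA ler_pdivlMr // => N2'.
  rewrite (_ : eps ^+ 2 * (1024 * N%:R) = 1024 * (N%:R * eps ^+ 2)); last by ring.
  rewrite (_ : 2048 * S = 1024 * (2 * S)); last by ring.
  by apply: ler_wpM2l N2'; exact: ler0n.
exists N, m; split=> //.
- rewrite ler_pdivrMr //; apply: le_trans hK _.
  by apply: (@le_trans _ _ (1 / 2 * q)); [move: e21 S0 Sq; nra|rewrite ler_pM2l // divr_gt0].
- by rewrite -(ler_nat R); apply: le_trans gS (le_trans Sq Nq).
- by apply: le_trans P1; rewrite lerDr ltW.
have T1 : (window_pairs n alpha L t N)^-1 <= eps.
  rewrite -[leRHS]invrK lef_pV2 ?posrE //.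
    by apply: le_trans P1; rewrite lerDl ler0n.
  by apply: lt_le_trans P1; rewrite ltr_pwDl.
have cb0 := ball_mass_const_gt0 a12; have sm0 := strip_mass_gt0 a12.
have T3 : 4 * cb * S ^+ 2 / (N%:R * m.+1%:R) <= 4 * cb * eps.
  rewrite -mulrA; apply: ler_wpM2l; first by rewrite mulr_ge0 ?ler0n // ltW.
  rewrite ler_pdivrMr; last exact: mulr_gt0.
  have h : q * (eps * S) <= N%:R * m.+1%:R by apply: ler_pM => //; exact: ltW.
  apply: (@le_trans _ _ (eps * (q * (eps * S)))); last by rewrite ler_pM2l.
  rewrite /q le_eqVlt; apply/orP; left; apply/eqP; field; by rewrite gt_eqF.
have s240 : 0 < sm / 24 by apply: divr_gt0 sm0 _; rewrite ltr0n.
have T4 : (8 * m + 1)%:R / Num.sqrt (sm / 24 * S ^+ 2) <= 9 / Num.sqrt (sm / 24) * eps.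
  rewrite sqrtrM; last exact: ltW.
  rewrite sqrtr_sqr (gtr0_norm S0) ler_pdivrMr; last by rewrite mulr_gt0 ?sqrtr_gt0.
  rewrite (_ : 9 / _ * eps * _ = 9 * (eps * S)); last by field; rewrite gt_eqF ?sqrtr_gt0.
  by rewrite natrD natrM; move: mS' eS1; lra.
have T5 : 2 * alpha * expR alpha * K / m.+1%:R <= eps.
  rewrite ler_pdivrMr //; apply: le_trans hK _.
  rewrite expr2 -mulrA; apply: ler_wpM2l mS; exact: ltW.
rewrite /window_error DE EE /error_const.
have T34 : 32 * (S ^+ 2 / n%:R) + (4 * cb * S ^+ 2 / (N%:R * m.+1%:R) +
    (8 * m + 1)%:R / Num.sqrt (sm / 24 * S ^+ 2)) <= eps * (1 + (4 * cb + 9 / Num.sqrt (sm / 24))).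
  rewrite (_ : eps * _ = eps + (4 * cb * eps + 9 / Num.sqrt (sm / 24) * eps)); last by ring.
  exact: lerD hD (lerD T3 T4).
have X0 : 0 <= 2048 * expR (2 * alpha) by rewrite mulr_ge0 ?ler0n ?expR_ge0.
have T6 := ler_wpM2l X0 T34.
have -> : eps * (4 + 2048 * expR (2 * alpha) * (1 + (4 * cb + 9 / Num.sqrt (sm / 24)))) =
  eps + eps + 2048 * expR (2 * alpha) * (eps * (1 + (4 * cb + 9 / Num.sqrt (sm / 24)))) + eps + eps by ring.
by apply: lerD => //; apply: lerD => //; apply: lerD => //; apply: lerD.
Qed.

End window_error_choice.

Lemma half_pow_small (R : realType) (eps : R) : 0 < eps -> exists g : nat, 2^-1 ^+ g <= eps.
Proof.
move=> e0; pose g := (Num.truncn eps^-1).+1; exists g.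
have h : eps^-1 <= 2 ^+ g.
  apply: (@le_trans _ _ g%:R); first by apply: ltW; exact: truncnS_gt.
  by rewrite -natrX ler_nat ltnW // ltn_expl.
by rewrite exprVn -[leRHS]invrK lef_pV2 ?posrE ?exprn_gt0 ?invr_gt0.
Qed.

Section window_error_limit.
Context (R : realType) (alpha nu : R).
Hypotheses (a12 : 1 / 2 < alpha) (nu0 : 0 < nu).
Local Notation beta := (1 / (1 + 8 * alpha)).
Let a0 : 0 < alpha. Proof. by move: a12; lra. Qed.
Let b1 : 1 + 8 * alpha != 0. Proof. by rewrite gt_eqF //; move: a0; lra. Qed.
Let b0 : 0 < beta. Proof. by apply: divr_gt0 => //; move: a0; lra. Qed.
Let cb := ball_mass_const alpha.
Let cb0 : 0 < cb. Proof. exact: ball_mass_const_gt0. Qed.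
Let a8 : R := nu * expR (- (ln 8 / (2 * alpha))).
Let a80 : 0 < a8. Proof. by rewrite mulr_gt0 ?expR_gt0. Qed.
Let r : R := Num.sqrt a8.
Let r0 : 0 < r. Proof. by rewrite sqrtr_gt0. Qed.
Let r2 : r ^+ 2 = a8. Proof. by rewrite sqr_sqrtr // ltW. Qed.

(** The factor [exp(- ln w / (2 alpha))] of the degree lies in [[1 / w, 1]]; the bounds are written
    as squares to be read on its square root. *)
Let window_degree_bounds (n : nat) (w : R) : (0 < n)%N -> 1 <= w ->
  let D := window_degree n (window_start alpha nu n (ln w)) in let x := ln n%:R in
  (r * expR (2 * beta * x) / w) ^+ 2 <= D /\ D <= (r * expR (2 * beta * x)) ^+ 2.
Proof.
move=> n0 w1 D x; have w0 : 0 < w by apply: lt_le_trans w1.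
have [_ + _] := window_startE a12 nu0 (ln w) n0; rewrite -/D -/x => DE.
pose u := expR (- (ln w / (2 * alpha))).
have DE' : D = (r * expR (2 * beta * x)) ^+ 2 * u.
  have an0 : alpha != 0 by rewrite gt_eqF.
  have e : expR (4 * beta * x - (ln 8 + ln w) / (2 * alpha)) =
      expR (- (ln 8 / (2 * alpha))) * expR (4 * beta * x) * u.
    by rewrite /u -!expRD; congr expR; field; rewrite an0.
  have e2 : expR (2 * beta * x) ^+ 2 = expR (4 * beta * x).
    by rewrite -expRM_natl; congr expR; ring.
  by rewrite DE e exprMn e2 r2 /a8; ring.
have lw : 0 <= ln w by exact: ln_ge0.
have u1 : u <= 1.
  by rewrite -expR0 ler_expR oppr_le0 divr_ge0 // mulr_ge0 ?ler0n // ltW.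
have uw : w^-1 <= u.
  rewrite -[X in X^-1](lnK (_ : w \in Num.pos)) ?posrE // -expRN ler_expR lerN2.
  by rewrite ler_pdivrMr ?mulr_gt0 ?ltr0n // ler_peMr //; move: a12; lra.
have A0 : 0 <= (r * expR (2 * beta * x)) ^+ 2 by exact: sqr_ge0.
rewrite DE'; split; last by rewrite ler_piMr.
rewrite exprMn; apply: ler_wpM2l => //; apply: le_trans uw.
by rewrite exprVn lef_pV2 ?posrE ?exprn_gt0 // expr2 ler_peMr // ltW.
Qed.

(** At the critical exponent [K^2] is of order [w^2 n^(2 beta)] and the square root of the degree at
    most of order [n^(2 beta)], so [hpairs] gains only from [w] being large. In the other conditions
    [w <= x] makes powers of [w] negligible against exponentials. *)
Lemma window_error_small (delta : R) : 0 < delta -> exists w0 : R, \forall x \near +oo,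
  forall (n : nat) (w : R), (0 < n)%N -> ln n%:R = x -> w0 <= w -> w <= x ->
  let t := window_start alpha nu n (ln w) in
  let K := window_count n alpha (rhg_radius nu n) t in
  exists N m g0 : nat, [/\ [/\ 1 <= w, 4 <= t, t + 2 <= rhg_radius nu n & (0 < N)%N],
    2 * alpha * expR alpha * K / N%:R <= 1 / 2,
    4 * cb * expR (- (t / 2)) <= 1 &
    [/\ (g0 <= N)%N, g0%:R <= window_pairs n alpha (rhg_radius nu n) t N,
      window_error n alpha (rhg_radius nu n) t N m g0 <= delta &
      2 * expR (- (K / 128)) <= delta]].
Proof.
move=> d0.
have sm0 := strip_mass_gt0 a12.
have ec0 : 0 < error_const alpha.
  rewrite /error_const; apply: ltr_pwDl; first by rewrite ltr0n.
  apply: mulr_ge0; first by apply: mulr_ge0 (expR_ge0 _); exact: ler0n.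
  apply: addr_ge0; first exact: ler01.
  apply: addr_ge0; first by apply: mulr_ge0 (ltW cb0); exact: ler0n.
  by apply: divr_ge0 (sqrtr_ge0 _); exact: ler0n.
pose eps := Num.min (1 / 2) (delta / error_const alpha).
have e0 : 0 < eps by rewrite lt_min divr_gt0 ?ltr0n // divr_gt0.
have e1 : eps <= 1 / 2 by rewrite ge_min lexx.
have e2 : eps * error_const alpha <= delta.
  by rewrite -ler_pdivlMr // ge_min lexx orbT.
have [g0 hg0] := half_pow_small e0.
pose C0 := eps^-1 + g0%:R.
have C00 : 0 < C0 by rewrite ltr_pwDl ?invr_gt0.
have c4 : 0 < 1 - 4 * beta.
  have h : 0 < 1 + 8 * alpha by move: a0; lra.
  rewrite subr_gt0 mulrA mulr1 ltr_pdivrMr // mul1r; move: a12; lra.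
have b4 : 0 < 4 * beta by move: b0; lra.
have b2 : 0 < 2 * beta by move: b0; lra.
have ae0 : 0 < alpha ^+ 2 * eps ^+ 2 by apply: mulr_gt0; exact: exprn_gt0.
(* The second term is what [hpairs] requires of [w]; the first ensures [w >= 1]. *)
exists (1 + 32 * r * C0 / (alpha ^+ 2 * eps ^+ 2)).
near=> x.
have x1 : 1 <= x by near: x; exact: nbhs_pinfty_ge (num_real _).
have N1 : (16 * a8) * x ^+ 0 <= expR ((1 - 4 * beta) * x) by near: x; exact: pow_le_expR.
have N2 : (32 * a8 / eps) * x ^+ 0 <= expR ((1 - 4 * beta) * x) by near: x; exact: pow_le_expR.
have N3 : (4 * cb * a8) * x ^+ 0 <= expR ((1 - 4 * beta) * x) by near: x; exact: pow_le_expR.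
have N4 : (4 * nu / a8) * x ^+ 2 <= expR (4 * beta * x) by near: x; exact: pow_le_expR.
have N5 : (C0 / r) * x ^+ 1 <= expR (2 * beta * x) by near: x; exact: pow_le_expR.
have N6 : (16 * alpha * expR alpha / (eps ^+ 2 * r)) * x ^+ 2 <= expR (beta * x) by near: x; exact: pow_le_expR.
have N7 : (60 / eps) * x ^+ 0 <= expR (1 * x) by near: x; exact: pow_le_expR.
have N8 : (32 / delta) * x ^+ 0 <= expR (beta * x) by near: x; exact: pow_le_expR.
move=> n w n0 nx w0w wx; set t := window_start alpha nu n (ln w).
have cpos : 0 <= 32 * r * C0 / (alpha ^+ 2 * eps ^+ 2).
  apply: divr_ge0; last exact: ltW.
  by apply: mulr_ge0 (ltW C00); apply: mulr_ge0 (ltW r0); exact: ler0n.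
have w1 : 1 <= w by apply: le_trans w0w; rewrite lerDl.
have wC : 32 * r * C0 / (alpha ^+ 2 * eps ^+ 2) <= w by apply: le_trans w0w; rewrite lerDr ler01.
have w0 : 0 < w by apply: lt_le_trans w1.
have x0 : 0 < x by apply: lt_le_trans x1.
have nR : 0 < n%:R :> R by rewrite ltr0n.
have nE : n%:R = expR x by rewrite -nx lnK ?posrE.
have [Kt _ et] := window_startE a12 nu0 (ln w) n0; rewrite -/t nx in Kt et.
have {}Kt : window_count n alpha (rhg_radius nu n) t = 8 * expR (beta * x) * w.
  by rewrite Kt expRD lnK ?posrE // mulrA.
have [Dlo Dhi] := window_degree_bounds n0 w1; rewrite -/t nx in Dlo Dhi.
set D := window_degree n t in et Dlo Dhi.
set E := expR (2 * beta * x) in N5 Dlo Dhi.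
have E0 : 0 < E by exact: expR_gt0.
have E2 : E ^+ 2 = expR (4 * beta * x) by rewrite /E -expRM_natl; congr expR; ring.
have EB : E = expR (beta * x) ^+ 2 by rewrite /E -expRM_natl; congr expR; ring.
set F := expR (beta * x) in N6 N8 Kt EB.
have F0 : 0 < F by exact: expR_gt0.
have Dhi' : D <= a8 * E ^+ 2 by move: Dhi; rewrite exprMn r2.
have D0 : 0 < D.
  by apply: lt_le_trans Dlo; apply: exprn_gt0; apply: divr_gt0 w0; exact: mulr_gt0.
have nDE : n%:R = expR ((1 - 4 * beta) * x) * E ^+ 2.
  by rewrite nE E2 -expRD; congr expR; ring.
have Dn (c : R) : 0 <= c -> (c * a8) * x ^+ 0 <= expR ((1 - 4 * beta) * x) -> c * D <= n%:R.
  move=> c0; rewrite expr0 mulr1 => h; rewrite nDE.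
  apply: (@le_trans _ _ (c * (a8 * E ^+ 2))); first exact: ler_wpM2l.
  by rewrite mulrA; apply: ler_wpM2r h; exact: sqr_ge0.
have D16 : 16 * D <= n%:R by apply: Dn N1; exact: ler0n.
have D4 : 4 * nu <= D.
  apply: le_trans Dlo; rewrite exprMn exprVn ler_pdivlMr ?exprn_gt0 // exprMn r2 E2.
  move: N4; rewrite mulrAC ler_pdivrMr // [_ * a8]mulrC => h.
  apply: le_trans h; apply: ler_wpM2l; first by rewrite mulr_ge0 ?ler0n // ltW.
  exact: lerXn2r _ (ltW w0) (ltW x0) wx.
have [t4 t2] := window_start_bounds a12 nu0 n0 D4 D16.
pose S := Num.sqrt D.
have S0 : 0 < S by rewrite sqrtr_gt0.
have S2 : S ^+ 2 = D by rewrite sqr_sqrtr // ltW.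
have Slo : r * E / w <= S.
  rewrite -[leLHS]ger0_norm -?sqrtr_sqr; first exact: ler_wsqrtr.
  by apply: divr_ge0 (ltW w0); apply: mulr_ge0; exact: ltW.
have Shi : S <= r * E.
  rewrite -[leRHS]ger0_norm -?sqrtr_sqr; first exact: ler_wsqrtr.
  by apply: mulr_ge0; exact: ltW.
have hn : 60 / n%:R <= eps.
  rewrite nE ler_pdivrMr ?expR_gt0 // mulrC -ler_pdivrMr //.
  by move: N7; rewrite expr0 mulr1 mul1r.
have hD : 32 * (S ^+ 2 / n%:R) <= eps.
  have h : 32 / eps * D <= n%:R.
    apply: Dn; first by apply: divr_ge0; [exact: ler0n|exact: ltW].
    by rewrite (mulrAC 32).
  by rewrite S2 mulrA ler_pdivrMr // (mulrC eps); move: h; rewrite mulrAC ler_pdivrMr.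
have hS : C0 <= S.
  apply: le_trans Slo; rewrite ler_pdivlMr //; move: N5; rewrite expr1 mulrAC ler_pdivrMr // [E * r]mulrC.
  by apply: le_trans; apply: ler_wpM2l wx; exact: ltW.
have hK : 2 * alpha * expR alpha * window_count n alpha (rhg_radius nu n) t <= eps ^+ 2 * S.
  have s2 : 0 < eps ^+ 2 by exact: exprn_gt0.
  apply: le_trans (ler_wpM2l (ltW s2) Slo); rewrite Kt (mulrA (eps ^+ 2)) ler_pdivlMr // EB.
  rewrite (_ : 2 * alpha * expR alpha * (8 * F * w) * w = (16 * alpha * expR alpha * w ^+ 2) * F); last by ring.
  rewrite (_ : eps ^+ 2 * (r * F ^+ 2) = F * (eps ^+ 2 * r) * F); last by ring.
  rewrite ler_pM2r //; move: N6; rewrite mulrAC (ler_pdivrMr _ _ (mulr_gt0 s2 r0)); apply: le_trans.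
  apply: ler_wpM2l; last exact: lerXn2r _ (ltW w0) (ltW x0) wx.
  by apply: mulr_ge0 (expR_ge0 _); apply: mulr_ge0 (ltW a0); exact: ler0n.
have hpairs : C0 <= alpha ^+ 2 * window_count n alpha (rhg_radius nu n) t ^+ 2 * eps ^+ 2 / (2048 * S).
  have S20 : 0 < 2048 * S by apply: mulr_gt0 S0; rewrite ltr0n.
  rewrite ler_pdivlMr //; apply: (@le_trans _ _ (C0 * (2048 * (r * E)))).
    by apply: ler_wpM2l; [exact: ltW|apply: ler_wpM2l Shi; exact: ler0n].
  rewrite Kt (_ : alpha ^+ 2 * _ * _ = 64 * (alpha ^+ 2 * eps ^+ 2) * (w * w) * E); last by rewrite EB; ring.
  rewrite (_ : C0 * _ = 64 * (32 * r * C0) * E); last by ring.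
  rewrite ler_pM2r // -[leRHS]mulrA; apply: ler_wpM2l; first exact: ler0n.
  move: wC; rewrite ler_pdivrMr // => h; apply: (le_trans h).
  by rewrite [leLHS]mulrC; apply: ler_wpM2l; [exact: ltW|rewrite ler_peMr // ltW].
have DS : window_degree n t = S ^+ 2 by rewrite S2.
have ES : expR (- (t / 2)) = S ^+ 2 / n%:R by rewrite S2.
have [N [m [h1 h2 h3 h4 h5]]] := window_error_choice a12 e0 e1 S0 n0 DS ES hg0 hpairs hn hD hS hK.
exists N, m, g0; split=> //; last split=> //.
- rewrite et mulrA ler_pdivrMr // [leRHS]mul1r; apply: Dn N3.
  by rewrite mulr_ge0 ?ler0n // ltW.
- exact: le_trans h5 e2.
have Kge : 256 / delta <= window_count n alpha (rhg_radius nu n) t.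
  rewrite Kt (_ : 256 / delta = 8 * (32 / delta)); last by field; rewrite gt_eqF.
  apply: (@le_trans _ _ (8 * F)); last by rewrite ler_peMr // mulr_ge0 ?ler0n // ltW.
  by apply: ler_wpM2l; [exact: ler0n|move: N8; rewrite expr0 mulr1].
have K1 : 0 < 2 / delta by apply: divr_gt0 d0; rewrite ltr0n.
have Kd : 2 / delta <= window_count n alpha (rhg_radius nu n) t / 128.
  by rewrite ler_pdivlMr ?ltr0n //; apply: le_trans Kge; rewrite mulrAC -natrM.
apply: le_trans (ler_wpM2l (ler0n _ 2) (expRN_le K1 Kd)) _.
by rewrite invf_div mulrC divfK.
Unshelve. all: by end_near. Qed.

End window_error_limit.

Lemma near_ln_nat (R : realType) (Q : R -> Prop) :
  (\forall x \near +oo, Q x) -> \forall n \near \oo, (0 < n)%N /\ Q (ln n%:R).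
Proof.
move=> [M [_ hM]]; near=> n.
have h : expR M < n%:R by near: n; exact: nbhs_infty_gtr.
have n0 : 0 < n%:R :> R by apply: lt_trans h; exact: expR_gt0.
split; first by rewrite -(ltr0n R).
by apply: hM; rewrite -ltr_expR lnK ?posrE.
Unshelve. all: by end_near. Qed.

(** The probability space and [v] vary with [n], so they are quantified after the threshold on
    [x = ln n]; the estimate sees [v] only through its lower bound. *)
Lemma degree_event_limit (R : realType) (alpha nu e : R) : 1 / 2 < alpha -> 0 < nu -> 0 < e ->
  exists B : R, \forall x \near +oo, forall (n : nat) (v : R) d (T : measurableType d)
    (P : probability T R) (X : 'I_n -> {RV P >-> (R * R)%type}),
  (0 < n)%N -> ln (n%:R : R) = x -> B <= v -> rhg_nodes alpha nu X ->
  let beta : R := 1 / (1 + 8 * alpha) in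
  let k := Num.truncn (n%:R `^ beta * (ln n%:R) `^ (- (2 * alpha))) in
  1 - e <= pr P [set w | degree_event nu k (n%:R `^ beta) (n%:R `^ beta * v) (fun i => X i w)].
Proof.
move=> a12 nu0 e0; pose delta := e / 5.
have d0 : 0 < delta by rewrite divr_gt0 ?ltr0n.
have a0 : 0 < alpha by move: a12; lra.
have [w0 hw] := window_error_small a12 nu0 d0.
have ht := top_error_small a12 nu0 d0.
pose B : R := `|w0| + 1 + 32 * expR alpha / delta.
have c0 : 0 <= 32 * expR alpha / delta.
  by apply: divr_ge0 (ltW d0); apply: mulr_ge0 (expR_ge0 _); exact: ler0n.
have B0 : 0 < B by apply: ltr_pwDl c0; exact: ltr_wpDl.
exists (B ^+ 2); apply: filter_app hw; apply: filter_app ht; near=> x => h2 h1.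
have xB : B <= x by near: x; exact: nbhs_pinfty_ge (num_real _).
have xnu : 4 + ln nu <= x by near: x; exact: nbhs_pinfty_ge (num_real _).
have x1 : 1 <= x by near: x; exact: nbhs_pinfty_ge (num_real _).
move=> n v d T P X n0 nx vB iX; set k := Num.truncn _.
have x0 : 0 < x by apply: lt_le_trans x1.
have nR : 0 < n%:R :> R by rewrite ltr0n.
have nE : n%:R = expR x by rewrite -nx lnK ?posrE.
have n2 : (1 < n)%N by rewrite -(ltr_nat R) nE expR_gt1.
have L8 : 8 <= rhg_radius nu n.
  by rewrite /rhg_radius ln_div ?posrE // nx; move: xnu; lra.
have v0 : 0 < v by apply: lt_le_trans vB; exact: exprn_gt0.
have sB : B <= Num.sqrt v.
  by rewrite -[leLHS](gtr0_norm B0) -sqrtr_sqr; exact: ler_wsqrtr.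
have s0 : 0 < Num.sqrt v by rewrite sqrtr_gt0.
(* At most [ln n], as the window estimates ask, and smaller than [v] by a factor at least [sqrt v],
   so that Markov's inequality keeps the window within rank [n^beta v]. *)
pose w := Num.min x (Num.sqrt v).
have Bw : w0 <= B.
  by apply: le_trans (ler_norm _) _; rewrite /B -addrA lerDl addr_ge0.
have w0w : w0 <= w by rewrite le_min (le_trans Bw xB) (le_trans Bw sB).
have wx : w <= x by rewrite ge_min lexx.
have ws : w <= Num.sqrt v by rewrite ge_min lexx orbT.
have [N [m [g0 [[w1 t04 t0L N0] hKN hB [gN gp we wK]]]]] := h1 n w n0 nx w0w wx.
have [eta [t4 tL eta0 eta1 [hl he te tK]]] := h2 n n0 nx.
have wpos : 0 < w by apply: lt_le_trans w1.
set t0 := window_start alpha nu n (ln w) in t04 t0L hKN hB gp we wK.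
set t := window_start alpha nu n (- (2 * alpha * ln x)) in t4 tL hl he te tK.
have [Kt _ _] := window_startE a12 nu0 (- (2 * alpha * ln x)) n0; rewrite -/t nx in Kt.
have [K0 _ _] := window_startE a12 nu0 (ln w) n0; rewrite -/t0 nx in K0.
set beta := 1 / (1 + 8 * alpha) in Kt K0 *.
have nb : n%:R `^ beta = expR (beta * x) by rewrite /powR gt_eqF // nx.
have xb : x `^ (- (2 * alpha)) = expR (- (2 * alpha * ln x)) by rewrite /powR gt_eqF // mulNr.
have kK : k%:R <= window_count n alpha (rhg_radius nu n) t / 8.
  rewrite Kt (mulrC 8) mulfK ?pnatr_eq0 // expRD -nb -xb -nx /k truncn_le //.
  by rewrite mulr_ge0 ?powR_ge0.
have K0' : window_count n alpha (rhg_radius nu n) t0 = 8 * (n%:R `^ beta * w).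
  by rewrite K0 nb expRD lnK ?posrE.
have nb0 : 0 < n%:R `^ beta by rewrite nb expR_gt0.
have lo : n%:R `^ beta <= window_count n alpha (rhg_radius nu n) t0 / 8.
  by rewrite K0' (mulrC 8) mulfK ?pnatr_eq0 // ler_peMr // ltW.
have hi0 : 0 < n%:R `^ beta * v by exact: mulr_gt0.
have tL1 : t + 1 <= rhg_radius nu n by apply: le_trans tL; rewrite lerD2l ler1n.
have hhi : 4 * expR alpha * window_count n alpha (rhg_radius nu n) t0 / (n%:R `^ beta * v) <= delta.
  rewrite K0' ler_pdivrMr //.
  rewrite (_ : 4 * _ * _ = n%:R `^ beta * (32 * expR alpha * w)); last by ring.
  rewrite (mulrCA delta); apply: ler_wpM2l; first exact: ltW.
  have vv : v = Num.sqrt v * Num.sqrt v by rewrite -expr2 sqr_sqrtr // ltW.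
  rewrite [X in _ <= _ * X]vv mulrA.
  have c32 : 0 <= 32 * expR alpha by apply: mulr_ge0 (expR_ge0 _); exact: ler0n.
  apply: (ler_pM c32 (ltW wpos) _ ws).
  rewrite (mulrC delta) -ler_pdivrMr //; apply: le_trans sB.
  by rewrite /B lerDr addr_ge0.
have main := degree_event_prob a12 L8 n2 iX m t4 tL1 eta0 eta1 x0 hl he kK N0 t04 t0L hKN hB gN gp lo hi0.
apply: le_trans main; rewrite lerD2l lerN2.
have -> : e = delta + delta + delta + delta + delta by rewrite /delta; field.
by apply: lerD hhi; apply: lerD wK; apply: lerD we; apply: lerD.
Unshelve. all: by end_near. Qed.

Theorem theorem3p2 (R : realType) (alpha nu : R) (v : nat -> R)
    (d : nat -> measure_display) (T : forall n : nat, measurableType (d n))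
    (P : forall n : nat, probability (T n) R)
    (X : forall n : nat, 'I_n -> {RV (P n) >-> (R * R)%type}) :
  1 / 2 < alpha -> 0 < nu ->
  v n @[n --> \oo] --> +oo ->
  (forall n : nat, nu < n%:R -> rhg_nodes alpha nu (X n)) ->
  let beta : R := 1 / (1 + 8 * alpha) in
  let k (n : nat) : nat :=
    Num.truncn (n%:R `^ beta * (ln n%:R) `^ (- (2 * alpha))) in
  P n [set w : T n |
    forall s : 'S_n, radius_ordering (fun i => X n i w) s ->
    let D (i : 'I_n) : nat := rhg_deg nu (fun j => X n j w) (s i) in
    (forall i : 'I_n, (k n < i.+1)%N ->
       (forall a b : 'I_n, b = a.+1 :> nat -> (b.+1 <= k n)%N ->
          (D b < D a)%N) /\
       (forall a : 'I_n, a.+1 = k n -> (D i < D a)%N)) /\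
    (exists a b : 'I_n, [/\ b = a.+1 :> nat,
       n%:R `^ beta <= a.+1%:R <= n%:R `^ beta * v n & (D a < D b)%N])]
  @[n --> \oo] --> 1%E.
Proof.
move=> a12 nu0 hv hX beta k.
pose S n : set (T n) := [set w | degree_event nu (k n) (n%:R `^ beta) (n%:R `^ beta * v n) (fun i => X n i w)].
have mS n : measurable (S n) by apply: measurable_degree_event.
suff h : P n (S n) @[n --> \oo] --> 1%E by exact: h.
have fS : \forall n \near \oo, P n (S n) \is a fin_num.
  by apply: nearW => n; rewrite fin_num_measure.
(* As probabilities are at most 1, convergence to 1 amounts to the lower bounds [1 - e]. *)
apply: (cvg_EFin fS); apply/cvgrPdist_le => e e0.
have [B hB] := degree_event_limit a12 nu0 e0.
apply: filter_app (near_ln_nat hB); near=> n => -[n0 h].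
have vn : B <= v n by near: n; move/cvgryPge : hv; apply.
have nun : nu < n%:R by near: n; exact: nbhs_infty_gtr.
have := h n (v n) _ _ (P n) (X n) n0 erefl vn (hX n nun).
have p1 : pr (P n) (S n) <= 1 by exact: pr_le1.
change (1 - e <= pr (P n) (S n) -> `|1 - pr (P n) (S n)| <= e).
by move=> h'; rewrite ger0_norm ?subr_ge0 // lerBlDr -lerBlDl.
Unshelve. all: by end_near. Qed.
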